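(* Let $F=\mathbb{Q}(\zeta_9)$, $K=\mathbb{Q}(\zeta_9+\zeta_9^{-1})$, $\Lambda=\frac13(1-\zeta_9)(1-\zeta_9^{-1})\mathbb{Z}_F$, and let $C$ be a Euclidean self-dual $\mathbb{Z}/3\mathbb{Z}$-code of length $n\ge1$. With $\mathfrak{L}$, $\theta_a$ and $\theta_C$ as defined in the context: 1. For $a\in\{0,1\}$, the function $\theta_a:\mathbb{H}^{\oplus3}\to\mathbb{C}$ is a Hilbert modular form of weight $1$ for the group $\Gamma(\mathfrak{L})$. 2. The function $\theta_C:\mathbb{H}^{\oplus3}\to\mathbb{C}$ is a Hilbert modular form of weight $n$ for the whole group $\mathrm{SL}_2(\mathbb{Z}_K)$.
   Context: $\zeta_9=\exp(2\pi\sqrt{-1}/9)$; $\mathbb{Z}_F,\mathbb{Z}_K$ are the rings of integers; $\mathbb{H}$ is the upper half plane; bar is complex conjugation. $\mathrm{Gal}(K/\mathbb{Q})=\{\sigma_1=\mathrm{id},\sigma_2,\sigma_3\}$. **Hilbert modular forms.** $\mathrm{SL}_2(\mathbb{Z}_K)$ acts on $\mathbb{H}^{\oplus3}$ by $z_l\mapsto\frac{\sigma_l(\alpha)z_l+\sigma_l(\beta)}{\sigma_l(\gamma)z_l+\sigma_l(\delta)}$, and $N_{K/\mathbb{Q}}(\gamma z+\delta)=\prod_{l}(\sigma_l(\gamma)z_l+\sigma_l(\delta))$. For a subgroup $\Gamma\subset\mathrm{SL}_2(\mathbb{Z}_K)$, a holomorphic $f:\mathbb{H}^{\oplus3}\to\mathbb{C}$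 is a Hilbert modular form of weight $k$ for $\Gamma$ if $f\big(\frac{\alpha z+\beta}{\gamma z+\delta}\big)=N_{K/\mathbb{Q}}(\gamma z+\delta)^k f(z)$ for all $\begin{pmatrix}\alpha&\beta\\\gamma&\delta\end{pmatrix}\in\Gamma$. For an ideal $\mathfrak{L}$ of $\mathbb{Z}_K$, $\Gamma(\mathfrak{L})$ is the subgroup of matrices in $\mathrm{SL}_2(\mathbb{Z}_K)$ with $\alpha\equiv\delta\equiv1$, $\beta\equiv\gamma\equiv0\pmod{\mathfrak{L}}$. Here $\mathfrak{L}=(1-\zeta_9)(1-\zeta_9^{-1})\mathbb{Z}_K$ (the level of $\Lambda$). **The lattice.** $\Lambda$ carries the form $(x,y)\mapsto\mathrm{Tr}_{F/\mathbb{Q}}(x\bar y)$, for which it is a lattice of type $E_6$ with $\mathbb{Z}$-basis $f_i=\frac13(1-\zeta_9)(1-\zeta_9^2)\zeta_9^{i-1}$ ($1\le i\le6$). Its dual $\Lambda^*=\{x\in F:\mathrm{Tr}_{F/\mathbb{Q}}(x\bar y)\in\mathbb{Z}\ \forall y\in\Lambda\}$ has the dual basis $f_i^*=\frac13(1-\zeta_9^4)\zeta_9^{i-3}$ for $1\le i\le3$ and $f_i^*=\frac13(1-\zeta_9^4)(\zeta_9^{i-3}+\zeta_9^{i-6})$ for $4\le i\le6$. **Codes.** A $\mathbb{Z}/3\mathbb{Z}$-code of length $n$ is a submodule $C$ of $(\mathbb{Z}/3\mathbb{Z})^{\oplus n}$; it is Euclidean self-dual if $C=C^\perp=\{x:\sum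 x_iy_i=0\ \forall y\in C\}$. Define the additive map $\rho^{\oplus n}:(\Lambda^* )^{\oplus n}\to(\mathbb{Z}/3\mathbb{Z})^{\oplus n}$ by $$\Big(\sum_{j=1}^6x_{ij}f_j^*\Big)_{1\le i\le n}\mapsto\Big(\sum_{j=1}^3x_{ij}-\sum_{j=4}^6x_{ij}\bmod3\Big)_{1\le i\le n}\qquad(x_{ij}\in\mathbb{Z}),$$ and $\Gamma_C=(\rho^{\oplus n})^{-1}(C)\subset F^{\oplus n}$. **Theta functions.** On $F^{\oplus n}$ (a $K$-vector space) put $v\cdot w=\sum_{i=1}^n(v_i\overline{w_i}+\overline{v_i}w_i)\in K$. For $z=(z_1,z_2,z_3)\in\mathbb{H}^{\oplus3}$ put $\mathrm{Tr}_{K/\mathbb{Q}}(zx^2)=\sum_{l=1}^3z_l\sigma_l(x\cdot x)$. Let $x_0=0$, $x_1=f_1^*$, $x_2=-f_1^*$. For $a=0,1,2$, $$\theta_a(z)=\sum_{x\in x_a+\Lambda}\exp(\pi\sqrt{-1}\,\mathrm{Tr}_{K/\mathbb{Q}}(zx^2)),\qquad\theta_C(z)=\sum_{x\in\Gamma_C}\exp(\pi\sqrt{-1}\,\mathrm{Tr}_{K/\mathbb{Q}}(zx^2)).$$ *)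

(* Defs.v *)
From HB Require Import structures.
From mathcomp Require Import all_boot all_order all_algebra all_fingroup all_field.
From mathcomp Require Import complex.
From mathcomp Require Import all_classical all_reals all_analysis.
From mathcomp Require Import summability.

Set Implicit Arguments.
Unset Strict Implicit.
Unset Printing Implicit Defensive.

Import Order.TTheory GRing.Theory Num.Theory numFieldNormedType.Exports.
Local Open Scope classical_set_scope.
Local Open Scope ring_scope.

(* R[i] seen through its numClosedFieldType structure: in this form the
   normed-module instances of numFieldNormedType apply to it. *)
Definition Cplx (R : realType) : numClosedFieldType := R[i].

Definition cexp (R : realType) (w : Cplx R) : Cplx R :=
  Complex (expR (complex.Re w) * cos (complex.Im w))
          (expR (complex.Re w) * sin (complex.Im w)).

(* Q(zeta_9) is an abstract extension F of rat generated by zeta, embedded in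
   the complex numbers by iota with iota zeta = exp (2 pi i / 9). *)
Definition is_Q_zeta9 (R : realType) (F : splittingFieldType rat)
    (iota : {rmorphism F -> Cplx R}) (zeta : F) : Prop :=
  <<1; zeta>>%VS = fullv /\ iota zeta = cexp (Complex 0 (2 * pi / 9)).

Definition realSubfield (F : splittingFieldType rat) (zeta : F) : {subfield F} :=
  <<1; zeta + zeta^-1>>%AS.

Definition is_gal_enum (F : splittingFieldType rat) (zeta : F)
    (sigma : 'I_3 -> gal_of (realSubfield zeta)) : Prop :=
  [/\ injective sigma,
      [set sigma l | l in [set: 'I_3]]%SET = 'Gal(realSubfield zeta / 1)%g
    & sigma ord0 = 1%g].

Definition ringOfIntegersF (F : splittingFieldType rat) : set F :=
  [set x | integralOver (intr : int -> F) x].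

Definition ringOfIntegersK (F : splittingFieldType rat) (zeta : F) : set F :=
  [set x | x \in realSubfield zeta /\ integralOver (intr : int -> F) x].

Definition levelIdeal (F : splittingFieldType rat) (zeta : F) : set F :=
  [set (1 - zeta) * (1 - zeta^-1) * y | y in ringOfIntegersK zeta].

Section HilbertModularForms.
Variables (R : realType) (F : splittingFieldType rat).
Variables (iota : {rmorphism F -> Cplx R}) (zeta : F).
Variable sigma : 'I_3 -> gal_of (realSubfield zeta).

Definition upperHalfPlane3 : set 'rV[Cplx R]_3 :=
  [set z : 'rV[Cplx R]_3 | forall l, 0 < complex.Im (z 0 l)].

Definition SL2_ZK : set 'M[F]_2 :=
  [set M : 'M[F]_2 | (forall i j, ringOfIntegersK zeta (M i j)) /\ \det M = 1].

Definition GammaLevel (L : set F) : set 'M[F]_2 :=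
  [set M : 'M[F]_2 |
    [/\ SL2_ZK M, L (M 0 0 - 1), L (M 1 1 - 1), L (M 0 1) & L (M 1 0)]].

Definition moebius (M : 'M[F]_2) (z : 'rV[Cplx R]_3) : 'rV[Cplx R]_3 :=
  \row_l ((iota (sigma l (M 0 0)) * z 0 l + iota (sigma l (M 0 1))) /
          (iota (sigma l (M 1 0)) * z 0 l + iota (sigma l (M 1 1)))).

Definition normFactor (M : 'M[F]_2) (z : 'rV[Cplx R]_3) : Cplx R :=
  \prod_(l < 3) (iota (sigma l (M 1 0)) * z 0 l + iota (sigma l (M 1 1))).

(* The values of f outside the (open) domain upperHalfPlane3 play no role. *)
Definition isHilbertModularForm (k : nat) (Gamma : set 'M[F]_2)
    (f : 'rV[Cplx R]_3 -> Cplx R) : Prop :=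
  (forall z, upperHalfPlane3 z -> differentiable f z) /\
  (forall M, Gamma M -> forall z, upperHalfPlane3 z ->
     f (moebius M z) = normFactor M z ^+ k * f z).

End HilbertModularForms.

Section LatticeAndTheta.
Variables (R : realType) (F : splittingFieldType rat).
Variables (iota : {rmorphism F -> Cplx R}) (zeta : F).
Variable sigma : 'I_3 -> gal_of (realSubfield zeta).

(* The complex conjugation of iota F, transported to F. *)
Definition conjF (x : F) : F := xget 0 [set y | iota y = (iota x)^*].

Definition Lambda : set F :=
  [set 3^-1 * (1 - zeta) * (1 - zeta^-1) * y | y in @ringOfIntegersF F].

Definition dualLambda : set F :=
  [set x | forall y, Lambda y ->
     exists m : int, galTrace 1 fullv (x * conjF y) = m%:~R].

(* The index j : 'I_6 stands for the index j + 1 of the dual basis. *)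
Definition fdual (j : 'I_6) : F :=
  3^-1 * (1 - zeta ^+ 4) *
  (if (j < 3)%N then zeta ^ (j.+1%:Z - 3)
   else zeta ^ (j.+1%:Z - 3) + zeta ^ (j.+1%:Z - 6)).

(* Meaningful for x in dualLambda, of which fdual is a Z-basis. *)
Definition fdual_coords (x : F) : 'rV[int]_6 :=
  xget 0 [set c : 'rV[int]_6 | x = \sum_(j < 6) (c 0 j)%:~R * fdual j].

Definition rho (x : F) : 'F_3 :=
  let c := fdual_coords x in
  (\sum_(j < 6 | (j < 3)%N) c 0 j - \sum_(j < 6 | (3 <= j)%N) c 0 j)%:~R.

Definition GammaCode (n : nat) (C : {vspace 'rV['F_3]_n}) : set 'rV[F]_n :=
  [set v : 'rV[F]_n |
    (forall i, dualLambda (v 0 i)) /\ \row_i rho (v 0 i) \in C].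

Definition dotF (n : nat) (v w : 'rV[F]_n) : F :=
  \sum_(i < n) (v 0 i * conjF (w 0 i) + conjF (v 0 i) * w 0 i).

Definition trzsq (n : nat) (z : 'rV[Cplx R]_3) (x : 'rV[F]_n) : Cplx R :=
  \sum_(l < 3) z 0 l * iota (sigma l (dotF x x)).

(* summability.sum is the limit of the net of finite partial sums; the summand
   is extended by 0 outside A. *)
Definition thetaSeries (n : nat) (A : set 'rV[F]_n) (z : 'rV[Cplx R]_3) : Cplx R :=
  summability.sum
    (patch (fun=> 0) A (fun x => cexp ((Complex 0 pi : Cplx R) * trzsq z x))).

Definition cosetRep (a : 'I_3) : F :=
  nth 0 [:: 0; fdual ord0; - fdual ord0] a.

(* F is identified with 'rV[F]_1. *)
Definition theta (a : 'I_3) : 'rV[Cplx R]_3 -> Cplx R :=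
  thetaSeries [set (const_mx (cosetRep a + y) : 'rV[F]_1) | y in Lambda].

Definition thetaCode (n : nat) (C : {vspace 'rV['F_3]_n}) :
    'rV[Cplx R]_3 -> Cplx R :=
  thetaSeries (GammaCode C).

End LatticeAndTheta.

Definition euclideanSelfDual (n : nat) (C : {vspace 'rV['F_3]_n}) : Prop :=
  forall x : 'rV['F_3]_n,
    x \in C <-> (forall y, y \in C -> \sum_(i < n) x 0 i * y 0 i = 0).

(* Main.v *)
Require Import Defs.
From HB Require Import structures.
From mathcomp Require Import all_boot all_order all_algebra all_fingroup all_field.
From mathcomp Require Import complex finmap.
From mathcomp Require Import all_classical all_reals all_analysis.
From mathcomp Require Import summability ring lra zify.

Set Implicit Arguments.
Unset Strict Implicit.
Unset Printing Implicit Defensive.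

Import Order.TTheory GRing.Theory Num.Theory numFieldNormedType.Exports.
Local Open Scope classical_set_scope.
Local Open Scope ring_scope.

(** The proof rests on one analytic identity and on arithmetic in the ring
Z[zeta] modulo the prime 1 - zeta above 3.

Analysis. Through the three pairs of conjugate embeddings E_l of F, the lattice
Lambda becomes Z^6, and theta_0(z) becomes the sum over Z^6 of a Gaussian
exp(2 pi i sum_l z_l |E_l x|^2).  The inversion formula relates the values at
w = -1/z to the sum over the dual lattice.  It is obtained without Fourier
integrals: for a function f dominated by an integrable weight let the grid mean
be N^-6 times the sum of f over (1/N) Z^6.  A Taylor expansion along a segment
cut in N steps (grid_mean_step) shows that, up to O(1/N), the grid mean of a
Gaussian times a character only picks up the dual Gaussian as a factor
(grid_mean_shifted), and that (prod_l w_l) times the grid mean does not depend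
on w (grid_mean_scale).  Testing the Gaussian against a Fejer kernel, whose mass
concentrates on the integral points of the grid, turns this into theorem
poisson: (prod_l w_l) Theta(w) = const * Theta^*(-1/w), with an unspecified
constant.

Arithmetic.  The ring of integers of F is Z[zeta] (Zin_of_aint); the dual lattice
is 3^-1 (1 - zeta^4) Z[zeta], and rho is reduction modulo 1 - zeta in that
presentation (dual_residue, rhoE).  For x in the dual lattice of residue a and
an integer b of K of residue r, the number Tr(b x xbar) is 4 r a^2 / 3 modulo 2
(quad_ee), so that the translation z -> z + b fixes theta_0 and multiplies
theta_1 by exp(4 pi i r / 3).

With theta_2 = theta_1, the pair (theta_0, theta_1) is therefore transformed
linearly by S : z -> -1/z and by all T^b.  The constant of the inversion formula
is forced by the group relation (ST)^3 = S^2 together with a sign read at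
z = (i, i, i); this makes volume computations superfluous (S_transform).  As
Z_K is norm-Euclidean, S and the T^b generate SL_2(Z_K) (SL2_ind).  For weight
1, the matrix by which an element acts on (theta_0, theta_1) is expressed through
its entries modulo 1 - zeta (weil), hence is trivial on the principal congruence
subgroup of level L.  For the code, theta_C is the weight enumerator
sum_(u in C) prod_i theta_(u_i) (thetaCodeE); it is T^b-invariant because C is
self-orthogonal, and the MacWilliams argument over the dual code makes it an
eigenvector of S, whose eigenvalue is 1 by (ST)^3 = S^2 again.

Holomorphy comes from a second order Taylor bound of the terms, summed over the
lattice (coset_theta_quad). *)

(** * Moduli of complex numbers and unordered sums *)

Section Modulus.
Variable R : realType.
Implicit Types (z w : Cplx R) (x y : R).

(** Estimates live in the ordered field R, whereas norms on Cplx R take values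
in Cplx R itself; RC and md carry numbers between the two. *)
Definition RC x : Cplx R := (real_complex R x).
Definition md z : R := complex.Re `|z|.

Lemma RC0 : RC 0 = 0. Proof. by []. Qed.
Lemma RC1 : RC 1 = 1. Proof. by []. Qed.
Lemma RCD x y : RC (x + y) = RC x + RC y. Proof. exact: rmorphD. Qed.
Lemma RCN x : RC (- x) = - RC x. Proof. exact: rmorphN. Qed.
Lemma RCM x y : RC (x * y) = RC x * RC y. Proof. exact: rmorphM. Qed.
Lemma RCV x : RC (x^-1) = (RC x)^-1. Proof. exact: fmorphV. Qed.
Lemma RCn n : RC n%:R = n%:R. Proof. exact: rmorph_nat. Qed.
Lemma RC_le x y : (RC x <= RC y) = (x <= y). Proof. exact: lecR. Qed.
Lemma RC_lt x y : (RC x < RC y) = (x < y). Proof. exact: ltcR. Qed.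

Lemma normE z : `|z| = RC (md z). Proof. by []. Qed.
Lemma md_ge0 z : 0 <= md z. Proof. by rewrite -RC_le -normE normr_ge0. Qed.
Lemma mdD z w : md (z + w) <= md z + md w.
Proof. by rewrite -RC_le RCD -!normE ler_normD. Qed.
Lemma mdM z w : md (z * w) = md z * md w.
Proof. by apply: (@complexI R); rewrite -[LHS]/(RC _) -[RHS]/(RC _) RCM -!normE normrM. Qed.
Lemma mdN z : md (- z) = md z. Proof. by rewrite /md normrN. Qed.
Lemma mdB z w : md (z - w) <= md z + md w. Proof. by rewrite -(mdN w) mdD. Qed.
Lemma md0 : md 0 = 0. Proof. by rewrite /md normr0. Qed.
Lemma md1 : md 1 = 1. Proof. by rewrite /md normr1. Qed.
Lemma md_eq0 z : (md z == 0) = (z == 0).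
Proof. by rewrite -[RHS]normr_eq0 normE; apply/eqP/eqP => [->|[]]. Qed.
Lemma md_gt0 z : (0 < md z) = (z != 0).
Proof. by rewrite lt_def md_ge0 andbT md_eq0. Qed.
Lemma mdV z : md (z^-1) = (md z)^-1.
Proof. by apply: (@complexI R); rewrite -[LHS]/(RC _) -[RHS]/(RC _) RCV -!normE normfV. Qed.
Lemma mdRC x : md (RC x) = `|x|.
Proof.
apply: (@complexI R); rewrite -[LHS]/(RC _) -[RHS]/(RC _) -normE.
by rewrite /RC normc_def /= expr0n /= addr0 sqrtr_sqr.
Qed.
Lemma md_sum (I : Type) (r : seq I) (P : pred I) (F : I -> Cplx R) :
  md (\sum_(i <- r | P i) F i) <= \sum_(i <- r | P i) md (F i).
Proof.
elim/big_rec2: _ => [|i y z _ h]; first by rewrite md0.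
by rewrite (le_trans (mdD _ _)) // lerD2l.
Qed.
Lemma md_prod (I : Type) (r : seq I) (P : pred I) (F : I -> Cplx R) :
  md (\prod_(i <- r | P i) F i) = \prod_(i <- r | P i) md (F i).
Proof. by elim/big_rec2: _ => [|i y z _ h]; rewrite ?md1 // mdM h. Qed.
Lemma RC_sum (I : Type) (r : seq I) (P : pred I) (F : I -> R) :
  RC (\sum_(i <- r | P i) F i) = \sum_(i <- r | P i) RC (F i).
Proof. by elim/big_rec2: _ => [//|i y z _ h]; rewrite RCD h. Qed.
Lemma Re_md z : `|complex.Re z| <= md z.
Proof. by rewrite -RC_le -normE; exact: normc_ge_Re. Qed.
Lemma ImD z w : complex.Im (z + w) = complex.Im z + complex.Im w.
Proof. by case: z w => [a b] []. Qed.
Lemma Im_RCM x z : complex.Im (RC x * z) = x * complex.Im z.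
Proof. by case: z => [a b] /=; rewrite mul0r addr0. Qed.
Lemma md_ReIm z : md z <= `|complex.Re z| + `|complex.Im z|.
Proof.
case: z => a b /=; have -> : (Complex a b : Cplx R) = RC a + (Complex 0 1 : Cplx R) * RC b.
  exact: (complexE (Complex a b)).
rewrite (le_trans (mdD _ _)) // mdM !mdRC.
have -> : md (Complex 0 1) = 1.
  apply: (@complexI R); rewrite -[LHS]/(RC _) -normE normc_def /=.
  by rewrite expr0n expr1n add0r sqrtr1.
by rewrite mul1r.
Qed.
Lemma Im_md z : `|complex.Im z| <= md z.
Proof.
rewrite -RC_le -normE; case: z => a b; rewrite normc_def /= lecR -sqrtr_sqr.
by rewrite ler_wsqrtr // lerDr sqr_ge0.
Qed.
End Modulus.

Section Sums.
Variable R : realType.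
Local Notation C := (Cplx R).

(** Unconditional summability in epsilon form, which is easier to combine than
the limit of a filter; hasSumE goes back to the latter. *)
Definition hasSum (I : choiceType) (f : I -> C) (s : C) : Prop :=
  forall e : R, 0 < e -> exists A : {fset I}, forall B : {fset I},
    (A `<=` B)%fset -> md (\sum_(i <- B) f i - s) < e.

(** For a nonnegative family, bounded finite partial sums amount to
summability; carrying the bound M explicitly lets the estimates stay uniform
in parameters. *)
Definition bsum (I : choiceType) (g : I -> R) (M : R) : Prop :=
  forall B : {fset I}, \sum_(i <- B) g i <= M.

Definition asum (I : choiceType) (f : I -> C) : Prop :=
  exists M, bsum (fun i => md (f i)) M.

Lemma hasSumE (I : choiceType) (f : I -> C) (s : C) :
  hasSum f s -> summability.sum (f : I -> C) = s.
Proof.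
move=> hf; have PF := @totally_filter I; have FF : Filter (@totally I) by apply: filter_filter.
apply: cvg_lim; first exact: norm_hausdorff.
apply/(@cvgrPdist_lt C _ {fset I} totally) => e e0.
have [r r0 er] : exists2 r : R, 0 < r & e = RC r.
  case: e e0 => a b; rewrite ltcE /= => /andP[/eqP -> a0].
  by exists a.
have [A hA] := hf r r0.
exists A => // B /= AB.
have -> : partial_sum f B = \sum_(i <- B) f i by rewrite big_seq_fsetE.
by rewrite distrC normE er RC_lt; exact: hA.
Qed.

Lemma hasSumD (I : choiceType) (f g : I -> C) s t :
  hasSum f s -> hasSum g t -> hasSum (fun i => f i + g i) (s + t).
Proof.
move=> hf hg e e0; have e2 : 0 < e / 2 by lra.
have [A hA] := hf _ e2; have [B hB] := hg _ e2.
exists (A `|` B)%fset => D; rewrite fsubUset => /andP[/hA a /hB b].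
rewrite big_split /= opprD addrACA (le_lt_trans (mdD _ _)) //; lra.
Qed.

Lemma hasSumZ (I : choiceType) (f : I -> C) s c :
  hasSum f s -> hasSum (fun i => c * f i) (c * s).
Proof.
move=> hf e e0; have m0 : 0 < md c + 1 by rewrite ltr_wpDl ?md_ge0.
have [A hA] := hf (e / (md c + 1)) (divr_gt0 e0 m0).
exists A => B /hA h; rewrite -mulr_sumr -mulrBr mdM.
apply: (le_lt_trans (y := (md c + 1) * md (\sum_(i <- B) f i - s))).
  by rewrite ler_wpM2r ?md_ge0 // lerDl.
by rewrite mulrC -ltr_pdivlMr.
Qed.

Lemma hasSum_ext (I : choiceType) (f g : I -> C) s : f =1 g -> hasSum f s -> hasSum g s.
Proof. by move=> /funext ->. Qed.

Lemma hasSum0 (I : choiceType) : hasSum (fun _ : I => 0 : C) 0.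
Proof. by move=> e e0; exists fset0 => B _; rewrite big1 // subrr md0. Qed.

Lemma hasSum_big (I : choiceType) (J : Type) (r : seq J) (P : pred J) (f : J -> I -> C) s :
  (forall j, P j -> hasSum (f j) (s j)) ->
  hasSum (fun i => \sum_(j <- r | P j) f j i) (\sum_(j <- r | P j) s j).
Proof.
move=> h; elim: r => [|j r IH].
  by rewrite big_nil; apply: hasSum_ext (hasSum0 I) => i; rewrite big_nil.
case Pj : (P j); last first.
  by rewrite big_cons Pj; apply: hasSum_ext IH => i; rewrite big_cons Pj.
rewrite big_cons Pj; apply: hasSum_ext (hasSumD (h j Pj) IH) => i.
by rewrite big_cons Pj.
Qed.

Lemma bsum_sub (I : choiceType) (g : I -> R) (A B : {fset I}) :
  (forall i, 0 <= g i) -> (A `<=` B)%fset ->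
  \sum_(i <- A) g i <= \sum_(i <- B) g i.
Proof.
move=> g0 AB; rewrite (big_fsetID _ (mem A) B) /=.
have -> : [fset x in B | x \in A]%fset = A.
  apply/fsetP => x; rewrite !inE /= andbC; case xA : (x \in A) => //=.
  exact: (fsubsetP AB).
by rewrite lerDl sumr_ge0.
Qed.

(** The supremum of the finite partial sums. *)
Lemma hasSum_ge0 (I : choiceType) (g : I -> R) M :
  (forall i, 0 <= g i) -> bsum g M -> exists s, hasSum (fun i => RC (g i)) s.
Proof.
move=> g0 gM; pose E := [set x | exists A : {fset I}, x = \sum_(i <- A) g i]%classic.
have hs : has_sup E.
  split; first by exists 0, fset0; rewrite big_seq_fset0.
  by exists M => _ [A ->].
exists (RC (sup E)) => e e0.
have [_ [A ->] hA] := sup_adherent e0 hs.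
exists A => B AB; rewrite -RC_sum -RCN -RCD mdRC distrC.
have h1 := bsum_sub g0 AB.
have h2 : \sum_(i <- B) g i <= sup E by apply: sup_upper_bound => //; exists B.
rewrite ger0_norm; lra.
Qed.

Lemma bsum_le (I : choiceType) (g h : I -> R) M :
  (forall i, g i <= h i) -> bsum h M -> bsum g M.
Proof. by move=> gh hM B; apply: le_trans (hM B); apply: ler_sum. Qed.

Lemma bsumD (I : choiceType) (g h : I -> R) M N :
  bsum g M -> bsum h N -> bsum (fun i => g i + h i) (M + N).
Proof. by move=> gM hN B; rewrite big_split lerD. Qed.

Lemma bsumZ (I : choiceType) (g : I -> R) M c : 0 <= c ->
  bsum g M -> bsum (fun i => c * g i) (c * M).
Proof. by move=> c0 gM B; rewrite -mulr_sumr ler_wpM2l. Qed.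

(** The real and imaginary parts are differences of two nonnegative families
with bounded partial sums. *)
Lemma asum_has (I : choiceType) (f : I -> C) :
  asum f -> hasSum f (summability.sum (f : I -> C)).
Proof.
move=> [M hM]; suff [s hs] : exists s, hasSum f s by rewrite (hasSumE hs).
have hr (p : C -> R) : (forall z, `|p z| <= md z) ->
    exists s, hasSum (fun i => RC (p (f i))) s.
  move=> hp.
  have b1 : bsum (fun i => p (f i) + md (f i)) (M + M).
    by apply: bsumD => //; apply: bsum_le hM => i; rewrite (le_trans (ler_norm _)).
  have [|s hs] := hasSum_ge0 _ b1.
    by move=> i; have := hp (f i); rewrite ler_norml => /andP[]; lra.
  have [|t ht] := hasSum_ge0 _ hM; first by move=> i; exact: md_ge0.
  exists (s + (- 1) * t); apply: hasSum_ext (hasSumD hs (hasSumZ (-1) ht)) => i /=.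
  by rewrite RCD; ring.
have [s hs] := hr _ (@Re_md R); have [t ht] := hr _ (@Im_md R).
exists (s + (Complex 0 1 : C) * t); apply: hasSum_ext (hasSumD hs (hasSumZ _ ht)) => i /=.
by rewrite [f i in RHS]complexE.
Qed.

Lemma hasSum_md (I : choiceType) (f : I -> C) s M :
  hasSum f s -> bsum (fun i => md (f i)) M -> md s <= M.
Proof.
move=> hf hM; apply/ler_addgt0Pr => e e0; have [A hA] := hf e e0.
have := hA A (fsubset_refl A) => /ltW h.
have -> : s = \sum_(i <- A) f i - (\sum_(i <- A) f i - s) by ring.
by rewrite (le_trans (mdB _ _)) // lerD // (le_trans (md_sum _ _ _)).
Qed.

Lemma md_sum_le (I : choiceType) (f : I -> C) M :
  bsum (fun i => md (f i)) M -> md (summability.sum (f : I -> C)) <= M.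
Proof. by move=> h; apply: (hasSum_md (asum_has _) h); exists M. Qed.

Lemma asum_le (I : choiceType) (f : I -> C) g M :
  bsum g M -> (forall i, md (f i) <= g i) -> asum f.
Proof. by move=> h fg; exists M; apply: bsum_le h. Qed.

Lemma bsum_inj (I J : choiceType) (h : J -> I) (g : I -> R) M :
  injective h -> bsum g M -> bsum (fun j => g (h j)) M.
Proof.
move=> hi gM B; apply: le_trans (gM (h @` B)%fset).
by rewrite big_imfset //= => x y _ _; apply: hi.
Qed.

(** Reindexing along an injection: the indices outside its range contribute
nothing. *)
Lemma hasSum_inj (I J : choiceType) (h : J -> I) (f : I -> C) s :
  injective h -> (forall i, (forall j, i <> h j) -> f i = 0) ->
  hasSum (fun j => f (h j)) s -> hasSum f s.
Proof.
move=> hi hf hs e e0; have [A hA] := hs e e0.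
have [k hk] : exists k : I -> option J, forall i j, k i = Some j <-> i = h j.
  suff /choice[k hk] : forall i, exists o : option J, forall j, o = Some j <-> i = h j by exists k.
  move=> i; have [[j ->]|nj] := pselect (exists j, i = h j).
    by exists (Some j) => j'; split => [[->]//|/hi ->].
  by exists None => j; split => // ij; case: nj; exists j.
exists (h @` A)%fset => B AB.
pose D := [fset j in pmap k (enum_fset B)]%fset.
have DE j : (j \in D) = (h j \in B).
  rewrite inE /= mem_pmap; apply/mapP/idP => [[i iB /esym/hk ij]|hB].
    by move: iB; rewrite ij.
  by exists (h j) => //; apply/esym/hk.
have AD : (A `<=` D)%fset.
  apply/fsubsetP => j jA; rewrite DE; apply: (fsubsetP AB).
  by apply/imfsetP; exists j.
have <- : \sum_(j <- D) f (h j) = \sum_(i <- B) f i; last exact: hA.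
rewrite (_ : \sum_(j <- D) f (h j) = \sum_(i <- (h @` D)%fset) f i); last first.
  by rewrite [RHS]big_imfset // => x y _ _; apply: hi.
apply: big_fset_incl => [|i iB niD].
  by apply/fsubsetP => _ /imfsetP[j /= + ->]; rewrite DE.
apply: hf => j ij; move/negP: niD; apply; apply/imfsetP; exists j => //=.
by rewrite DE -ij.
Qed.

Lemma sum_inj (I J : choiceType) (h : J -> I) (f : I -> C) :
  injective h -> (forall i, (forall j, i <> h j) -> f i = 0) -> asum (f \o h) ->
  summability.sum (f : I -> C) = summability.sum (f \o h : J -> C).
Proof. by move=> hi hf /asum_has hs; apply: hasSumE; apply: hasSum_inj hs. Qed.

(** The way in which a sum over the dual lattice is cut along the cosets of
Lambda, and a sum over the code lattice along the code words. *)
Lemma sum_partition (I I' : choiceType) (J : finType) (h : J -> I' -> I) (f : I -> C) :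
  (forall j j' i i', h j i = h j' i' -> j = j' /\ i = i') ->
  (forall x, (forall j i, x <> h j i) -> f x = 0) ->
  (forall j, asum (f \o h j)) ->
  summability.sum (f : I -> C) = \sum_j summability.sum (f \o h j : I' -> C).
Proof.
move=> hi hf hs; pose fj j x := if `[< exists i, x = h j i >] then f x else 0.
apply: hasSumE; apply: (@hasSum_ext _ (fun x => \sum_j fj j x)) => [x|].
  have [[j [i xji]]|nx] := pselect (exists j i, x = h j i).
    rewrite (bigD1 j) //= big1 => [|j' j'j].
      by rewrite addr0 /fj asboolT //; exists i.
    rewrite /fj; case: asboolP => // -[i' xi']; move: j'j.
    by move: xi'; rewrite xji => /hi[-> _]; rewrite eqxx.
  rewrite hf => [|j i xji]; last by apply: nx; exists j, i.
  by rewrite big1 // => j _; rewrite /fj; case: asboolP => // -[i xji]; case: nx; exists j, i.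
apply: hasSum_big => j _; apply: (@hasSum_inj _ _ (h j)).
- by move=> i i' /hi[].
- by move=> x nx; rewrite /fj; case: asboolP => // -[i xi]; case: (nx i).
- apply: hasSum_ext (asum_has (hs j)) => i /=.
  by rewrite /fj asboolT //; exists i.
Qed.

Lemma sum_big (I : choiceType) (J : Type) (r : seq J) (P : pred J) (f : J -> I -> C) :
  (forall j, P j -> asum (f j)) ->
  summability.sum ((fun i => \sum_(j <- r | P j) f j i) : I -> C) =
  \sum_(j <- r | P j) summability.sum (f j : I -> C).
Proof. by move=> h; apply: hasSumE; apply: hasSum_big => j /h /asum_has. Qed.

Lemma sumD (I : choiceType) (f g : I -> C) : asum f -> asum g ->
  summability.sum ((fun i => f i + g i) : I -> C) =
  summability.sum (f : I -> C) + summability.sum (g : I -> C).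
Proof. by move=> /asum_has hf /asum_has hg; apply: hasSumE; apply: hasSumD. Qed.

Lemma sumZ (I : choiceType) (f : I -> C) c : asum f ->
  summability.sum ((fun i => c * f i) : I -> C) = c * summability.sum (f : I -> C).
Proof. by move=> /asum_has hf; apply: hasSumE; apply: hasSumZ. Qed.

Lemma asumD (I : choiceType) (f g : I -> C) : asum f -> asum g -> asum (fun i => f i + g i).
Proof.
move=> [M hM] [N hN]; exists (M + N).
by apply: bsum_le (bsumD hM hN) => i; apply: mdD.
Qed.

Lemma asumZ (I : choiceType) (f : I -> C) c : asum f -> asum (fun i => c * f i).
Proof.
move=> [M hM]; exists (md c * M).
by apply: bsum_le (bsumZ (md_ge0 c) hM) => i; rewrite mdM.
Qed.

Lemma sumB (I : choiceType) (f g : I -> C) : asum f -> asum g ->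
  summability.sum ((fun i => f i - g i) : I -> C) =
  summability.sum (f : I -> C) - summability.sum (g : I -> C).
Proof.
move=> hf hg; rewrite -mulN1r -(sumZ _ hg) -(sumD hf (asumZ _ hg)).
by congr summability.sum; apply/funext => i; rewrite mulN1r.
Qed.

Lemma asum_inj (I J : choiceType) (h : J -> I) (f : I -> C) :
  injective h -> asum f -> asum (f \o h).
Proof. by move=> hi [M hM]; exists M; apply: (bsum_inj hi hM). Qed.

(** Boxes are cofinal among the finite sets of tuples, and on a box the sum of
products factors. *)
Lemma boxE (I : choiceType) (J : finType) (A : {fset I}) :
  exists P : {fset {ffun J -> I}}, (forall c : {ffun J -> I}, (c \in P) <-> (forall j, c j \in A)) /\
   forall (K : comNzRingType) (g : J -> I -> K),
     \sum_(c <- P) \prod_j g j (c j) = \prod_j \sum_(i <- A) g j i.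
Proof.
pose e (c : {ffun J -> A}) : {ffun J -> I} := [ffun j => val (c j)].
have ei : injective e.
  by move=> c d /ffunP cd; apply/ffunP => j; apply/val_inj; have := cd j; rewrite !ffunE.
exists [fset e c | c in {ffun J -> A}]%fset; split.
  move=> c; split=> [/imfsetP[d _ ->] j|cA].
    by rewrite ffunE; exact: valP.
  apply/imfsetP; exists [ffun j => [` cA j]%fset] => //.
  by apply/ffunP => j; rewrite !ffunE.
move=> K g; rewrite (big_imfset _ _ (fun c : {ffun J -> I} => \prod_j g j (c j))) /=;
  last by move=> x y _ _; apply: ei.
rewrite big_enum /=.
under [RHS]eq_bigr => j _ do rewrite big_seq_fsetE /=.
rewrite bigA_distr_bigA /=; apply: eq_bigr => c _.
by apply: eq_bigr => j _; rewrite ffunE.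
Qed.

Lemma asum_prod (I : choiceType) (J : finType) (f : J -> I -> C) :
  (forall j, asum (f j)) -> asum (fun c : {ffun J -> I} => \prod_j f j (c j)).
Proof.
move=> /choice[M hM]; exists (\prod_j M j) => B.
pose A : {fset I} := (\bigcup_(c <- B) [fset (c : {ffun J -> I}) j | j in J])%fset.
have [P [PE Psum]] := boxE J A.
apply: (le_trans (y := \sum_(c <- B) \prod_j md (f j (c j)))).
  by apply: ler_sum => c _; rewrite md_prod.
apply: (le_trans (bsum_sub (B := P) (g := fun c : {ffun J -> I} => \prod_j md (f j (c j))) _ _)).
- by move=> c; apply: prodr_ge0 => j _; apply: md_ge0.
- apply/fsubsetP => c cB; apply/PE => j; apply/bigfcupP.
  by exists c; rewrite ?cB //; apply/imfsetP; exists j.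
rewrite (Psum R (fun j i => md (f j i))); apply: ler_prod => j _.
by rewrite sumr_ge0 => [|i _]; rewrite ?md_ge0 //=; apply: hM.
Qed.

Lemma prod_cont (J : Type) (r : seq J) (S : J -> C) (e : R) : 0 < e ->
  exists2 d : R, 0 < d & forall T : J -> C, (forall j, md (T j - S j) < d) ->
    md (\prod_(j <- r) T j - \prod_(j <- r) S j) < e.
Proof.
elim: r e => [|j r IH] e e0; first by exists 1 => // T _; rewrite !big_nil subrr md0.
set p := \prod_(j <- r) S j.
have m1 := md_ge0 (S j); have m2 := md_ge0 p.
have K0 : 0 < 2 * (md (S j) + md p + 1) by lra.
pose d0 := Num.min 1 (e / (2 * (md (S j) + md p + 1))).
have d00 : 0 < d0 by rewrite lt_min ltr01 divr_gt0.
have [d d1 hd] := IH _ d00.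
exists (Num.min d d0) => [|T hT]; first by rewrite lt_min d1 d00.
have h1 : md (\prod_(j <- r) T j - p) < d0.
  by apply: hd => k; apply: lt_le_trans (hT k) _; rewrite ge_min lexx.
have h2 : md (T j - S j) < d0 by apply: lt_le_trans (hT j) _; rewrite ge_min lexx orbT.
rewrite !big_cons -/p; set q := \prod_(j <- r) T j in h1 *.
have -> : T j * q - S j * p = (T j - S j) * (q - p) + (T j - S j) * p + S j * (q - p) by ring.
have h3 : d0 <= 1 by rewrite ge_min lexx.
have h4 : d0 * (2 * (md (S j) + md p + 1)) <= e.
  by rewrite -ler_pdivlMr // ge_min lexx orbT.
have m3 := md_ge0 (T j - S j); have m4 := md_ge0 (q - p).
apply: (le_lt_trans (mdD _ _)); apply: (le_lt_trans (lerD (mdD _ _) (lexx _))).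
rewrite !mdM; nra.
Qed.

(** A Fubini theorem: by absolute summability it is enough to evaluate the sum
along boxes. *)
Lemma sum_prod (I : choiceType) (J : finType) (f : J -> I -> C) :
  (forall j, asum (f j)) ->
  summability.sum ((fun c : {ffun J -> I} => \prod_j f j (c j)) : _ -> C) =
  \prod_j summability.sum (f j : I -> C).
Proof.
move=> hf; have hF := asum_has (asum_prod hf).
set s := LHS in hF *; set S := fun j => summability.sum (f j : I -> C).
apply/eqP; rewrite -subr_eq0 -md_eq0 eq_le md_ge0 andbT.
apply/ler_addgt0Pr => e e0; rewrite add0r.
have e2 : 0 < e / 2 by lra.
have [B hB] := hF _ e2.
have [d d0 hd] := prod_cont (index_enum J) S e2.
have /choice[Aj hAj] : forall j, exists A : {fset I}, forall B, (A `<=` B)%fset ->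
  md (\sum_(i <- B) f j i - S j) < d by move=> j; exact: (asum_has (hf j)).
pose A : {fset I} := (\bigcup_(c <- B) [fset (c : {ffun J -> I}) j | j in J] `|` \bigcup_(j <- enum J) Aj j)%fset.
have [P [PE Psum]] := boxE J A.
have BP : (B `<=` P)%fset.
  apply/fsubsetP => c cB; apply/PE => j; rewrite inE; apply/orP; left; apply/bigfcupP.
  by exists c; rewrite ?cB //; apply/imfsetP; exists j.
have h1 := hB P BP.
have h2 : md (\prod_j (\sum_(i <- A) f j i) - \prod_j S j) < e / 2.
  apply: hd => j; apply: hAj; apply/fsubsetP => i iA.
  rewrite inE; apply/orP; right; apply/bigfcupP; exists j => //.
  by rewrite mem_enum.
rewrite (Psum C f) in h1.
have -> : s - \prod_j S j = (\prod_j (\sum_(i <- A) f j i) - \prod_j S j) -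
  (\prod_j (\sum_(i <- A) f j i) - s) by ring.
apply: (le_trans (mdB _ _)); lra.
Qed.
End Sums.

(** * The complex exponential *)

Section Exp.
Variable R : realType.
Local Notation C := (Cplx R).

Lemma cexpE (x y : R) : cexp (Complex x y : C) = RC (expR x) * (Complex (cos y) (sin y) : C).
Proof.
rewrite /cexp /=; apply/eqP; rewrite eq_complex /= !mul0r subr0 addr0.
by rewrite !eqxx.
Qed.

Lemma cexpD (a b : C) : cexp (a + b) = cexp a * cexp b.
Proof.
case: a b => [x y] [u v]; rewrite /cexp /=; rewrite expRD cosD sinD.
by apply/eqP; rewrite eq_complex /=; apply/andP; split; apply/eqP; ring.
Qed.

Lemma cexp0 : cexp (0 : C) = 1.
Proof. by rewrite /cexp /= expR0 cos0 sin0 mulr1 mulr0. Qed.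

Lemma cexp_sum (I : Type) (r : seq I) (P : pred I) (F : I -> C) :
  cexp (\sum_(i <- r | P i) F i) = \prod_(i <- r | P i) cexp (F i).
Proof. by elim/big_rec2: _ => [|i y z _ h]; rewrite ?cexp0 // cexpD h. Qed.

Lemma md_cexp (a : C) : md (cexp a) = expR (complex.Re a).
Proof.
case: a => x y; rewrite cexpE mdM mdRC ger0_norm ?expR_ge0 //=.
suff -> : md (Complex (cos y) (sin y)) = 1 by rewrite mulr1.
apply: (@complexI R); rewrite -[LHS]/(RC _) -normE normc_def /=.
by rewrite cos2Dsin2 sqrtr1.
Qed.

Lemma cexp_neq0 (a : C) : cexp a != 0.
Proof. by rewrite -md_gt0 md_cexp expR_gt0. Qed.

Lemma sqr_normr (x : R) : `|x| ^+ 2 = x ^+ 2.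
Proof. by rewrite real_normK // num_real. Qed.

Lemma cos_mono (x y : R) : 0 <= x -> x <= y -> y <= pi -> cos y <= cos x.
Proof.
move=> x0 xy yp; rewrite leNgt ltr_cos ?in_itv /= -?leNgt //.
  by rewrite yp (le_trans x0).
by rewrite x0 (le_trans xy).
Qed.

Lemma expR_bnd (x : R) : `|expR x - 1| <= `|x| * (1 + expR x).
Proof.
have h1 := expR_ge1Dx x; have h2 := expR_ge1Dx (- x); have h3 := expR_gt0 x.
have h4 : expR (- x) * expR x = 1 by rewrite -expRD addNr expR0.
have h5 : expR x - 1 <= x * expR x by nra.
have [x0|x0] := leP 0 x.
  rewrite !ger0_norm; nra.
rewrite ler0_norm ?ltr0_norm //; nra.
Qed.

Lemma expR_bnd2 (x : R) : `|expR x - 1 - x| <= x ^+ 2 * (1 + expR x).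
Proof.
have h1 := expR_ge1Dx x; have h2 := expR_ge1Dx (- x); have h3 := expR_gt0 x.
have h4 : expR (- x) * expR x = 1 by rewrite -expRD addNr expR0.
have h5 : expR x - 1 <= x * expR x by nra.
rewrite ger0_norm; last lra.
have [x0|x0] := leP 0 x; nra.
Qed.

Lemma sin_le_id (x : R) : 0 <= x -> `|sin x| <= x.
Proof.
move=> x0; have [|c _] := @MVT_segment R sin cos 0 x x0.
  by apply: continuous_subspaceT; exact: continuous_sin.
rewrite sin0 !subr0 => ->; rewrite normrM (ger0_norm x0).
have := cos_max c; nra.
Qed.

Lemma sin_abs (x : R) : `|sin x| <= `|x|.
Proof.
have [x0|x0] := leP 0 x; first by rewrite (ger0_norm x0) sin_le_id.
by rewrite (ltr0_norm x0) -normrN -sinN sin_le_id // oppr_ge0 ltW.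
Qed.

Lemma cos_double (x : R) : 1 - cos x = 2 * sin (x / 2) ^+ 2.
Proof.
have h : cos x = cos (x / 2 + x / 2) by congr cos; field.
have := cos2Dsin2 (x / 2); rewrite h cosD; nra.
Qed.

Lemma cos_bnd (x : R) : `|cos x - 1| <= x ^+ 2.
Proof.
have h := cos_double x; have h2 := sin_abs (x / 2).
have h3 : sin (x / 2) ^+ 2 <= (x / 2) ^+ 2.
  by rewrite -[X in X <= _]sqr_normr -[X in _ <= X]sqr_normr ler_sqr ?nnegrE.
rewrite ler0_norm; have := sqr_ge0 (sin (x / 2)); nra.
Qed.

Lemma cos_bnd1 (x : R) : `|cos x - 1| <= `|x|.
Proof.
have h1 := cos_bnd x; have h2 := cos_max x.
have [x1|x1] := leP `|x| 1.
  apply: le_trans h1 _; rewrite -(sqr_normr x); have := normr_ge0 x; nra.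
have h := cos_double x; have h3 := sin_abs (x / 2); have h4 := sin_max (x / 2).
have h5 : `|x / 2| = `|x| / 2 by rewrite normrM (@ger0_norm _ (2^-1)) // invr_ge0.
have h6 := normr_ge0 (sin (x / 2)); have h7 := sqr_normr (sin (x / 2)).
rewrite ler0_norm; nra.
Qed.

Lemma sin_bnd (x : R) : `|sin x - x| <= 2 * x ^+ 2.
Proof.
wlog x0 : x / 0 <= x.
  move=> h; have [|x0] := leP 0 x; first exact: h.
  have := h (- x); rewrite oppr_ge0 => /(_ (ltW x0)).
  by rewrite sinN -opprD normrN sqrrN.
have [x1|x1] := leP x 1; last first.
  apply: (le_trans (ler_normB _ _)); have := sin_max x; rewrite (ger0_norm x0); nra.
have [|c c01] := @MVT_segment R sin cos 0 x x0.
  by apply: continuous_subspaceT; exact: continuous_sin.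
rewrite sin0 !subr0 => ->.
have -> : cos c * x - x = (cos c - 1) * x by ring.
rewrite normrM (ger0_norm x0); have h := cos_bnd1 c.
move: c01; rewrite in_itv /= => /andP[c0 cx]; rewrite (ger0_norm c0) in h; nra.
Qed.

(** The second order Taylor bound, valid for all arguments; it is used both to
compare successive steps of a deformation and to differentiate theta series.
*)
Lemma cexp_bnd2 (a : C) :
  md (cexp a - 1 - a) <= 8 * md a ^+ 2 * (1 + md (cexp a)).
Proof.
have hm := md_cexp a; have hr := Re_md a; have hi := Im_md a.
case: a hm hr hi => x y hm; rewrite /= => hr hi; rewrite hm /=.
set m := md (Complex x y : C) in hr hi *.
have -> : cexp (Complex x y : C) - 1 - (Complex x y : C) =
   RC (expR x - 1 - x) + RC (expR x) * RC (cos y - 1) +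
   (RC (expR x) * RC (sin y - y) + RC (expR x - 1) * RC y) * (Complex 0 1 : C).
  apply/eqP; rewrite eq_complex /cexp /=; apply/andP; split; apply/eqP; ring.
have mi : md (Complex 0 1 : C) = 1.
  apply: (@complexI R); rewrite -[LHS]/(RC _) -normE normc_def /=.
  by rewrite expr0n expr1n add0r sqrtr1.
apply: (le_trans (mdD _ _)); rewrite mdM mi mulr1.
apply: (le_trans (lerD (mdD _ _) (mdD _ _))); rewrite !mdM !mdRC.
have h1 := expR_bnd x; have h2 := expR_bnd2 x; have h3 := cos_bnd y; have h4 := sin_bnd y.
have e0 := expR_gt0 x; rewrite (gtr0_norm e0).
have x2 : x ^+ 2 <= m ^+ 2 by rewrite -(sqr_normr x) ler_sqr ?nnegrE ?md_ge0.
have y2 : y ^+ 2 <= m ^+ 2 by rewrite -(sqr_normr y) ler_sqr ?nnegrE ?md_ge0.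
have xy : `|x| * `|y| <= m ^+ 2 by rewrite expr2 ler_pM.
have h5 : `|expR x - 1| * `|y| <= m ^+ 2 * (1 + expR x).
  apply: le_trans (_ : (`|x| * (1 + expR x)) * `|y| <= _); first by rewrite ler_wpM2r.
  by rewrite mulrAC ler_wpM2r // addr_ge0 // ltW.
have m20 := sqr_ge0 m.
have t1 : `|expR x - 1 - x| <= m ^+ 2 * (1 + expR x) by nra.
have t2 : expR x * `|cos y - 1| <= m ^+ 2 * expR x by rewrite mulrC; nra.
have t3 : expR x * `|sin y - y| <= 2 * m ^+ 2 * expR x by rewrite mulrC; nra.
have me : 0 <= m ^+ 2 * expR x by rewrite mulr_ge0 // ltW.
apply: (le_trans (lerD (lerD t1 t2) (lerD t3 h5))).
clear - m20 me; move: m20 me; move: (m ^+ 2) (expR x) => u v u0 uv.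
by lra.
Qed.

Lemma cexp_bnd1 (a : C) :
  md (cexp a - 1) <= 4 * md a * (1 + md (cexp a)).
Proof.
have hm := md_cexp a; have hr := Re_md a; have hi := Im_md a.
case: a hm hr hi => x y hm; rewrite /= => hr hi; rewrite hm /=.
set m := md (Complex x y : C) in hr hi *.
have -> : cexp (Complex x y : C) - 1 =
   RC (expR x - 1) + RC (expR x) * RC (cos y - 1) +
   (RC (expR x) * RC (sin y)) * (Complex 0 1 : C).
  apply/eqP; rewrite eq_complex /cexp /=; apply/andP; split; apply/eqP; ring.
have mi : md (Complex 0 1 : C) = 1.
  apply: (@complexI R); rewrite -[LHS]/(RC _) -normE normc_def /=.
  by rewrite expr0n expr1n add0r sqrtr1.
apply: (le_trans (mdD _ _)); rewrite mdM mi mulr1.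
apply: (le_trans (lerD (mdD _ _) (lexx _))); rewrite !mdM !mdRC.
have h1 := expR_bnd x; have h3 := cos_bnd1 y; have h4 := sin_abs y.
have e0 := expR_gt0 x; rewrite (gtr0_norm e0).
have t1 : `|expR x - 1| <= m * (1 + expR x).
  by apply: le_trans h1 _; rewrite ler_wpM2r // addr_ge0 // ltW.
have t2 : expR x * `|cos y - 1| <= expR x * m.
  by rewrite ler_wpM2l ?(ltW e0) // (le_trans h3).
have t3 : expR x * `|sin y| <= expR x * m.
  by rewrite ler_wpM2l ?(ltW e0) // (le_trans h4).
apply: (le_trans (lerD (lerD t1 t2) t3)).
have m0 : 0 <= m by apply: md_ge0.
clear - m0 e0; move: m0 e0; move: m (expR x) => u v u0 v0; nra.
Qed.

Definition ee (t : R) : C := cexp (Complex 0 (2 * pi * t)).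

Lemma eeD s t : ee (s + t) = ee s * ee t.
Proof. by rewrite /ee -cexpD; congr cexp; apply/eqP; rewrite eq_complex /= addr0 eqxx /=; apply/eqP; ring. Qed.
Lemma ee0 : ee 0 = 1. Proof. by rewrite /ee mulr0 cexp0. Qed.
Lemma md_ee t : md (ee t) = 1. Proof. by rewrite md_cexp /= expR0. Qed.
Lemma ee_neq0 t : ee t != 0. Proof. exact: cexp_neq0. Qed.
Lemma eeN t : ee (- t) = (ee t)^-1.
Proof. by apply: (mulfI (ee_neq0 t)); rewrite -eeD subrr ee0 mulfV // ee_neq0. Qed.
Lemma eeMn t n : ee (n%:R * t) = ee t ^+ n.
Proof.
elim: n => [|n IH]; first by rewrite mul0r ee0.
by rewrite exprS -IH -eeD -natr1; congr ee; ring.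
Qed.
Lemma ee_sum (I : Type) (r : seq I) (P : pred I) (F : I -> R) :
  ee (\sum_(i <- r | P i) F i) = \prod_(i <- r | P i) ee (F i).
Proof. by elim/big_rec2: _ => [|i y z _ h]; rewrite ?ee0 // eeD h. Qed.
Lemma ee1 : ee 1 = 1.
Proof. by rewrite /ee /cexp /= mulr1 expR0 mulr_natl cos2pi sin2pi !mul1r. Qed.
Lemma eeZ (m : int) : ee m%:~R = 1.
Proof.
have h n : ee n%:R = 1 by rewrite -[n%:R]mulr1 eeMn ee1 expr1n.
by case: m => n; rewrite ?NegzE ?rmorphN /= ?eeN -?pmulrn ?h ?invr1.
Qed.
Lemma eeDZ t (m : int) : ee (t + m%:~R) = ee t. Proof. by rewrite eeD eeZ mulr1. Qed.

Lemma md_ee1 t : md (ee t - 1) ^+ 2 = 4 * sin (pi * t) ^+ 2.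
Proof.
have -> : md (ee t - 1) ^+ 2 = (1 - cos (2 * pi * t)) * 2.
  apply: (@complexI R); rewrite -[LHS]/(RC _) -[RHS]/(RC _) expr2 RCM -expr2 -normE.
  rewrite -add_Re2_Im2 /ee /cexp /= expR0 !mul1r subr0; congr (_%:C)%C.
  have := cos2Dsin2 (2 * pi * t); nra.
rewrite cos_double; have -> : 2 * pi * t / 2 = pi * t by field.
ring.
Qed.

Lemma ee_neq1 t : 0 < t < 1 -> ee t != 1.
Proof.
move=> /andP[t0 t1]; rewrite -subr_eq0 -md_eq0 -sqrf_eq0 md_ee1 mulf_eq0 pnatr_eq0 /=.
have p0 := pi_gt0 R.
by rewrite sqrf_eq0 gt_eqF // sin_gt0_pi // mulr_gt0 //= gtr_pMr.
Qed.

Lemma sin_lb (x : R) : 0 <= x <= pi / 2 -> x / 2 <= sin x.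
Proof.
move=> /andP[x0 x1]; have p0 := pi_gt0 R.
pose y := x / 2; have y0 : 0 <= y by rewrite /y; lra.
have [|c c01] := @MVT_segment R sin cos 0 y y0.
  by apply: continuous_subspaceT; exact: continuous_sin.
rewrite sin0 !subr0 => sy; move: c01; rewrite in_itv /= => /andP[c0 cy].
have cyc : cos y <= cos c.
  by apply: cos_mono => //; rewrite /y; lra.
have cy4 : cos (pi / 4) <= cos y.
  by apply: cos_mono => //; rewrite /y; lra.
have c4 : cos (pi / 4) ^+ 2 = 1 / 2 :> R.
  have h := cos_pihalf R; have h2 : pi / 2 = pi / 4 + pi / 4 :> R by field.
  rewrite h2 cosD in h; have := cos2Dsin2 (pi / 4 : R); nra.
have c40 : 0 < cos (pi / 4 : R) by rewrite cos_gt0_pihalf //; apply/andP; split; lra.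
have -> : sin x = 2 * (sin y * cos y).
  have -> : x = y + y by rewrite /y; field.
  rewrite sinD; ring.
have h1 : cos (pi / 4) * y <= sin y by rewrite sy; nra.
have h2 : (cos (pi / 4) * y) * cos (pi / 4) <= sin y * cos y.
  by apply: ler_pM => //; [rewrite mulr_ge0 // ltW | exact: ltW].
rewrite /y in h2 *; nra.
Qed.

(** The comparison of chord and arc, which makes the Fejer kernel concentrate
at integers. *)
Lemma ee_lb t : `|t| <= 2^-1 -> t ^+ 2 <= md (ee t - 1) ^+ 2.
Proof.
move=> ht; rewrite md_ee1; have p0 := pi_gt0 R; have p2 := pi_ge2 R.
have -> : sin (pi * t) ^+ 2 = sin (pi * `|t|) ^+ 2.
  have [t0|t0] := leP 0 t; first by rewrite (ger0_norm t0).
  by rewrite (ltr0_norm t0) mulrN sinN sqrrN.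
have h := @sin_lb (pi * `|t|); have t0 := normr_ge0 t.
have {}h : pi * `|t| / 2 <= sin (pi * `|t|) by apply: h; apply/andP; split; nra.
have h2 : `|t| <= sin (pi * `|t|) by nra.
rewrite -(sqr_normr t); nra.
Qed.

End Exp.

(** * Grid means of rapidly decreasing functions *)

Section Weight.
Variable R : realType.
Local Notation C := (Cplx R).

Lemma sum_retract (I J : choiceType) (h : J -> I) (k : I -> J) (g : I -> R) M (D : {fset I}) :
  {in D, forall i, h (k i) = i} -> bsum (g \o h) M -> \sum_(i <- D) g i <= M.
Proof.
move=> hk hM; apply: le_trans (hM (k @` D)%fset).
rewrite big_imfset /=; last by move=> i j /hk + /hk + e; rewrite e => -> ->.
by rewrite big_seq [X in _ <= X]big_seq; apply: ler_sum => i iD; rewrite hk.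
Qed.

(** A summable weight whose sum over a grid of step 1/N is at most 4 N. *)
Definition wt1 (t : R) : R := ((1 + `|t|)^-1) ^+ 2.

Lemma wt1_gt0 t : 0 < wt1 t.
Proof. by rewrite exprn_gt0 // invr_gt0 ltr_pwDl. Qed.

Lemma wt1_le1 t : wt1 t <= 1.
Proof.
by rewrite expr_le1 // ?invr_ge0 ?addr_ge0 // invf_le1 ?lerDl // ltr_pwDl.
Qed.

Lemma bsum_nat (N : nat) : (0 < N)%N ->
  bsum (fun n : nat => wt1 (n%:R / N%:R)) (1 + N%:R).
Proof.
move=> N0 B; have NR : 0 < N%:R :> R by rewrite ltr0n.
have [T hT] : exists T, {in B, forall n : nat, (n < T.+1)%N}.
  exists (\sum_(n <- B) n)%N => n nB.
  by rewrite (big_fsetD1 n) //= ltnS leq_addr.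
apply: (le_trans (bsum_sub (B := [fset n in iota 0 T.+1]%fset) _ _)).
- by move=> n; apply/ltW/wt1_gt0.
- apply/fsubsetP => n nB; have hs : n \in iota 0 T.+1 by rewrite mem_iota add0n (hT n nB).
  by apply/imfsetP; exists n.
rewrite (_ : \sum_(n <- _) _ = \sum_(0 <= n < T.+1) wt1 (n%:R / N%:R)); last first.
  rewrite /index_iota subn0; apply: perm_big; apply: uniq_perm.
  - exact: fset_uniq.
  - exact: iota_uniq.
  - by move=> n; apply/imfsetP/idP => [[m ? ->]//|hn]; exists n.
suff : \sum_(0 <= n < T.+1) wt1 (n%:R / N%:R) <= 1 + N%:R - N%:R / (1 + T%:R / N%:R).
  move=> h; apply: le_trans h _; rewrite gerBl divr_ge0 // addr_ge0 // divr_ge0 //.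
elim: T {hT} => [|T IH].
  rewrite big_nat1 mul0r addr0 divr1 addrK; apply: wt1_le1.
rewrite big_nat_recr //=; apply: le_trans (lerD IH (lexx _)) _.
rewrite -lerBrDl /wt1 ger0_norm ?divr_ge0 //.
have -> : T.+1%:R / N%:R = T%:R / N%:R + N%:R^-1 :> R by rewrite -natr1; field; rewrite gt_eqF.
set a := T%:R / N%:R; have a0 : 0 <= a by rewrite divr_ge0.
set e := N%:R^-1; have e0 : 0 < e by rewrite invr_gt0.
have -> : N%:R = e^-1 :> R by rewrite invrK.
have -> : 1 + e^-1 - e^-1 / (1 + (a + e)) - (1 + e^-1 - e^-1 / (1 + a)) =
   ((1 + (a + e))^-1 * (1 + a)^-1).
  by field; rewrite !gt_eqF //; lra.
rewrite expr2; apply: ler_wpM2l; first by rewrite invr_ge0; lra.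
rewrite lef_pV2 ?posrE; lra.
Qed.

Lemma bsum_int (N : nat) : (0 < N)%N ->
  bsum (fun k : int => wt1 (k%:~R / N%:R)) (4 * N%:R).
Proof.
move=> N0 B; have NR : 1 <= N%:R :> R by rewrite ler1n.
apply: (le_trans (y := (1 + N%:R) + (1 + N%:R))); last lra.
rewrite (big_fsetID _ (fun k : int => 0 <= k) B) /= lerD //.
  apply: (@sum_retract _ _ Posz absz) => [k|].
    by rewrite !inE /= => /andP[_]; case: k.
  by apply: bsum_le (bsum_nat N0) => n /=.
apply: (@sum_retract _ _ (fun n : nat => - (n%:Z)) (fun k => absz k)) => [k|].
  by rewrite !inE /= => /andP[_]; case: k => // n; rewrite NegzE.
apply: bsum_le (bsum_nat N0) => n /=.
by rewrite /wt1 mulrNz mulNr normrN.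
Qed.

Variable g : nat.
Local Notation pts := ('I_g -> R).
Local Notation lat := {ffun 'I_g -> int}.
Implicit Types (x : pts) (k m : lat).

Definition norm1 x : R := \sum_i `|x i|.
Definition wt x : R := \prod_i wt1 (x i).
Definition gridpt (N : nat) k : pts := fun i => (k i)%:~R / N%:R.

Lemma norm1_ge0 x : 0 <= norm1 x. Proof. exact: sumr_ge0. Qed.
Lemma wt_gt0 x : 0 < wt x. Proof. by apply: prodr_gt0 => i _; apply: wt1_gt0. Qed.

Lemma bsum_wt N : (0 < N)%N -> bsum (fun k => wt (gridpt N k)) ((4 * N%:R) ^+ g).
Proof.
move=> N0 B.
pose A : {fset int} := (\bigcup_(c <- B) [fset (c : lat) j | j in 'I_g])%fset.
have [P [PE Psum]] := boxE 'I_g A.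
apply: (le_trans (bsum_sub (B := P) (g := fun c : lat => wt (gridpt N c)) _ _)).
- by move=> c; apply/ltW/wt_gt0.
- apply/fsubsetP => c cB; apply/PE => j; apply/bigfcupP.
  by exists c; rewrite ?cB //; apply/imfsetP; exists j.
rewrite (Psum R (fun _ i => wt1 (i%:~R / N%:R))) -[X in _ ^+ X]card_ord -prodr_const.
apply: ler_prod => j _.
by rewrite sumr_ge0 => [|i _]; rewrite ?(ltW (wt1_gt0 _)) //=; apply: bsum_int.
Qed.

Lemma Om_lb x : expR (- (2 * norm1 x)) <= wt x.
Proof.
rewrite /norm1 mulr_sumr -sumrN expR_sum; apply: ler_prod => i _.
rewrite expR_ge0 /= /wt1.
have -> : - (2 * `|x i|) = - `|x i| + - `|x i| by ring.
rewrite expRD -expr2 expRN ler_sqr ?nnegrE ?invr_ge0 ?expR_ge0 ?addr_ge0 //.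
by rewrite lef_pV2 ?posrE ?expR_gt0 ?ltr_pwDl // expR_ge1Dx.
Qed.

Lemma exp_quad_le_wt (a c : R) : 0 < c ->
  exists2 K : R, 0 < K & forall x, expR (a * norm1 x - c * norm1 x ^+ 2) <= K * wt x.
Proof.
move=> c0; exists (expR ((a + 2) ^+ 2 / (4 * c))) => [|x]; first exact: expR_gt0.
apply: le_trans (_ : _ <= expR ((a + 2) ^+ 2 / (4 * c)) * expR (- (2 * norm1 x))) _; last first.
  by rewrite ler_pM2l ?expR_gt0 // Om_lb.
rewrite -expRD ler_expR; set n := norm1 x.
have -> : a * n - c * n ^+ 2 =
   (a + 2) ^+ 2 / (4 * c) - (2 * n) - ((a + 2) - 2 * c * n) ^+ 2 / (4 * c).
  by field; rewrite gt_eqF.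
by rewrite gerBl divr_ge0 ?sqr_ge0 // mulr_ge0 // ltW.
Qed.

(** A Riemann sum over a grid of step 1/N. All limits are taken in the form of
explicit O(1/N) estimates, so that no integral is needed. *)
Definition grid_mean (N : nat) (f : pts -> C) : C :=
  RC ((N%:R ^+ g)^-1) * summability.sum ((fun k : lat => f (gridpt N k)) : lat -> C).

Definition dominated (K : R) (f : pts -> C) := forall x, md (f x) <= K * wt x.

Lemma dominated_ge0 K f : dominated K f -> 0 <= K.
Proof.
move=> /(_ (fun=> 0)) h; have := le_trans (md_ge0 _) h.
by rewrite pmulr_lge0 // wt_gt0.
Qed.

Lemma dominated_bsum K f N : (0 < N)%N -> dominated K f ->
  bsum (fun k : lat => md (f (gridpt N k))) (K * (4 * N%:R) ^+ g).
Proof.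
move=> N0 hf; apply: bsum_le (bsumZ (dominated_ge0 hf) (bsum_wt N0)) => k; exact: hf.
Qed.

Lemma dominated_asum K f N : (0 < N)%N -> dominated K f -> asum (fun k : lat => f (gridpt N k)).
Proof. by move=> N0 /(dominated_bsum N0) h; eexists; exact: h. Qed.

Lemma grid_mean_le K f N : (0 < N)%N -> dominated K f -> md (grid_mean N f) <= K * 4 ^+ g.
Proof.
move=> N0 hf; rewrite /grid_mean mdM mdRC.
have N1 : 0 < N%:R ^+ g :> R by rewrite exprn_gt0 // ltr0n.
rewrite ger0_norm ?invr_ge0 ?(ltW N1) // mulrC ler_pdivrMr //.
by rewrite -mulrA -exprMn; apply/md_sum_le/dominated_bsum.
Qed.

Lemma grid_meanD K K' f f' N : (0 < N)%N -> dominated K f -> dominated K' f' ->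
  grid_mean N (fun x => f x + f' x) = grid_mean N f + grid_mean N f'.
Proof. by move=> N0 h h'; rewrite /grid_mean -mulrDr (@sumD _ _ (fun k => f (gridpt N k)) (fun k => f' (gridpt N k)) (dominated_asum N0 h) (dominated_asum N0 h')). Qed.

Lemma grid_meanZ K f N c : (0 < N)%N -> dominated K f -> grid_mean N (fun x => c * f x) = c * grid_mean N f.
Proof. by move=> N0 h; rewrite /grid_mean (@sumZ _ _ (fun k => f (gridpt N k)) c (dominated_asum N0 h)) mulrCA. Qed.

Lemma grid_mean_sum (J : Type) (r : seq J) (P : pred J) K (f : J -> pts -> C) N : (0 < N)%N ->
  (forall j, P j -> dominated K (f j)) ->
  grid_mean N (fun x => \sum_(j <- r | P j) f j x) = \sum_(j <- r | P j) grid_mean N (f j).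
Proof.
move=> N0 h; rewrite /grid_mean (@sum_big _ _ _ r P (fun j k => f j (gridpt N k))) ?mulr_sumr // => j /h; exact: dominated_asum.
Qed.

Lemma dominatedD K K' f f' : dominated K f -> dominated K' f' -> dominated (K + K') (fun x => f x + f' x).
Proof. by move=> h h' x; rewrite mulrDl (le_trans (mdD _ _)) // lerD. Qed.

Definition latshift (e : R) (i : 'I_g) x : pts := fun j => x j + e * (i == j)%:R.

(** The grid is invariant under its own steps. This replaces the vanishing of
the integral of a derivative. *)
Lemma grid_mean_shift f K N i : (0 < N)%N -> dominated K f ->
  grid_mean N (fun x => f (latshift N%:R^-1 i x)) = grid_mean N f.
Proof.
move=> N0 hf; rewrite /grid_mean; congr (_ * _).
pose h (s : int) (k : lat) : lat := [ffun j => k j + s * (i == j)%:R].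
have hK s : cancel (h s) (h (- s)).
  by move=> k; apply/ffunP => j; rewrite !ffunE mulNr addrK.
have hh k : latshift N%:R^-1 i (gridpt N k) = gridpt N (h 1 k).
  apply/funext => j; rewrite /latshift /gridpt ffunE rmorphD /= mulrDl mul1r; congr (_ + _).
  by case: (i == j); rewrite ?mulr0 ?mul0r // mulr1 mul1r.
have -> : (fun k => f (latshift N%:R^-1 i (gridpt N k))) = (fun k : lat => f (gridpt N k)) \o h 1.
  by apply/funext => k /=; rewrite hh.
rewrite -(@sum_inj _ _ _ (h 1)) //; first exact: can_inj (hK 1).
- by move=> k nk; case: (nk (h (- 1) k)); rewrite -{1}(opprK 1) hK.
- apply: asum_inj; first exact: can_inj (hK 1).
  exact: dominated_asum hf.
Qed.

(** One step of length e of a deformation: X E changes to first order by e (B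
+ X a) E, with a remainder of order e^2 controlled by a cubic polynomial in
the data. *)
Lemma taylor_step (E X B a b : C) (e T : R) : 0 < e -> e <= 1 -> 1 <= T ->
  md X <= T -> md B <= T -> md a <= T -> md b <= T ->
  md ((X + RC e * B) * (E * cexp (RC e * a + RC (e ^+ 2) * b)) - X * E -
      RC e * ((B + X * a) * E)) <=
  e ^+ 2 * (67 * T ^+ 3 * (md E + md (E * cexp (RC e * a + RC (e ^+ 2) * b)))).
Proof.
move=> e0 e1 T1 hX hB ha hb; set c := _ + _ * b.
have hc : md c <= e * (2 * T).
  apply: (le_trans (mdD _ _)); rewrite !mdM !mdRC !ger0_norm ?sqr_ge0 ?(ltW e0) //.
  have e2 : e ^+ 2 <= e by rewrite expr2 ger_pMl.
  have -> : e * (2 * T) = e * T + e * T by ring.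
  by apply: lerD; apply: ler_pM; rewrite ?md_ge0 ?sqr_ge0 ?(ltW e0).
have -> : (X + RC e * B) * (E * cexp c) - X * E - RC e * ((B + X * a) * E) =
  E * ((X + RC e * B) * (cexp c - 1 - c) + (RC (e ^+ 2) * (X * b) + RC e * (B * c))).
  by move: (cexp c) => y; rewrite /c; ring.
rewrite !mdM; apply: le_trans (_ : md E * (e ^+ 2 * (67 * T ^+ 3 * (1 + md (cexp c)))) <= _); last by rewrite le_eqVlt; apply/orP; left; apply/eqP; ring.
rewrite ler_wpM2l ?md_ge0 //.
apply: (le_trans (mdD _ _)); apply: (le_trans (lerD (lexx _) (mdD _ _))).
rewrite !mdM !mdRC !ger0_norm ?sqr_ge0 ?(ltW e0) //.
have h2 := cexp_bnd2 c; set M := md (cexp c) in h2 *; have M0 : 0 <= M by apply: md_ge0.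
have c0 := md_ge0 c.
have c2 : md c ^+ 2 <= e ^+ 2 * (4 * T ^+ 2).
  have -> : e ^+ 2 * (4 * T ^+ 2) = (e * (2 * T)) ^+ 2 by ring.
  by rewrite ler_sqr ?nnegrE // (le_trans c0).
have t1 : md (X + RC e * B) <= 2 * T.
  apply: (le_trans (mdD _ _)); rewrite mdM mdRC ger0_norm ?(ltW e0) //.
  have := md_ge0 B; nra.
have t2 : md (X + RC e * B) * md (cexp c - 1 - c) <= (2 * T) * (8 * (e ^+ 2 * (4 * T ^+ 2)) * (1 + M)).
  apply: ler_pM; rewrite ?md_ge0 //; apply: le_trans h2 _.
  by rewrite ler_wpM2r ?addr_ge0 // ler_wpM2l.
have t3 : md X * md b <= T ^+ 2 by rewrite expr2 ler_pM ?md_ge0.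
have t4 : e * (md B * md c) <= e ^+ 2 * (2 * T ^+ 2).
  have -> : e ^+ 2 * (2 * T ^+ 2) = e * (T * (e * (2 * T))) by ring.
  by rewrite ler_pM2l // ler_pM ?md_ge0.
have e20 : 0 <= e ^+ 2 by apply: sqr_ge0.
have t5 : e ^+ 2 * (md X * md b) <= e ^+ 2 * T ^+ 2 by rewrite ler_wpM2l.
apply: (le_trans (lerD t2 (lerD t5 t4))).
have -> : 2 * T * (8 * (e ^+ 2 * (4 * T ^+ 2)) * (1 + M)) + (e ^+ 2 * T ^+ 2 + e ^+ 2 * (2 * T ^+ 2))
  = e ^+ 2 * (64 * T ^+ 3 * (1 + M) + 3 * T ^+ 2) by ring.
rewrite ler_wpM2l //.
have T23 : T ^+ 2 <= T ^+ 3 by rewrite ler_weXn2l.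
have T30 : 0 <= T ^+ 3 by rewrite exprn_ge0 // (le_trans ler01).
nra.
Qed.

(** The discrete form of differentiating an integral under the integral sign
and integrating by parts. If the logarithmic derivative kap + D of the family
at E is the divergence of the vector field X against E, then E' - E is, up to
O(e^2), a sum of differences between functions and their translates by one
step of the grid, which have mean zero. *)
Lemma grid_mean_step (E E' : pts -> C) (kap del : C) (D : pts -> C)
   (X a : 'I_g -> pts -> C) (B al : 'I_g -> C) (T : pts -> R) (K : R) (N : nat) :
  (0 < N)%N -> let e := N%:R^-1 : R in
  (forall x, E' x = (1 + RC e * kap) * (E x * cexp (RC e * D x + RC (e ^+ 2) * del))) ->
  (forall i x, E (latshift e i x) = E x * cexp (RC e * a i x + RC (e ^+ 2) * al i)) ->
  (forall i x, X i (latshift e i x) = X i x + RC e * B i) ->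
  (forall x, kap + D x = \sum_i (B i + X i x * a i x)) ->
  (forall x, 1 <= T x) -> (forall x, md kap <= T x) -> (forall x, md del <= T x) ->
  (forall x, md (D x) <= T x) -> (forall i x, md (X i x) <= T x) ->
  (forall i x, md (a i x) <= T x) -> (forall i x, md (B i) <= T x) ->
  (forall i x, md (al i) <= T x) ->
  (forall x, T x ^+ 3 * md (E x) <= K * wt x) ->
  (forall x, T x ^+ 3 * md (E x * cexp (RC e * D x + RC (e ^+ 2) * del)) <= K * wt x) ->
  (forall i x, T x ^+ 3 * md (E (latshift e i x)) <= K * wt x) ->
  md (grid_mean N E' - grid_mean N E) <= e ^+ 2 * (134 * K * (1 + g%:R) * 4 ^+ g).
Proof.
move=> N0 e E'E Es Xs div T1 Tk Td TD TX Ta TB Tal bE bE' bEs.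
have e0 : 0 < e by rewrite invr_gt0 ltr0n.
have e1 : e <= 1 by rewrite invf_le1 ?ltr0n // ler1n.
have T3 x : 1 <= T x ^+ 3 by rewrite exprn_ege1.
have dE : dominated K E.
  by move=> x; apply: le_trans (bE x); rewrite ler_peMl ?md_ge0.
have T0 x : 0 <= T x by rewrite (le_trans ler01).
have TT x : T x <= T x ^+ 3 by rewrite -{1}(expr1 (T x)) ler_weXn2l.
have T2 x : T x ^+ 2 <= T x ^+ 3 by rewrite ler_weXn2l.
have dh i : dominated K (fun x => X i x * E x).
  move=> x; apply: le_trans (bE x); rewrite mdM ler_wpM2r ?md_ge0 //.
  exact: le_trans (TX i x) (TT x).
have dhs i : dominated (2 * K) (fun x => X i (latshift e i x) * E (latshift e i x)).
  move=> x; rewrite -mulrA; apply: le_trans (_ : _ <= 2 * (T x ^+ 3 * md (E (latshift e i x)))) _; last by rewrite ler_wpM2l.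
  rewrite mdM [X in _ <= X]mulrA ler_wpM2r ?md_ge0 // Xs (le_trans (mdD _ _)) // mdM mdRC ger0_norm ?(ltW e0) //.
  have := TX i x; have := TB i x; have := TT x; have := md_ge0 (B i); nra.
have dE' : dominated (2 * K) E'.
  move=> x; rewrite -mulrA; apply: (le_trans (y := 2 * (T x ^+ 3 * md (E x * cexp (RC e * D x + RC (e ^+ 2) * del))))); last by rewrite ler_wpM2l // bE'.
  rewrite E'E mdM [X in _ <= X]mulrA ler_wpM2r ?md_ge0 //.
  rewrite (le_trans (mdD _ _)) // mdM mdRC md1 ger0_norm ?(ltW e0) //.
  have := Tk x; have := T1 x; have := TT x; have := md_ge0 kap; nra.
pose f0 x := E' x - E x - RC e * ((kap + 1 * D x) * E x).
pose fi i x := X i (latshift e i x) * E (latshift e i x) - X i x * E x - RC e * ((B i + X i x * a i x) * E x).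
have df0 : dominated (e ^+ 2 * (134 * K)) f0.
  move=> x; rewrite /f0 E'E -{2}(mul1r (E x)).
  apply: (le_trans (taylor_step _ e0 e1 (T1 x) _ _ _ _)) => //; rewrite ?md1 //.
  rewrite -(mulrA (e ^+ 2) (134 * K)) ler_wpM2l ?sqr_ge0 //.
  have h1 := bE x; have h2 := bE' x; rewrite -(mulrA 67) mulrDr.
  have -> : 134 * K * wt x = 67 * (K * wt x + K * wt x) by ring.
  by rewrite ler_wpM2l // lerD.
have dfi i : dominated (e ^+ 2 * (134 * K)) (fi i).
  move=> x; rewrite /fi Xs Es.
  apply: (le_trans (taylor_step _ e0 e1 (T1 x) _ _ _ _)) => //.
  rewrite -Es -(mulrA (e ^+ 2) (134 * K)) ler_wpM2l ?sqr_ge0 //.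
  have h1 := bE x; have h2 := bEs i x; rewrite -(mulrA 67) mulrDr.
  have -> : 134 * K * wt x = 67 * (K * wt x + K * wt x) by ring.
  by rewrite ler_wpM2l // lerD.
have dsum K' (f : 'I_g -> pts -> C) : (forall i, dominated K' (f i)) -> dominated (g%:R * K') (fun x => \sum_i f i x).
  move=> h x; apply: (le_trans (md_sum _ _ _)); apply: (le_trans (y := \sum_(i < g) (K' * wt x))).
    by apply: ler_sum => i _; apply: h.
  by rewrite sumr_const card_ord -mulrA mulr_natl.
have key x : E' x + (-1) * E x = f0 x + (-1) * (\sum_i fi i x) +
    \sum_i (X i (latshift e i x) * E (latshift e i x) + (-1) * (X i x * E x)).
  have -> : \sum_i fi i x = \sum_i (X i (latshift e i x) * E (latshift e i x) + (-1) * (X i x * E x)) -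
     RC e * ((kap + D x) * E x).
    rewrite /fi sumrB -!mulr_sumr -mulr_suml -div; congr (_ - _).
    by apply: eq_bigr => i _; rewrite mulN1r.
  rewrite /f0 mul1r; ring.
have dN K' f : dominated K' f -> dominated K' (fun x => (-1) * f x).
  by move=> h x; rewrite mulN1r mdN.
have dss i : dominated (2 * K + K) (fun x => X i (latshift e i x) * E (latshift e i x) + (-1) * (X i x * E x)).
  by apply: dominatedD (dhs i) _; apply: dN.
have -> : grid_mean N E' - grid_mean N E = grid_mean N f0 + (-1) * grid_mean N (fun x => \sum_i fi i x).
  have -> : grid_mean N E' - grid_mean N E = grid_mean N (fun x => E' x + (-1) * E x).
    by rewrite (grid_meanD N0 dE' (dN _ _ dE)) (grid_meanZ _ N0 dE) mulN1r.
  rewrite (funext key) (grid_meanD N0 (dominatedD df0 (dN _ _ (dsum _ _ dfi))) (dsum (2 * K + K) (fun i x => X i (latshift e i x) * E (latshift e i x) + (-1) * (X i x * E x)) dss)).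
  rewrite (grid_meanD N0 df0 (dN _ _ (dsum _ _ dfi))) (grid_meanZ _ N0 (dsum _ _ dfi)).
  rewrite (@grid_mean_sum _ _ _ (2 * K + K) (fun i x => X i (latshift e i x) * E (latshift e i x) + (-1) * (X i x * E x)) _ N0) // big1 ?addr0 // => i _.
  rewrite (grid_meanD N0 (dhs i) (dN _ _ (dh i))) (grid_meanZ _ N0 (dh i)).
  by rewrite (grid_mean_shift i N0 (dh i)) mulN1r subrr.
apply: (le_trans (mdD _ _)); rewrite mulN1r mdN.
apply: (le_trans (lerD (grid_mean_le N0 df0) (grid_mean_le N0 (dsum _ _ dfi)))).
by rewrite le_eqVlt; apply/orP; left; apply/eqP; ring.
Qed.

End Weight.

(** * Gaussians in complex coordinates *)

Section Gauss.
Variable R : realType.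
Local Notation C := (Cplx R).
Variables (g d : nat) (p q ps qs : 'I_g -> 'I_d -> C).
Hypothesis Hq : forall i l, q i l = (p i l)^*.
Hypothesis H1 : forall i j, \sum_l (p i l * qs j l + q i l * ps j l) = (i == j)%:R.
Hypothesis Hpq : forall l l', \sum_i p i l * qs i l' = (l == l')%:R.
Hypothesis Hqp : forall l l', \sum_i q i l * ps i l' = (l == l')%:R.
Hypothesis Hpp : forall l l', \sum_i p i l * ps i l' = 0.
Hypothesis Hqq : forall l l', \sum_i q i l * qs i l' = 0.
Local Notation pts := ('I_g -> R).
Implicit Types (x : pts) (w s t : 'I_d -> C).

Definition lincomb (v : 'I_g -> 'I_d -> C) x l : C := \sum_i RC (x i) * v i l.

Definition two_pi_i : C := Complex 0 (2 * pi).

(** The quadratic form is written through linear forms p and q, conjugate on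
real points, and shifted by s and t; letting s and t be independent keeps the
expression holomorphic in the shift. *)
Definition gauss w s t x : C := cexp (two_pi_i * \sum_l w l * ((lincomb p x l + s l) * (lincomb q x l + t l))).

Lemma lin_shift v e i x l : lincomb v (latshift e i x) l = lincomb v x l + RC e * v i l.
Proof.
rewrite /lincomb /latshift; under eq_bigr => j _ do rewrite RCD mulrDl.
rewrite big_split /=; congr (_ + _); rewrite (bigD1 i) //= eqxx mulr1 big1 ?addr0 // => j ji.
by rewrite eq_sym (negbTE ji) mulr0 RC0 mul0r.
Qed.

Lemma lin_add v x y l : lincomb v (fun i => x i + y i) l = lincomb v x l + lincomb v y l.
Proof. by rewrite /lincomb -big_split /=; apply: eq_bigr => i _; rewrite RCD mulrDl. Qed.

Lemma gauss_add w s t x y : gauss w s t (fun i => x i + y i) =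
  gauss w (fun l => s l + lincomb p y l) (fun l => t l + lincomb q y l) x.
Proof.
rewrite /gauss; congr cexp; congr (_ * _); apply: eq_bigr => l _; rewrite !lin_add.
by rewrite [lincomb p x l + lincomb p y l]addrC [lincomb q x l + lincomb q y l]addrC; ring.
Qed.

Lemma conjRC (a : R) : (RC a)^* = RC a.
Proof. by apply: conj_Creal; apply/complex_realP; exists a. Qed.

Lemma linqE x l : lincomb q x l = (lincomb p x l)^*.
Proof.
rewrite /lincomb rmorph_sum; apply: eq_bigr => i _ /=.
by rewrite rmorphM /= Hq conjRC.
Qed.

Lemma md_conj (z : C) : md z^* = md z.
Proof. by rewrite /md norm_conjC. Qed.

Lemma mulconj (z : C) : z * z^* = RC (md z ^+ 2).
Proof. by rewrite -normCK normE expr2 -RCM -expr2. Qed.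

Lemma mdM_le (a b : C) A B : md a <= A -> md b <= B -> md (a * b) <= A * B.
Proof. by move=> h h'; rewrite mdM ler_pM ?md_ge0. Qed.
Lemma mdD_le (a b : C) A B : md a <= A -> md b <= B -> md (a + b) <= A + B.
Proof. by move=> h h'; rewrite (le_trans (mdD _ _)) // lerD. Qed.

Definition coef_bound : R := \sum_i \sum_l (md (p i l) + md (q i l) + md (ps i l) + md (qs i l)).

Lemma bbP i l : [/\ md (p i l) <= coef_bound, md (q i l) <= coef_bound, md (ps i l) <= coef_bound & md (qs i l) <= coef_bound].
Proof.
have h : md (p i l) + md (q i l) + md (ps i l) + md (qs i l) <= coef_bound.
  rewrite /coef_bound (bigD1 i) //= (bigD1 l) //= -!addrA.
  have := md_ge0 (p i l); have := md_ge0 (q i l); have := md_ge0 (ps i l); have := md_ge0 (qs i l).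
  set a := (X in _ + (_ + (_ + (_ + X)))) => *; suff : 0 <= a by lra.
  by rewrite addr_ge0 // sumr_ge0 // => *; rewrite ?sumr_ge0 // => *; rewrite !addr_ge0 ?md_ge0.
have := md_ge0 (p i l); have := md_ge0 (q i l); have := md_ge0 (ps i l); have := md_ge0 (qs i l).
by split; lra.
Qed.

Lemma bb_ge0 : 0 <= coef_bound.
Proof. by rewrite sumr_ge0 // => i _; rewrite sumr_ge0 // => l _; rewrite !addr_ge0 ?md_ge0. Qed.

Lemma lin_bnd v x l : (forall i, md (v i l) <= coef_bound) -> md (lincomb v x l) <= coef_bound * norm1 x.
Proof.
move=> h; apply: (le_trans (md_sum _ _ _)); rewrite /norm1 mulr_sumr; apply: ler_sum => i _.
by rewrite mdM mdRC mulrC ler_wpM2r.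
Qed.

Lemma linp_bnd x l : md (lincomb p x l) <= coef_bound * norm1 x.
Proof. by apply: lin_bnd => i; have [] := bbP i l. Qed.
Lemma linq_bnd x l : md (lincomb q x l) <= coef_bound * norm1 x.
Proof. by apply: lin_bnd => i; have [] := bbP i l. Qed.

Lemma coordE x j : RC (x j) = \sum_l (lincomb p x l * qs j l + lincomb q x l * ps j l).
Proof.
transitivity (\sum_i RC (x i) * (i == j)%:R).
  rewrite (bigD1 j) //= eqxx mulr1 big1 ?addr0 // => i /negbTE ->; exact: mulr0.
under eq_bigr => i _ do rewrite -H1 mulr_sumr.
rewrite exchange_big /=; apply: eq_bigr => l _.
rewrite /lincomb !mulr_suml -big_split /=; apply: eq_bigr => i _; ring.
Qed.

(** Real coordinates are recovered from the complex linear forms by means of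
the dual forms ps and qs. *)
Lemma nn_bnd x : norm1 x <= g%:R * (2 * coef_bound) * \sum_l md (lincomb p x l).
Proof.
rewrite -mulrA; apply: (le_trans (y := \sum_(j < g) (2 * coef_bound * \sum_l md (lincomb p x l)))).
  apply: ler_sum => j _; rewrite -mdRC coordE mulr_sumr.
  apply: (le_trans (md_sum _ _ _)); apply: ler_sum => l _.
  apply: (le_trans (mdD _ _)); rewrite !mdM linqE md_conj.
  have [_ _ h1 h2] := bbP j l; have h3 := md_ge0 (lincomb p x l).
  have t1 := ler_wpM2l h3 h1; have t2 := ler_wpM2l h3 h2; lra.
by rewrite sumr_const card_ord [X in _ <= X]mulr_natl.
Qed.

Lemma cs_sum (a : 'I_d -> R) : (\sum_l a l) ^+ 2 <= d%:R * \sum_l a l ^+ 2.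
Proof.
case: d a => [|n] a; first by rewrite !big_ord0 expr0n mulr0.
set S := \sum_l a l; set k : R := n.+1%:R; have k0 : 0 < k by rewrite ltr0n.
have h : 0 <= \sum_l (a l - S / k) ^+ 2 by rewrite sumr_ge0 // => l _; exact: sqr_ge0.
have e : \sum_l (a l - S / k) ^+ 2 = \sum_l a l ^+ 2 - S ^+ 2 / k.
  rewrite (eq_bigr (fun l => a l ^+ 2 + (a l * (- (2 * S / k)) + (S / k) ^+ 2))); last first.
    by move=> l _; ring.
  rewrite !big_split /= -mulr_suml -/S sumr_const card_ord -mulr_natl -/k.
  by field; rewrite gt_eqF.
rewrite e subr_ge0 ler_pdivrMr // in h; by rewrite mulrC.
Qed.

(** The quadratic form is definite, because the linear forms separate points.
*)
Lemma coercive : exists2 c : R, 0 < c & forall x, c * norm1 x ^+ 2 <= \sum_l md (lincomb p x l) ^+ 2.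
Proof.
set K := g%:R * (2 * coef_bound); have K0 : 0 <= K by rewrite !mulr_ge0 // bb_ge0.
have M0 : 0 < K ^+ 2 * d%:R + 1 by rewrite ltr_wpDl // mulr_ge0 ?sqr_ge0.
exists (K ^+ 2 * d%:R + 1)^-1 => [|x]; first by rewrite invr_gt0.
have S0 : 0 <= \sum_l md (lincomb p x l) ^+ 2 by rewrite sumr_ge0 // => l _; exact: sqr_ge0.
rewrite mulrC ler_pdivrMr //.
have h1 := nn_bnd x; have h2 := cs_sum (fun l => md (lincomb p x l)).
have h3 : norm1 x ^+ 2 <= K ^+ 2 * (\sum_l md (lincomb p x l)) ^+ 2.
  by rewrite -exprMn ler_sqr ?nnegrE ?norm1_ge0 // mulr_ge0 // sumr_ge0 // => l _; exact: md_ge0.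
apply: (le_trans h3); apply: (le_trans (ler_wpM2l (sqr_ge0 K) h2)).
by rewrite mulrA mulrC ler_wpM2l // lerDl.
Qed.

Lemma gauss_bnd (c0 W S : R) : 0 < c0 -> exists a b c, 0 < c /\
  forall w s t, (forall l, c0 <= complex.Im (w l)) -> (forall l, md (w l) <= W) ->
   (forall l, md (s l) <= S) -> (forall l, md (t l) <= S) ->
   forall x, md (gauss w s t x) <= expR b * expR (a * norm1 x - c * norm1 x ^+ 2).
Proof.
move=> c00; have [c1 c10 hc] := coercive; have p0 := pi_gt0 R.
exists (2 * pi * d%:R * (W * (2 * coef_bound * S))), (2 * pi * d%:R * (W * S ^+ 2)), (2 * pi * (c0 * c1)).
split=> [|w s t hw hW hs ht x]; first by rewrite !mulr_gt0.
rewrite -expRD md_cexp ler_expR.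
have -> : complex.Re (two_pi_i * \sum_l w l * ((lincomb p x l + s l) * (lincomb q x l + t l))) =
   - (2 * pi) * \sum_l complex.Im (w l * ((lincomb p x l + s l) * (lincomb q x l + t l))).
  rewrite /two_pi_i; have -> : forall z : C, complex.Re ((Complex 0 (2 * pi) : C) * z) = - (2 * pi) * complex.Im z.
    by case=> a b /=; ring.
  congr (_ * _); elim/big_rec2: _ => [//|i y z _ <-]; exact: ImD.
suff h l : c0 * md (lincomb p x l) ^+ 2 - W * (2 * coef_bound * S) * norm1 x - W * S ^+ 2 <=
    complex.Im (w l * ((lincomb p x l + s l) * (lincomb q x l + t l))).
  have h' : c0 * (c1 * norm1 x ^+ 2) - d%:R * (W * (2 * coef_bound * S) * norm1 x) - d%:R * (W * S ^+ 2) <=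
     \sum_l complex.Im (w l * ((lincomb p x l + s l) * (lincomb q x l + t l))).
    apply: le_trans (ler_sum _ (fun l _ => h l)).
    have sc (k : R) : \sum_(l < d) k = d%:R * k by rewrite sumr_const card_ord mulr_natl.
    rewrite !sumrB !sc -mulr_sumr.
    by have h1 := ler_wpM2l (ltW c00) (hc x); apply: lerB => //; apply: lerB.
  have hh := ler_wnM2l (_ : - (2 * pi) <= 0 :> R) h'.
  apply: le_trans (hh _) _; first by rewrite oppr_le0 mulr_ge0 // ltW.
  by rewrite le_eqVlt; apply/orP; left; apply/eqP; ring.
have -> : w l * ((lincomb p x l + s l) * (lincomb q x l + t l)) =
  RC (md (lincomb p x l) ^+ 2) * w l + w l * (lincomb p x l * t l + s l * lincomb q x l + s l * t l).
  rewrite -mulconj -linqE; ring.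
rewrite ImD Im_RCM -!addrA lerD //; first by rewrite mulrC ler_wpM2l ?sqr_ge0.
set y := w l * _; have hy : md y <= W * (2 * coef_bound * S) * norm1 x + W * S ^+ 2.
  have -> : W * (2 * coef_bound * S) * norm1 x + W * S ^+ 2 = W * ((coef_bound * norm1 x) * S + (S * (coef_bound * norm1 x) + S * S)) by ring.
  apply: mdM_le; first exact: hW.
  apply: mdD_le; last apply: mdD_le; apply: mdM_le => //; [exact: linp_bnd|exact: linq_bnd].
have := Im_md y; rewrite ler_norml => /andP[h _]; lra.
Qed.

(** Uniform domination by the weight, with room for a polynomial factor; tau
and the sixth power provide for the cubic factors of grid_mean_step. *)
Lemma gauss_dom (c0 W S tau : R) : 0 < c0 -> 0 <= tau -> exists2 K : R, 0 < K &
  forall w s t, (forall l, c0 <= complex.Im (w l)) -> (forall l, md (w l) <= W) ->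
   (forall l, md (s l) <= S) -> (forall l, md (t l) <= S) ->
   forall x, (tau * (1 + norm1 x) ^+ 2) ^+ 3 * md (gauss w s t x) <= K * wt x.
Proof.
move=> c00 tau0; have [a [b [c [cg0 h]]]] := gauss_bnd W S c00.
have [K K0 hK] := @exp_quad_le_wt R g (a + 6) c cg0.
exists ((tau ^+ 3 + 1) * expR b * K) => [|w s t hw hW hs ht x].
  by rewrite !mulr_gt0 ?expR_gt0 // ltr_wpDl // exprn_ge0.
have h1 := h w s t hw hW hs ht x; have n0 := norm1_ge0 x.
have h2 : (1 + norm1 x) ^+ 6 <= expR (6 * norm1 x).
  rewrite expRM_natl; apply: lerXn2r; rewrite ?nnegrE ?expR_ge0 ?addr_ge0 //.
  exact: expR_ge1Dx.
have -> : (tau * (1 + norm1 x) ^+ 2) ^+ 3 = tau ^+ 3 * (1 + norm1 x) ^+ 6.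
  by rewrite exprMn -exprM.
rewrite -(mulrA (tau ^+ 3)).
have -> : (tau ^+ 3 + 1) * expR b * K * wt x = (tau ^+ 3 + 1) * (expR b * (K * wt x)) by ring.
apply: ler_pM.
- by rewrite exprn_ge0.
- by rewrite mulr_ge0 ?md_ge0 // exprn_ge0 // addr_ge0.
- by rewrite lerDl.
apply: (le_trans (ler_pM _ (md_ge0 _) h2 h1)); first by rewrite exprn_ge0 // addr_ge0.
rewrite mulrCA ler_pM2l ?expR_gt0 //; apply: le_trans (hK x).
by rewrite -expRD ler_expR le_eqVlt; apply/orP; left; apply/eqP; ring.
Qed.

Lemma gauss_dom1 (c0 W S : R) : 0 < c0 -> exists2 K : R, 0 < K &
  forall w s t, (forall l, c0 <= complex.Im (w l)) -> (forall l, md (w l) <= W) ->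
   (forall l, md (s l) <= S) -> (forall l, md (t l) <= S) -> dominated K (gauss w s t).
Proof.
move=> c00; have [K K0 h] := gauss_dom W S c00 ler01; exists K => // w s t hw hW hs ht x.
apply: le_trans (h w s t hw hW hs ht x); rewrite mul1r ler_peMl ?md_ge0 //.
by rewrite !exprn_ege1 // lerDl norm1_ge0.
Qed.

Lemma gauss_shift w s t e i x : gauss w s t (latshift e i x) = gauss w s t x *
  cexp (RC e * (two_pi_i * \sum_l w l * (p i l * (lincomb q x l + t l) + q i l * (lincomb p x l + s l))) +
        RC (e ^+ 2) * (two_pi_i * \sum_l w l * (p i l * q i l))).
Proof.
rewrite /gauss -cexpD; congr cexp.
rewrite !(mulrCA (RC _) two_pi_i) -!mulrDr; congr (_ * _).
rewrite !mulr_sumr -!big_split /=; apply: eq_bigr => l _; rewrite !lin_shift.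
by rewrite expr2 RCM; ring.
Qed.

Lemma sum_bnd (n : nat) (F : 'I_n -> C) c : (forall i, md (F i) <= c) ->
  md (\sum_i F i) <= n%:R * c.
Proof.
move=> h; apply: (le_trans (md_sum _ _ _)).
by apply: (le_trans (ler_sum _ (fun i _ => h i))); rewrite sumr_const card_ord mulr_natl.
Qed.

(** Both deformations below follow a segment cut in N steps, each of which
costs O(N^-2). *)
Lemma telescope_bound (F : nat -> nat -> C) (c : R) :
  (forall N k, (0 < N)%N -> (k < N)%N -> md (F N k.+1 - F N k) <= (N%:R^-1) ^+ 2 * c) ->
  forall N, (0 < N)%N -> md (F N N - F N 0%N) <= c / N%:R.
Proof.
move=> h N N0; suff H k : (k <= N)%N -> md (F N k - F N 0%N) <= k%:R * ((N%:R^-1) ^+ 2 * c).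
  apply: le_trans (H N (leqnn N)) _; rewrite le_eqVlt; apply/orP; left; apply/eqP.
  by field; rewrite pnatr_eq0 -lt0n.
elim: k => [|k IH] kN; first by rewrite subrr md0 mul0r.
have -> : F N k.+1 - F N 0%N = (F N k.+1 - F N k) + (F N k - F N 0%N) by ring.
apply: (le_trans (mdD _ _)); apply: (le_trans (lerD (h N k N0 kN) (IH (ltnW kN)))).
by rewrite -natr1 mulrDl mul1r addrC.
Qed.

Lemma exists_lb (w : 'I_d -> C) : (forall l, 0 < complex.Im (w l)) ->
  exists2 c : R, 0 < c & forall l, c <= complex.Im (w l).
Proof.
move=> h; pose S := 1 + \sum_l (complex.Im (w l))^-1.
have S0 : 0 < S by rewrite ltr_pwDl // sumr_ge0 // => l _; rewrite invr_ge0 ltW.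
exists S^-1 => [|l]; first by rewrite invr_gt0.
rewrite -[X in _ <= X]invrK lef_pV2 ?posrE ?invr_gt0 // /S (bigD1 l) //=.
rewrite addrCA lerDl addr_ge0 // sumr_ge0 // => k _; by rewrite invr_ge0 ltW.
Qed.

Lemma exists_ub (w : 'I_d -> C) : exists2 c : R, 0 <= c & forall l, md (w l) <= c.
Proof.
exists (\sum_l md (w l)) => [|l]; first by rewrite sumr_ge0 // => l _; exact: md_ge0.
by rewrite (bigD1 l) //= lerDl sumr_ge0 // => k _; exact: md_ge0.
Qed.

Lemma sum_bndM (n : nat) (F : 'I_n -> C) c M : 0 <= c -> n%:R <= M ->
  (forall i, md (F i) <= c) -> md (\sum_i F i) <= M * c.
Proof. by move=> c0 nM /sum_bnd h; rewrite (le_trans h) // ler_wpM2r. Qed.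

Lemma pow_le (M n : R) i j : 1 <= M -> 1 <= n -> (i <= 6)%N -> (j <= 2)%N ->
  M ^+ i * n ^+ j <= M ^+ 6 * n ^+ 2.
Proof.
move=> M1 n1 hi hj; have M0 : 0 <= M by apply: le_trans M1.
have n0 : 0 <= n by apply: le_trans n1.
by rewrite ler_pM ?exprn_ge0 ?ler_weXn2l.
Qed.

Lemma gauss_latshift_dom (c0 W S tau : R) : 0 < c0 -> 0 <= tau -> 0 <= S -> exists2 K : R, 0 < K &
  forall w s t, (forall l, c0 <= complex.Im (w l)) -> (forall l, md (w l) <= W) ->
   (forall l, md (s l) <= S) -> (forall l, md (t l) <= S) ->
   (forall x, (tau * (1 + norm1 x) ^+ 2) ^+ 3 * md (gauss w s t x) <= K * wt x) /\
   (forall e, 0 <= e <= 1 -> forall i x, (tau * (1 + norm1 x) ^+ 2) ^+ 3 * md (gauss w s t (latshift e i x)) <= K * wt x).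
Proof.
move=> c00 tau0 S0; have [K K0 h] := gauss_dom W (S + coef_bound) c00 tau0; have b0 := bb_ge0.
exists K => // w s t hw hW hs ht; split=> [x|e /andP[e0 e1] i x].
  by apply: h => // l; rewrite (le_trans (_ : _ <= S)) ?lerDl.
have hl v l : (forall j, md (v j l) <= coef_bound) -> md (lincomb v (fun j => e * (i == j)%:R) l) <= coef_bound.
  move=> hv; have -> : lincomb v (fun j => e * (i == j)%:R) l = RC e * v i l.
    rewrite /lincomb (bigD1 i) //= eqxx mulr1 big1 ?addr0 // => j /negbTE ji.
    by rewrite eq_sym ji mulr0 RC0 mul0r.
  by rewrite mdM mdRC ger0_norm // -[X in _ <= X]mul1r ler_pM ?md_ge0.
rewrite [gauss _ _ _ _]gauss_add; apply: h => // l; apply: mdD_le => //; apply: hl => j.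
  by have [] := bbP j l.
by have [] := bbP j l.
Qed.

(** Moving the centre of a Gaussian by a complex vector does not change its
mean, up to O(1/N): the deformation is a translation, whose generator is a
divergence. *)
Lemma grid_mean_shifted w s t : (forall l, 0 < complex.Im (w l)) ->
  exists2 c : R, 0 <= c & forall N, (0 < N)%N ->
    md (grid_mean N (gauss w s t) - grid_mean N (gauss w (fun=> 0) (fun=> 0))) <= c / N%:R.
Proof.
move=> w0; have [c0 c00 hc0] := exists_lb w0.
have [W W0 hW] := exists_ub w; have [S1 S10 hS1] := exists_ub s; have [S2 S20 hS2] := exists_ub t.
have p0 := pi_gt0 R; have b0 := bb_ge0.
pose M := 1 + 2 * pi + W + (S1 + S2) + coef_bound + d%:R; have dR : 0 <= d%:R :> R by [].
have M1 : 1 <= M by rewrite /M; lra.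
have M0 : 0 <= M by apply: le_trans M1.
have hw l : md (w l) <= M by apply: le_trans (hW l) _; rewrite /M; lra.
have hs l : md (s l) <= M by apply: le_trans (hS1 l) _; rewrite /M; lra.
have ht l : md (t l) <= M by apply: le_trans (hS2 l) _; rewrite /M; lra.
have htpi : md two_pi_i <= M.
  apply: (le_trans (md_ReIm _)); rewrite /= normr0 add0r ger0_norm ?mulr_ge0 ?(ltW p0) //.
  rewrite /M; lra.
have hd : d%:R <= M by rewrite /M; lra.
have hb : coef_bound <= M by rewrite /M; lra.
have hbp i l : [/\ md (p i l) <= M, md (q i l) <= M, md (ps i l) <= M & md (qs i l) <= M].
  by have [? ? ? ?] := bbP i l; split; apply: le_trans hb.
pose tau := 2 * M ^+ 6; have tau0 : 0 <= tau by rewrite mulr_ge0 // exprn_ge0.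
have [K K0 hK] := gauss_latshift_dom M c00 tau0 M0.
pose sk N k l := RC (k%:R / N%:R) * s l; pose tk N k l := RC (k%:R / N%:R) * t l.
pose E N k := gauss w (sk N k) (tk N k).
exists (134 * K * (1 + g%:R) * 4 ^+ g) => [|N N0].
  by rewrite !mulr_ge0 ?exprn_ge0 // ltW.
have NR : 0 < N%:R :> R by rewrite ltr0n.
have hE0 : gauss w (fun=> 0) (fun=> 0) = E N 0%N.
  by apply: f_equal2; apply/funext => l; rewrite /sk /tk mul0r RC0 mul0r.
have hEN : gauss w s t = E N N.
  by apply: f_equal2; apply/funext => l; rewrite /sk /tk divff ?gt_eqF // RC1 mul1r.
have -> : grid_mean N (gauss w s t) - grid_mean N (gauss w (fun=> 0) (fun=> 0)) = grid_mean N (E N N) - grid_mean N (E N 0%N).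
  by apply: f_equal2; [exact: f_equal hEN|apply: f_equal; exact: f_equal hE0].
apply: (telescope_bound (F := fun N k => grid_mean N (E N k))) N0 => {N NR hE0 hEN} N k N0 kN.
have NR : 0 < N%:R :> R by rewrite ltr0n.
have k1 : (k%:R / N%:R : R) <= 1 by rewrite ler_pdivrMr // mul1r ler_nat ltnW.
have k1' : (k.+1%:R / N%:R : R) <= 1 by rewrite ler_pdivrMr // mul1r ler_nat.
have hk j (v : 'I_d -> C) l : (j%:R / N%:R : R) <= 1 -> md (v l) <= M -> md (RC (j%:R / N%:R) * v l) <= M.
  move=> j1 hv; rewrite mdM mdRC ger0_norm ?divr_ge0 // -[X in _ <= X]mul1r.
  by rewrite ler_pM ?divr_ge0 ?md_ge0.
have hsk l : md (sk N k l) <= M by apply: hk.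
have htk l : md (tk N k l) <= M by apply: hk.
pose D x := two_pi_i * \sum_l w l * (s l * (lincomb q x l + tk N k l) + t l * (lincomb p x l + sk N k l)).
pose del := two_pi_i * \sum_l w l * (s l * t l).
have e0 : 0 <= (N%:R^-1 : R) <= 1 by rewrite invr_ge0 ltW //= invf_le1 // ler1n.
have kS : k.+1%:R / N%:R = k%:R / N%:R + N%:R^-1 :> R by rewrite -natr1 mulrDl mul1r.
have ES x : E N k.+1 x = E N k x * cexp (RC N%:R^-1 * D x + RC (N%:R^-1 ^+ 2) * del).
  rewrite /E /gauss -cexpD; congr cexp; rewrite /D /del !(mulrCA (RC _) two_pi_i) -!mulrDr; congr (_ * _).
  rewrite !mulr_sumr -!big_split /=; apply: eq_bigr => l _.
  have -> : sk N k.+1 l = sk N k l + RC N%:R^-1 * s l by rewrite /sk kS RCD mulrDl.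
  have -> : tk N k.+1 l = tk N k l + RC N%:R^-1 * t l by rewrite /tk kS RCD mulrDl.
  by rewrite expr2 RCM; move: (RC _) (lincomb p x l) (lincomb q x l) (sk N k l) (tk N k l) => *; ring.
have nx x : 1 <= 1 + norm1 x by rewrite lerDl norm1_ge0.
have n0 x : 0 <= 1 + norm1 x by rewrite (le_trans _ (nx x)).
have hlin v x l u : (forall i, md (v i l) <= coef_bound) -> md u <= M -> md (lincomb v x l + u) <= M * (1 + norm1 x).
  move=> hv hu; rewrite mulrDr mulr1 addrC; apply: mdD_le => //.
  by apply: le_trans (lin_bnd x hv) _; rewrite ler_wpM2r // norm1_ge0.
have hp x l u : md u <= M -> md (lincomb p x l + u) <= M * (1 + norm1 x).
  by apply: hlin => i; have [] := bbP i l.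
have hq x l u : md u <= M -> md (lincomb q x l + u) <= M * (1 + norm1 x).
  by apply: hlin => i; have [] := bbP i l.
have hT x i j c : (i <= 6)%N -> (j <= 2)%N -> c <= 2 -> c * (M ^+ i * (1 + norm1 x) ^+ j) <= tau * (1 + norm1 x) ^+ 2.
  move=> hi hj c2; rewrite /tau -mulrA; apply: (le_trans (y := 2 * (M ^+ i * (1 + norm1 x) ^+ j))).
    by rewrite ler_wpM2r // mulr_ge0 // exprn_ge0.
  by rewrite ler_wpM2l // pow_le.
have le1 : (1 : R) <= 2 by rewrite ler1n.
have Mn x : 0 <= M * (1 + norm1 x) by rewrite mulr_ge0.
have hX i : md (\sum_l (s l * qs i l + t l * ps i l)) <= 2 * M ^+ 3.
  apply: (le_trans (y := M * (M * M + M * M))); last by rewrite le_eqVlt; apply/orP; left; apply/eqP; ring.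
  apply: sum_bndM => // [|l]; first by rewrite addr_ge0 ?mulr_ge0.
  by apply: mdD_le; apply: mdM_le => //; have [] := hbp i l.
have ha i x (f : 'I_d -> C) (f' : 'I_d -> C) : (forall l, md (f l) <= M) -> (forall l, md (f' l) <= M) ->
   md (two_pi_i * \sum_l w l * (f l * (lincomb q x l + tk N k l) + f' l * (lincomb p x l + sk N k l))) <= tau * (1 + norm1 x) ^+ 2.
  move=> hf hf'; apply: (le_trans (y := M * (M * (M * (M * (M * (1 + norm1 x)) + M * (M * (1 + norm1 x))))))).
    apply: mdM_le => //; apply: sum_bndM => // [|l]; first by rewrite mulr_ge0 // addr_ge0 // mulr_ge0.
    by apply: mdM_le => //; apply: mdD_le; apply: mdM_le => //; [exact: hq|exact: hp].
  apply: le_trans (hT x 5%N 1%N 2 _ _ _) => //.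
  by rewrite le_eqVlt; apply/orP; left; apply/eqP; rewrite expr1; ring.
have hal (f f' : 'I_d -> C) x : (forall l, md (f l) <= M) -> (forall l, md (f' l) <= M) ->
   md (two_pi_i * \sum_l w l * (f l * f' l)) <= tau * (1 + norm1 x) ^+ 2.
  move=> hf hf'; apply: (le_trans (y := M * (M * (M * (M * M))))).
    apply: mdM_le => //; apply: sum_bndM => // [|l]; first by rewrite !mulr_ge0.
    by apply: mdM_le => //; apply: mdM_le.
  apply: le_trans (hT x 5%N 0%N 1 _ _ _) => //.
  by rewrite le_eqVlt; apply/orP; left; apply/eqP; ring.
have [hK1 hK2] := hK w (sk N k) (tk N k) hc0 hw hsk htk.
have [hK3 _] := hK w (sk N k.+1) (tk N k.+1) hc0 hw (fun l => hk _ _ _ k1' (hs l)) (fun l => hk _ _ _ k1' (ht l)).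
apply: (@grid_mean_step R g (E N k) (E N k.+1) 0 del D
  (fun i _ => \sum_l (s l * qs i l + t l * ps i l))
  (fun i x => two_pi_i * \sum_l w l * (p i l * (lincomb q x l + tk N k l) + q i l * (lincomb p x l + sk N k l)))
  (fun=> 0) (fun i => two_pi_i * \sum_l w l * (p i l * q i l)) (fun x => tau * (1 + norm1 x) ^+ 2) K N N0).
- by move=> x; rewrite mulr0 addr0 mul1r ES.
- by move=> i x; exact: gauss_shift.
- by move=> i x; rewrite mulr0 addr0.
- move=> x; rewrite add0r.
  under eq_bigr => i _ do rewrite add0r mulrCA.
  rewrite -mulr_sumr /D; congr (_ * _).
  under [RHS]eq_bigr => i _ do rewrite mulr_sumr.
  rewrite exchange_big /=; apply: eq_bigr => l _.
  under eq_bigr => i _ do rewrite mulrCA.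
  rewrite -mulr_sumr; congr (_ * _).
  have hsum (v : 'I_g -> 'I_d -> C) (f : 'I_d -> C) :
     \sum_i (\sum_l0 (s l0 * qs i l0 + t l0 * ps i l0)) * v i l =
     \sum_l0 (s l0 * (\sum_i v i l * qs i l0) + t l0 * (\sum_i v i l * ps i l0)).
    under eq_bigr => i _ do rewrite mulr_suml.
    rewrite exchange_big /=; apply: eq_bigr => l0 _; rewrite !mulr_sumr -big_split /=.
    by apply: eq_bigr => i _; ring.
  have e1 : \sum_i (\sum_l0 (s l0 * qs i l0 + t l0 * ps i l0)) * p i l = s l.
    rewrite hsum // (bigD1 l) //= Hpq Hpp eqxx mulr1 mulr0 addr0 big1 ?addr0 // => l0 /negbTE ll.
    by rewrite Hpq Hpp eq_sym ll !mulr0 addr0.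
  have e2 : \sum_i (\sum_l0 (s l0 * qs i l0 + t l0 * ps i l0)) * q i l = t l.
    rewrite hsum // (bigD1 l) //= Hqp Hqq eqxx mulr1 mulr0 add0r big1 ?addr0 // => l0 /negbTE ll.
    by rewrite Hqp Hqq eq_sym ll !mulr0 addr0.
  rewrite -{1}e1 -{1}e2 !mulr_suml -big_split /=; apply: eq_bigr => i _; ring.
- move=> x; apply: le_trans (hT x 0%N 0%N 1 _ _ _) => //; by rewrite !expr0 !mulr1.
- by move=> x; rewrite md0 mulr_ge0 // sqr_ge0.
- by move=> x; apply: hal.
- by move=> x; apply: ha.
- move=> i x; apply: le_trans (hX i) _; apply: le_trans (hT x 3%N 0%N 2 _ _ _) => //.
  by rewrite expr0 mulr1.
- by move=> i x; apply: ha => // l; have [] := hbp i l.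
- by move=> i x; rewrite md0 mulr_ge0 // sqr_ge0.
- by move=> i x; apply: hal => l; have [] := hbp i l.
- exact: hK1.
- by move=> x; rewrite -ES; exact: hK3.
- by move=> i x; apply: hK2.
Qed.

Local Notation z0 := (fun _ : 'I_d => 0 : C).

(** Deformation of a single parameter w_l0 along the segment from w to w' in
the upper half plane. The Euler field attached to the coordinate l0 has
divergence 1, which is what the factor w_l0 compensates. *)
Lemma grid_mean_scale1 (l0 : 'I_d) w w' : (forall l, 0 < complex.Im (w l)) ->
  (forall l, 0 < complex.Im (w' l)) -> (forall l, l != l0 -> w' l = w l) ->
  exists2 c : R, 0 <= c & forall N, (0 < N)%N ->
    md (w' l0 * grid_mean N (gauss w' z0 z0) - w l0 * grid_mean N (gauss w z0 z0)) <= c / N%:R.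
Proof.
move=> w0 w0' ww'; have [c1 c10 hc1] := exists_lb w0; have [c2 c20 hc2] := exists_lb w0'.
pose c0 := Num.min c1 c2; have c00 : 0 < c0 by rewrite lt_min c10.
have hc1' l : c0 <= complex.Im (w l) by rewrite (le_trans _ (hc1 l)) // ge_min lexx.
have hc2' l : c0 <= complex.Im (w' l) by rewrite (le_trans _ (hc2 l)) // ge_min lexx orbT.
have [W1 W10 hW1] := exists_ub w; have [W2 W20 hW2] := exists_ub w'.
have p0 := pi_gt0 R; have b0 := bb_ge0.
pose V := (W1 + W2) / c0; have V0 : 0 <= V by rewrite divr_ge0 ?addr_ge0 // ltW.
pose M := 1 + 2 * pi + (W1 + W2) + V + coef_bound + d%:R; have dR : 0 <= d%:R :> R by [].
have M1 : 1 <= M by rewrite /M; lra.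
have M0 : 0 <= M by apply: le_trans M1.
have htpi : md two_pi_i <= M.
  apply: (le_trans (md_ReIm _)); rewrite /= normr0 add0r ger0_norm ?mulr_ge0 ?(ltW p0) //.
  rewrite /M; lra.
have hd : d%:R <= M by rewrite /M; lra.
have hb : coef_bound <= M by rewrite /M; lra.
have hbp i l : [/\ md (p i l) <= M, md (q i l) <= M, md (ps i l) <= M & md (qs i l) <= M].
  by have [? ? ? ?] := bbP i l; split; apply: le_trans hb.
pose tau := 2 * M ^+ 6; have tau0 : 0 <= tau by rewrite mulr_ge0 // exprn_ge0.
have [K K0 hK] := gauss_latshift_dom M c00 tau0 (lexx 0).
pose wk N k l := w l + RC (k%:R / N%:R) * (w' l - w l).
pose E N k x := wk N k l0 * gauss (wk N k) z0 z0 x.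
exists (134 * (M * K) * (1 + g%:R) * 4 ^+ g) => [|N N0].
  by rewrite !mulr_ge0 ?exprn_ge0 // ltW.
have NR : 0 < N%:R :> R by rewrite ltr0n.
have wkb M' k l : (0 < M')%N -> (k <= M')%N -> c0 <= complex.Im (wk M' k l) /\ md (wk M' k l) <= M.
  move=> M'0 kM; have NR' : 0 < M'%:R :> R by rewrite ltr0n.
  set sg : R := k%:R / M'%:R; have s0 : 0 <= sg by rewrite divr_ge0.
  have s1 : sg <= 1 by rewrite /sg ler_pdivrMr // mul1r ler_nat.
  have -> : wk M' k l = RC (1 - sg) * w l + RC sg * w' l by rewrite /wk -/sg RCD RCN RC1; ring.
  split.
    rewrite ImD !Im_RCM.
    have -> : c0 = (1 - sg) * c0 + sg * c0 by ring.
    by rewrite lerD // ler_wpM2l // subr_ge0.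
  apply: (le_trans (y := W1 + W2)); last by rewrite /M; lra.
  rewrite -[W1]mul1r -[W2]mul1r; apply: mdD_le; apply: mdM_le => //; rewrite mdRC ger0_norm //; lra.
have muE k : (k <= N)%N -> wk N k l0 * grid_mean N (gauss (wk N k) z0 z0) = grid_mean N (E N k).
  move=> kN; have [K1 K10 hK1] := gauss_dom1 M 0 c00.
  by rewrite /E (grid_meanZ _ N0 (K := K1)) //; apply: hK1 => l; rewrite ?md0 //; have [] := wkb N k l N0 kN.
have wkN : wk N N = w' by apply/funext => l; rewrite /wk divff ?gt_eqF // RC1 mul1r addrC subrK.
have wk0 : wk N 0%N = w by apply/funext => l; rewrite /wk mul0r RC0 mul0r addr0.
have -> : w' l0 * grid_mean N (gauss w' z0 z0) = grid_mean N (E N N) by rewrite -muE // wkN.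
have -> : w l0 * grid_mean N (gauss w z0 z0) = grid_mean N (E N 0%N) by rewrite -muE // wk0.
apply: (telescope_bound (F := fun N k => grid_mean N (E N k))) N0 => {N NR wkN wk0 muE} N k N0 kN.
have NR : 0 < N%:R :> R by rewrite ltr0n.
have e0 : 0 <= (N%:R^-1 : R) <= 1 by rewrite invr_ge0 ltW //= invf_le1 // ler1n.
have hI l : c0 <= complex.Im (wk N k l) by have [] := wkb N k l N0 (ltnW kN).
have hw l : md (wk N k l) <= M by have [] := wkb N k l N0 (ltnW kN).
have hI' l : c0 <= complex.Im (wk N k.+1 l) by have [] := wkb N k.+1 l N0 kN.
have hw' l : md (wk N k.+1 l) <= M by have [] := wkb N k.+1 l N0 kN.
have wc : c0 <= md (wk N k l0) by apply: le_trans (hI l0) (le_trans (ler_norm _) (Im_md _)).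
have wn : wk N k l0 != 0 by rewrite -md_gt0 (lt_le_trans c00).
pose dw := w' l0 - w l0; have hdw1 : md dw <= W1 + W2.
  by rewrite addrC; apply: (le_trans (mdB _ _)); rewrite lerD.
have hdw : md dw <= M by apply: le_trans hdw1 _; rewrite /M; lra.
pose kap := dw / wk N k l0; have hkap : md kap <= M.
  apply: (le_trans (y := V)); last by rewrite /M; lra.
  rewrite /kap mdM mdV ler_pM ?md_ge0 ?invr_ge0 ?md_ge0 //.
  by rewrite lef_pV2 ?posrE // (lt_le_trans c00).
have wS l : wk N k.+1 l = wk N k l + RC N%:R^-1 * (w' l - w l).
  by rewrite /wk -[k.+1%:R]natr1 [(_ + 1) / _]mulrDl mul1r RCD mulrDl addrA.
pose D x := two_pi_i * (dw * (lincomb p x l0 * lincomb q x l0)).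
have ES0 x : gauss (wk N k.+1) z0 z0 x = gauss (wk N k) z0 z0 x * cexp (RC N%:R^-1 * D x + RC (N%:R^-1 ^+ 2) * 0).
  rewrite /gauss -cexpD; congr cexp; rewrite /D mulr0 addr0 (mulrCA (RC _) two_pi_i) -mulrDr; congr (_ * _).
  rewrite (bigD1 l0) //= [X in _ = X + _](bigD1 l0) //= wS -/dw !addr0.
  rewrite (eq_bigr (fun l => wk N k l * ((lincomb p x l + 0) * (lincomb q x l + 0)))).
    ring.
  by move=> l ll; rewrite wS ww' // subrr mulr0 addr0.
have nx x : 1 <= 1 + norm1 x by rewrite lerDl norm1_ge0.
have n0 x : 0 <= 1 + norm1 x by rewrite (le_trans _ (nx x)).
have hlin v x l : (forall i, md (v i l) <= coef_bound) -> md (lincomb v x l) <= M * (1 + norm1 x).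
  move=> hv; apply: le_trans (lin_bnd x hv) _.
  by rewrite ler_pM ?norm1_ge0 // lerDr.
have hp x l : md (lincomb p x l) <= M * (1 + norm1 x) by apply: hlin => i; have [] := bbP i l.
have hq x l : md (lincomb q x l) <= M * (1 + norm1 x) by apply: hlin => i; have [] := bbP i l.
have hT x i j c : (i <= 6)%N -> (j <= 2)%N -> c <= 2 -> c * (M ^+ i * (1 + norm1 x) ^+ j) <= tau * (1 + norm1 x) ^+ 2.
  move=> hi hj c2'; rewrite /tau -mulrA; apply: (le_trans (y := 2 * (M ^+ i * (1 + norm1 x) ^+ j))).
    by rewrite ler_wpM2r // mulr_ge0 // exprn_ge0.
  by rewrite ler_wpM2l // pow_le.
have le1 : (1 : R) <= 2 by rewrite ler1n.
have Mn x : 0 <= M * (1 + norm1 x) by rewrite mulr_ge0.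
have hB i : md (kap * (p i l0 * qs i l0)) <= M ^+ 3.
  apply: (le_trans (y := M * (M * M))); last by rewrite le_eqVlt; apply/orP; left; apply/eqP; ring.
  by apply: mdM_le => //; apply: mdM_le; have [] := hbp i l0.
have hX i x : md (kap * (lincomb p x l0 * qs i l0)) <= tau * (1 + norm1 x) ^+ 2.
  apply: (le_trans (y := M * ((M * (1 + norm1 x)) * M))).
    by apply: mdM_le => //; apply: mdM_le => //; have [] := hbp i l0.
  apply: le_trans (hT x 3%N 1%N 1 _ _ _) => //.
  by rewrite le_eqVlt; apply/orP; left; apply/eqP; rewrite expr1; ring.
have ha i x : md (two_pi_i * \sum_l wk N k l * (p i l * (lincomb q x l + 0) + q i l * (lincomb p x l + 0))) <= tau * (1 + norm1 x) ^+ 2.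
  apply: (le_trans (y := M * (M * (M * (M * (M * (1 + norm1 x)) + M * (M * (1 + norm1 x))))))).
    apply: mdM_le => //; apply: sum_bndM => // [|l]; first by rewrite mulr_ge0 // addr_ge0 // mulr_ge0.
    by have [? ? _ _] := hbp i l; apply: mdM_le => //; apply: mdD_le; apply: mdM_le => //; rewrite addr0; [exact: hq|exact: hp].
  apply: le_trans (hT x 5%N 1%N 2 _ _ _) => //.
  by rewrite le_eqVlt; apply/orP; left; apply/eqP; rewrite expr1; ring.
have hal i x : md (two_pi_i * \sum_l wk N k l * (p i l * q i l)) <= tau * (1 + norm1 x) ^+ 2.
  apply: (le_trans (y := M * (M * (M * (M * M))))).
    apply: mdM_le => //; apply: sum_bndM => // [|l]; first by rewrite !mulr_ge0.
    by have [? ? _ _] := hbp i l; apply: mdM_le => //; apply: mdM_le.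
  apply: le_trans (hT x 5%N 0%N 1 _ _ _) => //.
  by rewrite le_eqVlt; apply/orP; left; apply/eqP; ring.
have hD x : md (D x) <= tau * (1 + norm1 x) ^+ 2.
  apply: (le_trans (y := M * (M * ((M * (1 + norm1 x)) * (M * (1 + norm1 x)))))).
    by apply: mdM_le => //; apply: mdM_le => //; apply: mdM_le.
  apply: le_trans (hT x 4%N 2%N 1 _ _ _) => //.
  by rewrite le_eqVlt; apply/orP; left; apply/eqP; ring.
have z00 (l : 'I_d) : md ((z0 : _ -> C) l) <= 0 by rewrite md0.
have hM x (A : C) T : 0 <= T -> T * md A <= K * wt x -> forall c, md c <= M -> T * md (c * A) <= M * K * wt x.
  move=> T0 hA c hc; rewrite mdM mulrCA -mulrA; apply: ler_pM => //; rewrite ?md_ge0 //.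
  by rewrite mulr_ge0 ?md_ge0.
have T30 x : 0 <= (tau * (1 + norm1 x) ^+ 2) ^+ 3 by rewrite exprn_ge0 // mulr_ge0 // sqr_ge0.
have [hK1 hK2] := hK _ _ _ hI hw z00 z00; have [hK3 _] := hK _ _ _ hI' hw' z00 z00.
apply: (@grid_mean_step R g (E N k) (E N k.+1) kap 0 D
  (fun i x => kap * (lincomb p x l0 * qs i l0))
  (fun i x => two_pi_i * \sum_l wk N k l * (p i l * (lincomb q x l + 0) + q i l * (lincomb p x l + 0)))
  (fun i => kap * (p i l0 * qs i l0)) (fun i => two_pi_i * \sum_l wk N k l * (p i l * q i l))
  (fun x => tau * (1 + norm1 x) ^+ 2) (M * K) N N0).
- move=> x; rewrite /E ES0 wS.
  have fld (a e b y z : C) : a != 0 -> (a + e * b) * (y * z) = (1 + e * (b / a)) * (a * y * z).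
    by move=> a0; field.
  exact: fld.
- by move=> i x; rewrite /E gauss_shift mulrA.
- by move=> i x; rewrite lin_shift; ring.
- move=> x; rewrite big_split /= -mulr_sumr Hpq eqxx mulr1; congr (_ + _).
  have e1 v : \sum_i (kap * (lincomb p x l0 * qs i l0)) * v i =
     kap * (lincomb p x l0 * \sum_i v i * qs i l0).
    by rewrite !mulr_sumr; apply: eq_bigr => i _; ring.
  rewrite e1 (_ : \sum_i _ = two_pi_i * (wk N k l0 * lincomb q x l0)).
    have fld (a b P Q T : C) : a != 0 -> T * (b * (P * Q)) = b / a * (P * (T * (a * Q))).
      by move=> a0; field.
    exact: fld.
  under eq_bigr => i _ do rewrite -mulrA mulr_suml.
  rewrite -mulr_sumr exchange_big /=; congr (_ * _).
  rewrite (bigD1 l0) //= [X in _ + X]big1 => [|l /negbTE ll].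
    rewrite addr0 (eq_bigr (fun i => wk N k l0 * (lincomb q x l0 * (p i l0 * qs i l0)) + wk N k l0 * (lincomb p x l0 * (q i l0 * qs i l0)))).
      by rewrite big_split /= -!mulr_sumr Hpq Hqq eqxx mulr1n mulr1 !mulr0 addr0.
    by move=> i _; ring.
  rewrite (eq_bigr (fun i => wk N k l * (lincomb q x l * (p i l * qs i l0)) + wk N k l * (lincomb p x l * (q i l * qs i l0)))).
    by rewrite big_split /= -!mulr_sumr Hpq Hqq ll mulr0n !mulr0 addr0.
  by move=> i _; ring.
- move=> x; apply: le_trans (hT x 0%N 0%N 1 _ _ _) => //; by rewrite !expr0 !mulr1.
- move=> x; apply: le_trans hkap _; apply: le_trans (hT x 1%N 0%N 1 _ _ _) => //.
  by rewrite expr1 expr0 mulr1 mul1r.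
- by move=> x; rewrite md0 mulr_ge0 // sqr_ge0.
- exact: hD.
- exact: hX.
- exact: ha.
- move=> i x; apply: le_trans (hB i) _; apply: le_trans (hT x 3%N 0%N 1 _ _ _) => //.
  by rewrite expr0 mulr1 mul1r.
- exact: hal.
- by move=> x; apply: hM.
- by move=> x; rewrite /E -mulrA -ES0; apply: hM.
- by move=> i x; rewrite /E; apply: hM => //; apply: hK2.
Qed.

(** Changes the coordinates of w one at a time. *)
Lemma grid_mean_scale w w' : (forall l, 0 < complex.Im (w l)) -> (forall l, 0 < complex.Im (w' l)) ->
  exists2 c : R, 0 <= c & forall N, (0 < N)%N ->
    md ((\prod_l w' l) * grid_mean N (gauss w' z0 z0) - (\prod_l w l) * grid_mean N (gauss w z0 z0)) <= c / N%:R.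
Proof.
move=> w0 w0'; pose wj j (l : 'I_d) := if (l < j)%N then w' l else w l.
have wj0 j l : 0 < complex.Im (wj j l) by rewrite /wj; case: ifP.
suff H j : (j <= d)%N -> exists2 c : R, 0 <= c & forall N, (0 < N)%N ->
    md ((\prod_l wj j l) * grid_mean N (gauss (wj j) z0 z0) - (\prod_l w l) * grid_mean N (gauss w z0 z0)) <= c / N%:R.
  have := H d (leqnn d); suff -> : wj d = w' by [].
  by apply/funext => l; rewrite /wj ltn_ord.
elim: j => [|j IH] jd.
  exists 0 => // N N0; have -> : wj 0%N = w by apply/funext.
  by rewrite subrr md0 mul0r.
have [c c0 hc] := IH (ltnW jd); pose l0 : 'I_d := Ordinal jd.
have [|c' c0' hc'] := @grid_mean_scale1 l0 (wj j) (wj j.+1) (wj0 j) (wj0 j.+1).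
  move=> l ll; rewrite /wj ltnS leq_eqVlt; case: eqP => //= lj; case/eqP: ll; exact: val_inj.
pose Q := \prod_(l | l != l0) w l; pose B := \prod_(l | l != l0) wj j l.
exists (md B * c' + c) => [|N N0]; first by rewrite addr_ge0 ?mulr_ge0 ?md_ge0.
have -> : \prod_l wj j.+1 l = wj j.+1 l0 * B.
  rewrite (bigD1 l0) //=; congr (_ * _); apply: eq_bigr => l ll.
  rewrite /wj ltnS leq_eqVlt; case: eqP => //= lj; case/eqP: ll; exact: val_inj.
rewrite mulrDl.
have h1 := hc' N N0; have h2 := hc N N0.
rewrite (bigD1 l0) //= -/B in h2.
set m1 := grid_mean N _ in h1 *; set m2 := grid_mean N (gauss (wj j) _ _) in h1 h2; set y := _ * grid_mean N _ in h2 *.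
have -> : wj j.+1 l0 * B * m1 - y = B * (wj j.+1 l0 * m1 - wj j l0 * m2) + (wj j l0 * B * m2 - y) by ring.
by apply: mdD_le => //; rewrite -mulrA; apply: mdM_le.
Qed.
End Gauss.

(** * The Fejer kernel *)

Section Fejer.
Variable R : realType.
Local Notation C := (Cplx R).

(** The Fejer kernel, normalised to have mean 1 over any grid with at least M
points per period. *)
Definition fejer1 (M : nat) (t : R) : R := md (\sum_(r < M) ee (r%:R * t) : C) ^+ 2 / M%:R.

Lemma fejer1_ge0 M t : 0 <= fejer1 M t.
Proof. by rewrite divr_ge0 ?sqr_ge0. Qed.

Lemma ee_conj t : (ee t : C)^* = ee (- t).
Proof.
apply: (mulfI (ee_neq0 t)); rewrite mulconj md_ee expr1n RC1 -eeD subrr ee0 //.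
Qed.

Lemma fejer1E M t : RC (fejer1 M t) = (M%:R)^-1 * \sum_(c : 'I_M * 'I_M) (ee ((c.1%:R - c.2%:R) * t) : C).
Proof.
rewrite /fejer1 RCM RCV RCn -mulconj mulrC; congr (_ * _).
have -> : (\sum_(r < M) ee (r%:R * t) : C)^* = \sum_(r < M) ee (- (r%:R * t)).
  by rewrite rmorph_sum; apply: eq_bigr => r _; exact: ee_conj.
rewrite mulr_suml; under eq_bigr => r _ do rewrite mulr_sumr.
rewrite pair_bigA /=; apply: eq_bigr => c _.
by rewrite -eeD; congr ee; ring.
Qed.

Lemma fejer1Z M t (m : int) : fejer1 M (t + m%:~R) = fejer1 M t.
Proof.
rewrite /fejer1; congr (md _ ^+ 2 / _); apply: eq_bigr => r _.
have -> : r%:R * (t + m%:~R) = r%:R * t + ((r : nat)%:Z * m)%:~R :> R.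
  by rewrite intrM mulrDr.
exact: eeDZ.
Qed.

(** The kernel is small where ee t is far from 1. *)
Lemma fejer1_conc M t : (0 < M)%N -> fejer1 M t * md (ee t - 1 : C) ^+ 2 <= 4 / M%:R.
Proof.
move=> M0; rewrite /fejer1 mulrAC ler_pM2r ?invr_gt0 ?ltr0n // -exprMn -mdM.
have -> : (\sum_(r < M) ee (r%:R * t)) * (ee t - 1) = ee (M%:R * t) - 1 :> C.
  rewrite mulrC eeMn subrX1; congr (_ * _); apply: eq_bigr => r _; exact: eeMn.
have h : md (ee (M%:R * t) - 1 : C) <= 2 by rewrite (le_trans (mdB _ _)) // md_ee md1.
have := md_ge0 (ee (M%:R * t) - 1 : C); nra.
Qed.

(** The points j/N with |j| <= P, N = 2 P + 1: a symmetric system of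
representatives of (1/N) Z modulo Z. This is why N is taken odd. *)
Definition uj (P : nat) (j : nat) : R := (j%:R - P%:R) / (2 * P + 1)%N%:R.

(** Orthogonality of the characters of Z/N. *)
Lemma fejer1_sum M P : (0 < M)%N -> (M <= 2 * P + 1)%N ->
  \sum_(j < 2 * P + 1) fejer1 M (uj P j) = (2 * P + 1)%N%:R.
Proof.
move=> M0 MN; set N := (2 * P + 1)%N; have N0 : (0 < N)%N by rewrite /N addn1.
have NR : N%:R != 0 :> R by rewrite pnatr_eq0 -lt0n.
apply: (@complexI R); rewrite -[LHS]/(RC _) -[RHS]/(RC _) RC_sum RCn.
under eq_bigr => j _ do rewrite fejer1E.
rewrite -mulr_sumr exchange_big /=.
have inner (c : 'I_M * 'I_M) : \sum_(j < N) (ee ((c.1%:R - c.2%:R) * uj P j) : C) = (c.1 == c.2)%:R * N%:R.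
  have [->|ne] := eqVneq c.1 c.2.
    by under eq_bigr => j _ do rewrite subrr mul0r ee0; rewrite sumr_const card_ord mul1r.
  rewrite mul0r; set de : R := c.1%:R - c.2%:R.
  have dn : (ee (de / N%:R) : C) != 1.
    wlog lt : c ne @de / (c.2 < c.1)%N.
      move=> H; have [lt|le] := ltnP c.2 c.1; first exact: H.
      have lt : (c.1 < c.2)%N by rewrite ltn_neqAle le andbT.
      have := H (c.2, c.1); rewrite /= eq_sym => /(_ ne lt).
      have -> : (c.2%:R - c.1%:R) / N%:R = - (de / N%:R) :> R by rewrite /de -mulNr opprB.
      by rewrite eeN invr_eq1.
    apply: ee_neq1; rewrite /de -natrB ?(ltnW lt) // divr_gt0 ?ltr0n ?subn_gt0 //=.
    rewrite ltr_pdivrMr ?ltr0n // mul1r ltr_nat (leq_ltn_trans (leq_subr _ _)) //.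
    exact: leq_trans (ltn_ord _) MN.
  have e j : ee (de * uj P j) = ee (- (de * P%:R / N%:R)) * ee (de / N%:R) ^+ j :> C.
    by rewrite -eeMn -eeD; congr ee; rewrite /uj -/N; field.
  under eq_bigr => j _ do rewrite e.
  rewrite -mulr_sumr.
  have : (ee (de / N%:R) - 1) * (\sum_(j < N) ee (de / N%:R) ^+ j) = 0 :> C.
    rewrite -subrX1 -eeMn mulrC divfK // /de.
    have -> : c.1%:R - c.2%:R = ((c.1%:Z - c.2%:Z)%:~R : R) by rewrite rmorphB.
    by rewrite eeZ subrr.
  by move/eqP; rewrite mulf_eq0 subr_eq0 (negbTE dn) /= => /eqP ->; rewrite mulr0.
under eq_bigr => c _ do rewrite inner.
rewrite -mulr_suml -(pair_bigA _ (fun r r' : 'I_M => (r == r')%:R)) /=.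
have -> : \sum_(r < M) \sum_(r' < M) (r == r')%:R = M%:R :> C.
  under eq_bigr => r _.
    rewrite (bigD1 r) //= eqxx big1 ?addr0; last by move=> i /negbTE h; rewrite eq_sym h.
    over.
  by rewrite sumr_const card_ord.
by rewrite mulrA mulVf ?mul1r // pnatr_eq0 -lt0n.
Qed.

Lemma uj_half P (j : 'I_(2 * P + 1)) : `|uj P j| <= 2^-1.
Proof.
have NR : 0 < (2 * P + 1)%N%:R :> R by rewrite ltr0n addn1.
rewrite /uj normrM normfV (gtr0_norm NR) ler_pdivrMr //.
have h : (j%:R : R) <= 2 * P%:R.
  by rewrite -natrM ler_nat; have := ltn_ord j; lia.
have j0 : 0 <= j%:R :> R by [].
rewrite ler_norml natrD natrM; apply/andP; split; lra.
Qed.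

(** The second moment of the kernel is O(1/M). *)
Lemma fejer1_mom M P : (0 < M)%N -> (M <= 2 * P + 1)%N ->
  \sum_(j < 2 * P + 1) fejer1 M (uj P j) * uj P j ^+ 2 <= (2 * P + 1)%N%:R * (4 / M%:R).
Proof.
move=> M0 MN; have -> : (2 * P + 1)%N%:R * (4 / M%:R) = \sum_(j < 2 * P + 1) (4 / M%:R : R).
  by rewrite sumr_const card_ord -[RHS]mulr_natl.
apply: ler_sum => j _; apply: le_trans (fejer1_conc (uj P j) M0).
by rewrite ler_wpM2l ?fejer1_ge0 // ee_lb // uj_half.
Qed.

Variable g : nat.
Local Notation pts := ('I_g -> R).
Local Notation lat := {ffun 'I_g -> int}.

Definition fejer M (x : pts) : R := \prod_i fejer1 M (x i).

Definition mf M (f : {ffun 'I_g -> 'I_M * 'I_M}) : lat := [ffun i => (f i).1%:Z - (f i).2%:Z].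
Definition expchar (m : lat) (x : pts) : C := ee (\sum_i (m i)%:~R * x i).

Lemma fejerE M x : RC (fejer M x) = (M%:R ^+ g)^-1 * \sum_(f : {ffun 'I_g -> 'I_M * 'I_M}) expchar (mf f) x.
Proof.
have -> : RC (fejer M x) = \prod_i RC (fejer1 M (x i)).
  by rewrite /fejer; elim/big_rec2: _ => [//|i y z _ h]; rewrite RCM h.
under eq_bigr => i _ do rewrite fejer1E.
rewrite big_split /= prodr_const card_ord exprVn; congr (_ * _).
rewrite bigA_distr_bigA /=; apply: eq_bigr => f _.
rewrite /expchar ee_sum; apply: eq_bigr => i _; congr ee; rewrite ffunE rmorphB //.
Qed.

Lemma fejer_ge0 M x : 0 <= fejer M x.
Proof. by apply: prodr_ge0 => i _; exact: fejer1_ge0. Qed.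

Definition ujs P (j : {ffun 'I_g -> 'I_(2 * P + 1)}) : pts := fun i => uj P (j i).

Lemma fejer_sum M P : (0 < M)%N -> (M <= 2 * P + 1)%N ->
  \sum_(j : {ffun 'I_g -> 'I_(2 * P + 1)}) fejer M (ujs j) = (2 * P + 1)%N%:R ^+ g.
Proof.
move=> M0 MN; rewrite -(bigA_distr_bigA (fun (_ : 'I_g) (j : 'I_(2 * P + 1)) => fejer1 M (uj P j))) /=.
under eq_bigr => i _ do rewrite fejer1_sum //.
by rewrite prodr_const card_ord.
Qed.

Lemma fejer_mom M P i : (0 < M)%N -> (M <= 2 * P + 1)%N ->
  \sum_(j : {ffun 'I_g -> 'I_(2 * P + 1)}) fejer M (ujs j) * ujs j i ^+ 2
     <= (2 * P + 1)%N%:R ^+ g * (4 / M%:R).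
Proof.
move=> M0 MN; pose F (k : 'I_g) (j : 'I_(2 * P + 1)) := fejer1 M (uj P j) * (if k == i then uj P j ^+ 2 else 1).
have -> : \sum_(j : {ffun 'I_g -> 'I_(2 * P + 1)}) fejer M (ujs j) * ujs j i ^+ 2 =
   \sum_(j : {ffun 'I_g -> 'I_(2 * P + 1)}) \prod_k F k (j k).
  apply: eq_bigr => j _; rewrite /F big_split /= /fejer; congr (_ * _).
  by rewrite -big_mkcond big_pred1_eq.
rewrite -(bigA_distr_bigA F) /= (bigD1 i) //= mulrC.
have -> : \prod_(k | k != i) \sum_j F k j = (2 * P + 1)%N%:R ^+ g.-1.
  under eq_bigr => k /negbTE ki.
    rewrite /F ki; under eq_bigr => j _ do rewrite mulr1; rewrite fejer1_sum //; over.
  by rewrite prodr_const; congr (_ ^+ _); rewrite cardC1 card_ord.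
have -> : (2 * P + 1)%N%:R ^+ g = (2 * P + 1)%N%:R ^+ g.-1 * (2 * P + 1)%N%:R :> R.
  by rewrite -exprSr prednK // (leq_ltn_trans _ (ltn_ord i)).
rewrite -mulrA ler_wpM2l ?exprn_ge0 // /F eqxx; exact: fejer1_mom.
Qed.

(** The first moment is O(1/r): |u| <= 1/r + r u^2, and M = 4 r^2 balances the
two terms. *)
Lemma fejer_nn M P r : (0 < r)%N -> M = (4 * r ^ 2)%N -> (M <= 2 * P + 1)%N ->
  \sum_(j : {ffun 'I_g -> 'I_(2 * P + 1)}) fejer M (ujs j) * norm1 (ujs j)
     <= (2 * P + 1)%N%:R ^+ g * (2 * g%:R / r%:R).
Proof.
move=> r0 ME MN; have rR : 0 < r%:R :> R by rewrite ltr0n.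
have M0 : (0 < M)%N by rewrite ME muln_gt0 /= expn_gt0 r0.
have le_u (u : R) : `|u| <= r%:R^-1 + u ^+ 2 * r%:R.
  have : 0 <= (`|u| * r%:R - 1) ^+ 2 by apply: sqr_ge0.
  rewrite -(sqr_normr u); have a0 := normr_ge0 u; move: (`|u|) a0 => a a0 h.
  rewrite -(ler_pM2r rR) mulrDl mulVf ?gt_eqF //; nra.
apply: (le_trans (y := \sum_(j : {ffun 'I_g -> 'I_(2 * P + 1)}) (g%:R / r%:R * fejer M (ujs j) +
    \sum_i r%:R * (fejer M (ujs j) * ujs j i ^+ 2)))).
  apply: ler_sum => j _; rewrite /norm1 mulr_sumr.
  have -> : g%:R / r%:R * fejer M (ujs j) = \sum_(i < g) fejer M (ujs j) / r%:R.
    by rewrite sumr_const card_ord -[RHS]mulr_natl; ring.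
  rewrite -big_split /=; apply: ler_sum => i _.
  apply: (le_trans (ler_wpM2l (fejer_ge0 M (ujs j)) (le_u (ujs j i)))).
  by rewrite le_eqVlt; apply/orP; left; apply/eqP; ring.
rewrite big_split /= -mulr_sumr fejer_sum // exchange_big /=.
have h : \sum_(i < g) \sum_(j : {ffun 'I_g -> 'I_(2 * P + 1)}) r%:R * (fejer M (ujs j) * ujs j i ^+ 2) <=
   g%:R * ((2 * P + 1)%N%:R ^+ g * r%:R^-1).
  apply: (le_trans (y := \sum_(i < g) ((2 * P + 1)%N%:R ^+ g * r%:R^-1))); last first.
    by rewrite sumr_const card_ord mulr_natl.
  apply: ler_sum => i _; rewrite -mulr_sumr.
  apply: (le_trans (ler_wpM2l (ltW rR) (fejer_mom i M0 MN))).
  rewrite ME natrM natrX le_eqVlt; apply/orP; left; apply/eqP; field.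
  by rewrite gt_eqF.
apply: (le_trans (lerD (lexx _) h)).
rewrite le_eqVlt; apply/orP; left; apply/eqP; ring.
Qed.
End Fejer.

(** * Poisson summation up to a constant *)

Section Poisson.
Variable R : realType.
Local Notation C := (Cplx R).
Variables (g d : nat) (p q ps qs : 'I_g -> 'I_d -> C).
Hypothesis Hq : forall i l, q i l = (p i l)^*.
Hypothesis Hqs : forall i l, qs i l = (ps i l)^*.
Hypothesis H1 : forall i j, \sum_l (p i l * qs j l + q i l * ps j l) = (i == j)%:R.
Hypothesis Hpq : forall l l', \sum_i p i l * qs i l' = (l == l')%:R.
Hypothesis Hqp : forall l l', \sum_i q i l * ps i l' = (l == l')%:R.
Hypothesis Hpp : forall l l', \sum_i p i l * ps i l' = 0.
Hypothesis Hqq : forall l l', \sum_i q i l * qs i l' = 0.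
Local Notation pts := ('I_g -> R).
Local Notation lat := {ffun 'I_g -> int}.
Local Notation z0 := (fun _ : 'I_d => 0 : C).
Local Notation E w := (gauss p q w z0 z0).
Local Notation Ed w := (gauss ps qs w z0 z0).
Local Notation pt1 := (@gridpt R g 1).

Lemma H1d i j : \sum_l (ps i l * q j l + qs i l * p j l) = (i == j)%:R.
Proof. by rewrite eq_sym -H1; apply: eq_bigr => l _; ring. Qed.

(** Completing the square: a character times a Gaussian is a shifted Gaussian
times a value of the dual Gaussian. *)
Lemma expchar_sq w m x : (forall l, w l != 0) ->
  E w x * expchar m x = Ed (fun l => - (w l)^-1) (pt1 m) *
   gauss p q w (fun l => lincomb ps (pt1 m) l / w l) (fun l => lincomb qs (pt1 m) l / w l) x.
Proof.
move=> w0; rewrite /expchar /gauss /ee -!cexpD; congr cexp.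
have -> : (Complex 0 (2 * pi * \sum_i (m i)%:~R * x i) : C) = two_pi_i R * RC (\sum_i (m i)%:~R * x i).
  by apply/eqP; rewrite eq_complex /two_pi_i /= !mul0r mulr0 subr0 add0r !eqxx.
have -> : RC (\sum_i (m i)%:~R * x i) = \sum_l (lincomb p x l * lincomb qs (pt1 m) l + lincomb q x l * lincomb ps (pt1 m) l).
  rewrite RC_sum.
  have h i : RC ((m i)%:~R * x i) = \sum_l (RC (pt1 m i) * (lincomb p x l * qs i l + lincomb q x l * ps i l)).
    by rewrite -mulr_sumr -(coordE H1) RCM /gridpt divr1.
  under eq_bigr => i _ do rewrite h.
  rewrite exchange_big /=; apply: eq_bigr => l _.
  rewrite /lincomb -/(lincomb p x l) -/(lincomb q x l) !mulr_sumr -big_split /=.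
  by apply: eq_bigr => i _; ring.
rewrite -!mulrDr; congr (_ * _); rewrite -!big_split /=; apply: eq_bigr => l _.
by field; exact: w0.
Qed.

(** The Fourier coefficient of a Gaussian, up to its mean. *)
Lemma grid_mean_expchar w m : (forall l, 0 < complex.Im (w l)) ->
  exists2 c : R, 0 <= c & forall N, (0 < N)%N ->
   md (grid_mean N (fun x => E w x * expchar m x) - Ed (fun l => - (w l)^-1) (pt1 m) * grid_mean N (E w)) <= c / N%:R.
Proof.
move=> w0; have wn l : w l != 0 by apply/eqP => h; have := w0 l; rewrite h ltxx.
set s := fun l => lincomb ps (pt1 m) l / w l; set t := fun l => lincomb qs (pt1 m) l / w l.
have [c c0 hc] := grid_mean_shifted Hq H1 Hpq Hqp Hpp Hqq s t w0.
set G := Ed _ _; exists (md G * c) => [|N N0]; first by rewrite mulr_ge0 ?md_ge0.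
have [c1 c10 hc1] := exists_lb w0; have [W W0 hW] := exists_ub w.
have [S1 S10 hS1] := exists_ub s; have [S2 S20 hS2] := exists_ub t.
have [K K0 hK] := gauss_dom1 Hq H1 W (S1 + S2) c10.
have dE : dominated K (gauss p q w s t).
  apply: hK => // l; [apply: le_trans (hS1 l) _|apply: le_trans (hS2 l) _].
    by rewrite lerDl.
  by rewrite lerDr.
have -> : (fun x => E w x * expchar m x) = (fun x => G * gauss p q w s t x).
  by apply/funext => x; exact: expchar_sq.
by rewrite (grid_meanZ _ N0 dE) -mulrBr -mulrA; apply: mdM_le => //; exact: hc.
Qed.

Lemma expchar_dom w m K : dominated K (E w) -> dominated K (fun x => E w x * expchar m x).
Proof. by move=> h x; rewrite mdM [X in _ * X]md_ee mulr1; exact: h. Qed.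

Lemma im_inv (z : C) : 0 < complex.Im z -> 0 < complex.Im (- z^-1).
Proof.
case: z => a b /= b0; rewrite opprK divr_gt0 //.
by rewrite ltr_wpDl ?sqr_ge0 // exprn_gt0.
Qed.

(** Cesaro mean of order M of the dual theta series. *)
Definition Gbar w (M : nat) : C :=
  (M%:R ^+ g)^-1 * \sum_(f : {ffun 'I_g -> 'I_M * 'I_M}) Ed (fun l => - (w l)^-1) (pt1 (mf f)).

Lemma grid_mean_fejer w M : (forall l, 0 < complex.Im (w l)) ->
  exists2 c : R, 0 <= c & forall N, (0 < N)%N ->
   md (grid_mean N (fun x => E w x * RC (fejer M x)) - Gbar w M * grid_mean N (E w)) <= c / N%:R.
Proof.
move=> w0.
have [c1 c10 hc1] := exists_lb w0; have [W W0 hW] := exists_ub w.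
have [K K0 hK] := gauss_dom1 Hq H1 W 0 c10.
have dE : dominated K (E w) by apply: hK => // l; rewrite md0.
have /choice[cf hcf] : forall f : {ffun 'I_g -> 'I_M * 'I_M}, exists c : R, 0 <= c /\ forall N, (0 < N)%N ->
   md (grid_mean N (fun x => E w x * expchar (mf f) x) - Ed (fun l => - (w l)^-1) (pt1 (mf f)) * grid_mean N (E w)) <= c / N%:R.
  by move=> f; have [c c0 hc] := grid_mean_expchar (mf f) w0; exists c.
exists (md ((M%:R ^+ g)^-1 : C) * \sum_f cf f) => [|N N0].
  by rewrite mulr_ge0 ?md_ge0 // sumr_ge0 // => f _; have [] := hcf f.
have -> : grid_mean N (fun x => E w x * RC (fejer M x)) =
   (M%:R ^+ g)^-1 * \sum_(f : {ffun 'I_g -> 'I_M * 'I_M}) grid_mean N (fun x => E w x * expchar (mf f) x).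
  have -> : (fun x => E w x * RC (fejer M x)) =
     (fun x => (M%:R ^+ g)^-1 * \sum_(f : {ffun 'I_g -> 'I_M * 'I_M}) E w x * expchar (mf f) x).
    by apply/funext => x; rewrite fejerE mulrCA mulr_sumr.
  rewrite -(@grid_mean_sum _ _ _ _ _ K (fun (f : {ffun 'I_g -> 'I_M * 'I_M}) x => E w x * expchar (mf f) x) _ N0); last first.
    by move=> f _; apply: expchar_dom.
  have dS : dominated (#|{: {ffun 'I_g -> 'I_M * 'I_M}}|%:R * K) (fun x => \sum_(f : {ffun 'I_g -> 'I_M * 'I_M}) E w x * expchar (mf f) x).
    move=> x; apply: (le_trans (md_sum _ _ _)).
    apply: (le_trans (y := \sum_(f : {ffun 'I_g -> 'I_M * 'I_M}) (K * wt x))).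
      by apply: ler_sum => f _; apply: (expchar_dom (mf f) dE).
    by rewrite sumr_const -mulrA mulr_natl.
  exact: (grid_meanZ _ N0 dS).
rewrite /Gbar; set A := _^-1.
rewrite -(mulrA A) -mulrBr -[X in _ <= X]mulrA; apply: mdM_le => //.
rewrite mulr_suml -sumrB; apply: (le_trans (md_sum _ _ _)).
rewrite mulr_suml; apply: ler_sum => f _; have [_] := hcf f; exact.
Qed.

(** The number of ways to write an integer as a difference of two elements of
{0, ..., M - 1}: M times the coefficient of the Fejer kernel. *)
Definition cnt (M : nat) (a : int) : R := \sum_(c : 'I_M * 'I_M) (a == c.1%:Z - c.2%:Z)%:R.

Lemma cnt_ub M a : cnt M a <= M%:R.
Proof.
rewrite /cnt -(pair_bigA _ (fun r r' : 'I_M => (a == r%:Z - r'%:Z)%:R)) /=.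
have -> : M%:R = \sum_(r < M) (1 : R) by rewrite sumr_const card_ord.
apply: ler_sum => r _.
have [/existsP[r0 /eqP h0]|h] := boolP [exists r' : 'I_M, a == r%:Z - r'%:Z].
  rewrite (bigD1 r0) //= big1 ?addr0; first by case: (_ == _).
  move=> r' ne; case: eqP => // h; case/eqP: ne; apply: val_inj => /=; lia.
rewrite big1 // => r' _; case: eqP => // h'; case/negP: h; apply/existsP; exists r'; exact/eqP.
Qed.

Lemma cnt_lb M a : M%:R - `|a|%:~R <= cnt M a.
Proof.
have key n : M%:R - n%:R <= \sum_(r' < M) \sum_(r < M) (r == (r' + n)%N :> nat)%:R :> R.
  apply: (le_trans (y := (M - n)%N%:R)).
    have [h|h] := leqP n M; first by rewrite natrB.
    by rewrite (le_trans _ (ler0n _ _)) // subr_le0 ler_nat ltnW.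
  have -> : (M - n)%N%:R = \sum_(r' < M) (r' < M - n)%N%:R :> R.
    rewrite -{1}(card_ord (M - n)) -sumr_const.
    rewrite (big_ord_widen M (fun=> 1)) ?leq_subr //.
    by rewrite big_mkcond /=; apply: eq_bigr => r' _; case: ifP.
  apply: ler_sum => r' _; case: ltnP => h; last by rewrite sumr_ge0.
  have hr : (r' + n < M)%N by lia.
  by rewrite (bigD1 (Ordinal hr)) //= eqxx lerDl sumr_ge0.
rewrite /cnt -(pair_bigA _ (fun r r' : 'I_M => (a == r%:Z - r'%:Z)%:R)) /=.
case: a => n.
  rewrite exchange_big /=; apply: (le_trans (key n)).
  apply: ler_sum => r' _; apply: ler_sum => r _; rewrite ler_nat.
  case: eqP => // h; suff -> : Posz n == r%:Z - r'%:Z by []. 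
  by apply/eqP; rewrite h; lia.
have -> : (`|Negz n|%:~R : R) = n.+1%:R by [].
apply: (le_trans (key n.+1)).
apply: ler_sum => r' _; apply: ler_sum => r _; rewrite ler_nat.
case: eqP => // h; suff -> : Negz n == r'%:Z - r%:Z by [].
by apply/eqP; rewrite h; lia.
Qed.

Definition fejer_coef (M : nat) (m : lat) : R := \prod_i (cnt M (m i) / M%:R).

Lemma prod_sub1 (I : Type) (r : seq I) (k : I -> R) : (forall i, 0 <= k i <= 1) ->
  0 <= 1 - \prod_(i <- r) k i <= \sum_(i <- r) (1 - k i) /\ 0 <= \prod_(i <- r) k i.
Proof.
move=> h; elim: r => [|i r [/andP[h1 h2] h3]]; first by rewrite !big_nil subrr lexx ler01.
have /andP[k0 k1] := h i; rewrite !big_cons; move: h1 h2 h3.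
set A := \prod_(_ <- r) _; set B := \sum_(_ <- r) _ => h1 h2 h3.
split; last nra.
by apply/andP; split; nra.
Qed.

Lemma kap_bnd M m : (0 < M)%N -> 0 <= 1 - fejer_coef M m <= norm1 (pt1 m) / M%:R.
Proof.
move=> M0; have MR : 0 < M%:R :> R by rewrite ltr0n.
have hk i : 0 <= cnt M (m i) / M%:R <= 1.
  by rewrite ler_pdivrMr // mul1r cnt_ub andbT divr_ge0 // sumr_ge0.
have [/andP[-> /= h] _] := prod_sub1 (index_enum _) hk; apply: (le_trans h).
rewrite /norm1 mulr_suml; apply: ler_sum => i _.
rewrite ler_pdivlMr // mulrBl mul1r divfK ?gt_eqF // /gridpt divr1 -intr_norm.
have := cnt_lb M (m i); lra.
Qed.

Lemma sum_single (I : choiceType) (f : I -> C) a :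
  hasSum (fun m => (m == a)%:R * f m) (f a).
Proof.
move=> e e0; exists [fset a]%fset => B; rewrite fsub1set => aB.
rewrite (big_fsetD1 a) //= eqxx mul1r big_seq big1 ?addr0 ?subrr ?md0 //.
by move=> m; rewrite !inE => /andP[/negbTE -> _]; rewrite mul0r.
Qed.

Lemma Gbar_sum w M : (0 < M)%N ->
  hasSum (fun m : lat => RC (fejer_coef M m) * Ed (fun l => - (w l)^-1) (pt1 m)) (Gbar w M).
Proof.
move=> M0; pose G m := Ed (fun l => - (w l)^-1) (pt1 m).
have h := hasSumZ ((M%:R ^+ g)^-1) (hasSum_big (P := xpredT) (index_enum _) (fun (f : {ffun 'I_g -> 'I_M * 'I_M}) _ => sum_single G (mf f))).
rewrite /Gbar; apply: (hasSum_ext _ h) => m; rewrite -mulr_suml mulrA; congr (_ * _).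
have -> : \sum_(f : {ffun 'I_g -> 'I_M * 'I_M}) (m == mf f)%:R =
   \sum_(f : {ffun 'I_g -> 'I_M * 'I_M}) \prod_i (m i == (f i).1%:Z - (f i).2%:Z)%:R :> C.
  apply: eq_bigr => f _; have [->|ne] := eqVneq m (mf f).
    by rewrite big1 // => i _; rewrite ffunE eqxx.
  have [i hi] : exists i, m i != mf f i.
    apply/existsP; rewrite -negb_forall; apply: contra ne => /forallP hh.
    by apply/eqP/ffunP => i; apply/eqP.
  by rewrite (bigD1 i) //=; move: hi; rewrite ffunE => /negbTE ->; rewrite mul0r.
rewrite -(bigA_distr_bigA (fun (i : 'I_g) (c : 'I_M * 'I_M) => (m i == c.1%:Z - c.2%:Z)%:R)) /=.
have -> : RC (fejer_coef M m) = \prod_i RC (cnt M (m i) / M%:R).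
  by rewrite /fejer_coef; elim/big_rec2: _ => [//|i y z _ e]; rewrite RCM e.
have -> : (M%:R ^+ g)^-1 = \prod_(i < g) (M%:R)^-1 :> C by rewrite prodr_const card_ord exprVn.
rewrite -big_split /=; apply: eq_bigr => i _.
rewrite RCM RCV RCn mulrC /cnt RC_sum; congr (_ * _); apply: eq_bigr => c _.
by rewrite RCn.
Qed.

Definition theta_dual z : C := summability.sum ((fun m : lat => Ed z (pt1 m)) : lat -> C).
Definition theta_lat z : C := summability.sum ((fun m : lat => E z (pt1 m)) : lat -> C).

(** Cesaro means of an absolutely convergent series converge to its sum. *)
Lemma Gbar_lim w : (forall l, 0 < complex.Im (w l)) -> exists2 c : R, 0 <= c &
  forall M, (0 < M)%N -> md (theta_dual (fun l => - (w l)^-1) - Gbar w M) <= c / M%:R.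
Proof.
move=> w0; set z := fun l => - (w l)^-1.
have zp l : 0 < complex.Im (z l) by apply: im_inv.
have [c0 c00 hc] := exists_lb zp; have [W W0 hW] := exists_ub z.
have [K K0 hK] := gauss_dom Hqs H1d W 0 c00 ler01.
have z00 (l : 'I_d) : md ((z0 : _ -> C) l) <= 0 by rewrite md0.
have {}hK := hK z z0 z0 hc hW z00 z00.
have n1 (x : pts) : 1 <= 1 + norm1 x by rewrite lerDl norm1_ge0.
have h1 x : md (Ed z x) <= K * wt x.
  apply: le_trans (hK x); rewrite mul1r ler_peMl ?md_ge0 //.
  by rewrite !exprn_ege1.
have h2 x : norm1 x * md (Ed z x) <= K * wt x.
  apply: le_trans (hK x); rewrite mul1r ler_wpM2r ?md_ge0 //.
  have a := n1 x; have b : 1 + norm1 x <= ((1 + norm1 x) ^+ 2) ^+ 3.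
    by rewrite -exprM -{1}(expr1 (1 + norm1 x)) ler_weXn2l.
  by apply: le_trans b; rewrite lerDr.
exists (K * (4 * 1) ^+ g) => [|M M0]; first by rewrite mulr_ge0 ?exprn_ge0 // ?mulr1 // ltW.
have MR : 0 < M%:R :> R by rewrite ltr0n.
have hs := hasSumD (asum_has (dominated_asum (ltnSn 0) h1)) (hasSumZ (-1) (Gbar_sum w M0)).
rewrite mulN1r in hs; apply: (hasSum_md hs).
have hb := bsumZ (_ : 0 <= (M%:R^-1 : R)) (bsumZ (ltW K0) (@bsum_wt R g 1 (ltnSn 0))).
have -> : K * (4 * 1) ^+ g / M%:R = M%:R^-1 * (K * (4 * 1%:R) ^+ g) by rewrite mulrC.
apply: bsum_le (hb _); last by rewrite invr_ge0 ltW.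
move=> m /=; set G := gauss _ _ _ _ _ _.
have -> : G + -1 * (RC (fejer_coef M m) * G) = RC (1 - fejer_coef M m) * G by rewrite RCD RCN RC1; ring.
have /andP[k0 k1] := kap_bnd m M0.
rewrite mdM mdRC ger0_norm //; apply: (le_trans (ler_wpM2r (md_ge0 _) k1)).
by rewrite mulrAC mulrC ler_pM2l ?invr_gt0 //; apply: h2.
Qed.

(** The Lipschitz bound near lattice points, still summable over the lattice.
*)
Lemma E_lip w : (forall l, 0 < complex.Im (w l)) -> exists2 L : R, 0 <= L &
  forall u : pts, (forall i, `|u i| <= 2^-1) -> dominated (L * norm1 u) (fun x => E w (fun i => x i + u i) - E w x).
Proof.
move=> w0; have [c0 c00 hc] := exists_lb w0; have [W W0 hW] := exists_ub w.
have b0 := bb_ge0 p q ps qs; have p0 := pi_gt0 R; set b := coef_bound p q ps qs in b0.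
have bg0 : 0 <= b * g%:R by rewrite mulr_ge0.
pose tau := 1 + 2 * pi * (d%:R * (W * (b ^+ 2 * (2 + g%:R)))).
have p1 : 0 <= pi :> R by apply: ltW.
have tau1 : 1 <= tau.
  rewrite lerDl; apply: mulr_ge0; first by apply: mulr_ge0.
  by rewrite !mulr_ge0 ?sqr_ge0 ?addr_ge0.
have tau0 : 0 <= tau by apply: le_trans tau1.
have [K K0 hK] := gauss_dom Hq H1 W (b * g%:R) c00 tau0.
exists (8 * K) => [|u hu x]; first by rewrite mulr_ge0 // ltW.
have nu : norm1 u <= g%:R.
  apply: (le_trans (y := \sum_(i < g) (1 : R))); last by rewrite sumr_const card_ord.
  by apply: ler_sum => i _; apply: le_trans (hu i) _; rewrite invf_le1 // ler1n.
have nu0 := norm1_ge0 u; have nx0 := norm1_ge0 x.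
pose be := two_pi_i R * \sum_l w l * (lincomb p x l * lincomb q u l + lincomb p u l * lincomb q x l + lincomb p u l * lincomb q u l).
have e1 : E w (fun i => x i + u i) = E w x * cexp be.
  rewrite /gauss -cexpD; congr cexp; rewrite /be -mulrDr -big_split /=; congr (_ * _).
  by apply: eq_bigr => l _; rewrite !lin_add; ring.
have hp y l : md (lincomb p y l) <= b * norm1 y by apply: linp_bnd.
have hq y l : md (lincomb q y l) <= b * norm1 y by apply: linq_bnd.
set T := tau * (1 + norm1 x) ^+ 2.
have T1 : 1 <= T.
  by rewrite -[1]mulr1 ler_pM // exprn_ege1 // lerDl.
have TT : T <= T ^+ 3 by rewrite -{1}(expr1 T) ler_weXn2l.
have hbe : md be <= T * norm1 u.
  apply: (le_trans (y := (2 * pi) * (d%:R * (W * ((b * norm1 x) * (b * norm1 u) + (b * norm1 u) * (b * norm1 x) + (b * norm1 u) * (b * norm1 u)))))).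
    apply: mdM_le; first by rewrite (le_trans (md_ReIm _)) //= normr0 add0r ger0_norm // mulr_ge0 // ltW.
    apply: sum_bnd => l; apply: mdM_le => //.
    by apply: mdD_le; [apply: mdD_le|]; apply: mdM_le.
  have -> : b * norm1 x * (b * norm1 u) + b * norm1 u * (b * norm1 x) + b * norm1 u * (b * norm1 u) =
     b ^+ 2 * (2 * norm1 x + norm1 u) * norm1 u by ring.
  have h2 : 2 * norm1 x + norm1 u <= (2 + g%:R) * (1 + norm1 x) ^+ 2.
    have g0 : 0 <= g%:R :> R by [].
    have h3 : 1 + norm1 x <= (1 + norm1 x) ^+ 2 by rewrite expr2; nra.
    have h4 : (2 + g%:R) * (1 + norm1 x) <= (2 + g%:R) * (1 + norm1 x) ^+ 2 by rewrite ler_wpM2l // addr_ge0.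
    apply: le_trans h4; nra.
  pose cc := 2 * pi * (d%:R * (W * b ^+ 2)).
  have cc0 : 0 <= cc by apply: mulr_ge0; [apply: mulr_ge0|rewrite !mulr_ge0 ?sqr_ge0].
  have -> : 2 * pi * (d%:R * (W * (b ^+ 2 * (2 * norm1 x + norm1 u) * norm1 u))) =
    cc * (2 * norm1 x + norm1 u) * norm1 u by rewrite /cc; ring.
  apply: ler_wpM2r => //; apply: (le_trans (ler_wpM2l cc0 h2)).
  have -> : T = (1 + norm1 x) ^+ 2 + cc * ((2 + g%:R) * (1 + norm1 x) ^+ 2) by rewrite /T /tau /cc; ring.
  by rewrite lerDr sqr_ge0.
have z00 (l : 'I_d) : md ((z0 : _ -> C) l) <= b * g%:R by rewrite md0.
have hu' (v : 'I_g -> 'I_d -> C) l : (forall y l', md (lincomb v y l') <= b * norm1 y) -> md (0 + lincomb v u l) <= b * g%:R.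
  by move=> h; rewrite add0r (le_trans (h _ _)) // ler_wpM2l.
have k1 := hK w z0 z0 hc hW z00 z00 x.
have k2 := hK w (fun l => 0 + lincomb p u l) (fun l => 0 + lincomb q u l) hc hW (fun l => hu' p l hp) (fun l => hu' q l hq) x.
rewrite -gauss_add in k2; rewrite -/T in k1 k2.
rewrite e1 in k2; rewrite e1.
have -> : E w x * cexp be - E w x = E w x * (cexp be - 1) by ring.
have hb := cexp_bnd1 be; set Em := md (E w x) in k1 *; have E0 : 0 <= Em by apply: md_ge0.
rewrite mdM in k2; rewrite mdM; rewrite -/Em in k2 *; set c := md (cexp be) in k2 hb *; have c10 : 0 <= c by apply: md_ge0.
apply: (le_trans (y := Em * (4 * (T * norm1 u) * (1 + c)))).
  apply: ler_wpM2l => //; apply: (le_trans hb); apply: ler_wpM2r; first by rewrite addr_ge0.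
  by apply: ler_wpM2l.
have h6 : T * Em <= K * wt x by apply: le_trans k1; rewrite ler_wpM2r.
have h7 : T * (Em * c) <= K * wt x by apply: le_trans k2; rewrite ler_wpM2r // mulr_ge0.
have -> : Em * (4 * (T * norm1 u) * (1 + c)) = 4 * norm1 u * (T * Em + T * (Em * c)) by ring.
have -> : 8 * K * norm1 u * wt x = 4 * norm1 u * (K * wt x + K * wt x) by ring.
by rewrite ler_wpM2l ?mulr_ge0 // lerD.
Qed.

(** For N = 2 P + 1, the grid (1/N) Z^g is the disjoint union of the
translates of Z^g by the points uj. *)
Lemma grid_mean_unfold P (f : pts -> C) K : dominated K f ->
  let N := (2 * P + 1)%N in
  grid_mean N f = RC ((N%:R ^+ g)^-1) * \sum_(j : {ffun 'I_g -> 'I_(2 * P + 1)})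
    summability.sum ((fun k : lat => f (fun i => pt1 k i + ujs R j i)) : lat -> C).
Proof.
move=> hf N; have N0 : (0 < N)%N by rewrite /N addn1.
have NR : N%:R != 0 :> R by rewrite pnatr_eq0 -lt0n.
have NZ : (N%:Z != 0) by rewrite eqz_nat -lt0n.
pose h (j : {ffun 'I_g -> 'I_(2 * P + 1)}) (k : lat) : lat := [ffun i => k i * N%:Z + ((j i)%:Z - P%:Z)].
have ph j k : gridpt R N (h j k) = (fun i => pt1 k i + ujs R j i) :> pts.
  apply/funext => i; rewrite /gridpt ffunE /ujs /uj -/N divr1.
  rewrite rmorphD rmorphM rmorphB /= mulrDl mulfK //.
have hi j j' k k' : h j k = h j' k' -> j = j' /\ k = k'.
  move=> /ffunP e; suff e2 i : (j i = j' i) /\ k i = k' i.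
    by split; apply/ffunP => i; have [] := e2 i.
  have := e i; rewrite !ffunE !addrA => /addIr e3.
  have b1 : (0 <= (j i)%:Z < N%:Z) by rewrite ltz_nat ltn_ord.
  have b2 : (0 <= (j' i)%:Z < N%:Z) by rewrite ltz_nat ltn_ord.
  have d1 := divzMDl (k i) (j i)%:Z NZ; have d2 := divzMDl (k' i) (j' i)%:Z NZ.
  rewrite (@divz_small (j i)%:Z) ?absz_nat ?addr0 // in d1.
  rewrite (@divz_small (j' i)%:Z) ?absz_nat ?addr0 // in d2.
  have kk : k i = k' i by apply: etrans (esym d1) (etrans (congr1 (divz^~ N%:Z) e3) d2).
  split=> //; apply: val_inj; move: e3; rewrite kk => /addrI [] //.
rewrite /grid_mean; congr (_ * _).
rewrite (@sum_partition _ _ _ _ h).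
- by apply: eq_bigr => j _; congr summability.sum; apply/funext => k /=; rewrite ph.
- exact: hi.
- move=> x nx; exfalso.
  pose k : lat := [ffun i => ((x i + P%:Z) %/ N%:Z)%Z].
  have jb i : (absz ((x i + P%:Z) %% N%:Z)%Z < 2 * P + 1)%N.
    by rewrite -ltz_nat gez0_abs ?modz_ge0 // ltz_pmod // ltz_nat.
  apply: (nx [ffun i => Ordinal (jb i)] k); apply/ffunP => i; rewrite !ffunE /=.
  rewrite gez0_abs ?modz_ge0 // addrA -divz_eq addrK //.
- move=> j; have ha := dominated_asum N0 hf; apply: asum_inj ha => k k' /hi[_ //].
Qed.

(** Testing a Gaussian against the Fejer kernel samples it at the lattice
points: the kernel is periodic, has mean 1, and a small first moment against
which the Lipschitz bound is used. *)
Lemma theta_lat_approx w : (forall l, 0 < complex.Im (w l)) ->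
  exists2 c : R, 0 <= c & forall r P, (0 < r)%N -> let N := (2 * P + 1)%N in
    (4 * r ^ 2 <= N)%N ->
    md (grid_mean N (fun x => E w x * RC (fejer (4 * r ^ 2) x)) - theta_lat w) <= c / r%:R.
Proof.
move=> w0; have [L L0 hL] := E_lip w0.
have [c0 c00 hc] := exists_lb w0; have [W W0 hW] := exists_ub w.
have [K K0 hK] := gauss_dom1 Hq H1 W 0 c00.
have dE : dominated K (E w) by apply: hK => // l; rewrite md0.
exists (L * (4 * 1) ^+ g * (2 * g%:R)) => [|r P r0 N MN].
  by rewrite !mulr_ge0 ?exprn_ge0 ?mulr_ge0.
set M := (4 * r ^ 2)%N in MN *.
have M0 : (0 < M)%N by rewrite /M muln_gt0 /= expn_gt0 r0.
have NR : 0 < N%:R :> R by rewrite ltr0n /N addn1.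
have rR : 0 < r%:R :> R by rewrite ltr0n.
have kb (t : R) : fejer1 M t <= M%:R.
  rewrite /fejer1 ler_pdivrMr ?ltr0n // -expr2 ler_sqr ?nnegrE ?md_ge0 //.
  apply: (le_trans (md_sum _ _ _)).
  apply: (le_trans (y := \sum_(i < M) (1 : R))); last by rewrite sumr_const card_ord.
  by apply: ler_sum => i _; rewrite md_ee.
have dEK : dominated (M%:R ^+ g * K) (fun x => E w x * RC (fejer M x)).
  move=> x; rewrite mulrC mdM mdRC ger0_norm ?fejer_ge0 // -mulrA ler_pM ?fejer_ge0 ?md_ge0 //.
  rewrite /fejer -[X in _ ^+ X]card_ord -prodr_const; apply: ler_prod => i _.
  by rewrite fejer1_ge0 kb.
rewrite (grid_mean_unfold P dEK) -/N.
have per k (j : {ffun 'I_g -> 'I_(2 * P + 1)}) : fejer M (fun i => pt1 k i + ujs R j i) = fejer M (ujs R j).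
  by apply: eq_bigr => i _; rewrite /gridpt divr1 addrC fejer1Z.
have dsh u : (forall i, `|u i| <= 2^-1) -> asum (fun k : lat => E w (fun i => pt1 k i + u i)).
  move=> hu; have h1 := dominated_asum (ltnSn 0) (hL u hu); have h2 := dominated_asum (ltnSn 0) dE.
  have [A hA] := asumD h1 h2; exists A; apply: bsum_le hA => k.
  by rewrite subrK.
have hsj j : forall i, `|ujs R (j : {ffun 'I_g -> 'I_(2 * P + 1)}) i| <= 2^-1 by move=> i; exact: uj_half.
have e1 (j : {ffun 'I_g -> 'I_(2 * P + 1)}) :
   summability.sum ((fun k : lat => E w (fun i => pt1 k i + ujs R j i) * RC (fejer M (fun i => pt1 k i + ujs R j i))) : lat -> C) =
   RC (fejer M (ujs R j)) * summability.sum ((fun k : lat => E w (fun i => pt1 k i + ujs R j i)) : lat -> C).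
  rewrite -(sumZ _ (dsh _ (hsj j))); congr summability.sum; apply/funext => k.
  by rewrite per mulrC.
under eq_bigr => j _ do rewrite e1.
have e2 : theta_lat w = RC ((N%:R ^+ g)^-1) * \sum_(j : {ffun 'I_g -> 'I_(2 * P + 1)}) RC (fejer M (ujs R j)) * theta_lat w.
  rewrite -mulr_suml -RC_sum fejer_sum // mulrA -RCM mulVf ?RC1 ?mul1r //.
  by rewrite expf_neq0 // gt_eqF.
rewrite {1}e2 -mulrBr -sumrB mdM mdRC ger0_norm ?invr_ge0 ?exprn_ge0 // mulrC.
rewrite ler_pdivrMr ?exprn_gt0 //; apply: (le_trans (md_sum _ _ _)).
apply: (le_trans (y := \sum_(j : {ffun 'I_g -> 'I_(2 * P + 1)}) L * (4 * 1) ^+ g * (fejer M (ujs R j) * norm1 (ujs R j)))).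
  apply: ler_sum => j _; rewrite -mulrBr mdM mdRC ger0_norm ?fejer_ge0 // mulrCA ler_wpM2l ?fejer_ge0 //.
  rewrite /theta_lat -(sumB (dsh _ (hsj j)) (dominated_asum (ltnSn 0) dE)).
  apply: (le_trans (md_sum_le (dominated_bsum (ltnSn 0) (hL _ (hsj j))))).
  by rewrite mulrAC.
rewrite -mulr_sumr.
have c40 : 0 <= L * (4 * 1) ^+ g by rewrite mulr_ge0 // exprn_ge0.
have h3 := @fejer_nn R g M P r r0 (erefl _) MN.
apply: (le_trans (ler_wpM2l c40 h3)).
by rewrite le_eqVlt; apply/orP; left; apply/eqP; rewrite -/N; field; rewrite gt_eqF.
Qed.

(** Both evaluations of the grid mean of a Gaussian times a Fejer kernel,
combined. *)
Lemma Th_approx w : (forall l, 0 < complex.Im (w l)) -> exists2 c : R, 0 <= c &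
  forall r, (0 < r)%N -> exists2 c' : R, 0 <= c' & forall P, let N := (2 * P + 1)%N in
    (4 * r ^ 2 <= N)%N ->
    md (theta_lat w - theta_dual (fun l => - (w l)^-1) * grid_mean N (E w)) <= c / r%:R + c' / N%:R.
Proof.
move=> w0; have [c1 c10 h1] := theta_lat_approx w0; have [c2 c20 h2] := Gbar_lim w0.
have [c0 c00 hc] := exists_lb w0; have [W W0 hW] := exists_ub w.
have [K K0 hK] := gauss_dom1 Hq H1 W 0 c00.
have dE : dominated K (E w) by apply: hK => // l; rewrite md0.
exists (c1 + c2 * (K * 4 ^+ g)) => [|r r0].
  by rewrite addr_ge0 // !mulr_ge0 ?exprn_ge0 // ltW.
have [c3 c30 h3] := grid_mean_fejer (4 * r ^ 2) w0.
exists c3 => // P N MN; have N0 : (0 < N)%N by rewrite /N addn1.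
have M0 : (0 < 4 * r ^ 2)%N by rewrite muln_gt0 /= expn_gt0 r0.
have rR : 0 < r%:R :> R by rewrite ltr0n.
pose X := grid_mean N (fun x => E w x * RC (fejer (4 * r ^ 2) x)).
have a1 := h1 r P r0 MN; have a2 := h2 _ M0; have a3 := h3 N N0; have a4 := grid_mean_le N0 dE.
rewrite -/N -/X in a1; rewrite -/X in a3.
have -> : theta_lat w - theta_dual (fun l => - (w l)^-1) * grid_mean N (E w) =
  - (X - theta_lat w) + (- (theta_dual (fun l => - (w l)^-1) - Gbar w (4 * r ^ 2)) * grid_mean N (E w)) +
  (X - Gbar w (4 * r ^ 2) * grid_mean N (E w)) by ring.
have a5 : c2 / (4 * r ^ 2)%N%:R <= c2 / r%:R.
  rewrite ler_wpM2l // lef_pV2 ?posrE ?ltr0n // ler_nat.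
  by rewrite mulnC -[X in (X <= _)%N]muln1 leq_mul // -{1}(expn1 r) leq_pexp2l.
apply: mdD_le a3; rewrite mulrDl; apply: mdD_le; first by rewrite mdN.
have -> : c2 * (K * 4 ^+ g) / r%:R = c2 / r%:R * (K * 4 ^+ g) by rewrite mulrAC.
by apply: mdM_le => //; rewrite mdN (le_trans a2).
Qed.

Lemma arch_le0 (x a : R) : 0 <= a -> (forall r, (0 < r)%N -> x <= a / r%:R) -> x <= 0.
Proof.
move=> a0 h; rewrite leNgt; apply/negP => x0.
have [n hn] : exists n : nat, a / x < n%:R.
  by exists (Num.truncn (a / x)).+1; rewrite truncnS_gt.
have := h n.+1 isT; rewrite ler_pdivlMr ?ltr0n // leNgt => /negP; apply.
rewrite ltr_pdivrMr // in hn; apply: (lt_le_trans hn); rewrite mulrC ler_pM2l // ler_nat.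
exact: leqnSn.
Qed.

(** Poisson summation up to the constant lim (prod_l w_l) grid_mean N (gauss
w), which is the same for w and w'; eliminating it spares the evaluation of a
Gaussian integral and of a covolume. *)
Theorem poisson w w' : (forall l, 0 < complex.Im (w l)) -> (forall l, 0 < complex.Im (w' l)) ->
  (\prod_l w l) * theta_lat w * theta_dual (fun l => - (w' l)^-1) =
  (\prod_l w' l) * theta_lat w' * theta_dual (fun l => - (w l)^-1).
Proof.
move=> w0 w0'; set a := \prod_l w l; set a' := \prod_l w' l.
set D := theta_dual (fun l => - (w l)^-1); set D' := theta_dual (fun l => - (w' l)^-1).
have [c1 c10 h1] := Th_approx w0; have [c2 c20 h2] := Th_approx w0'.
have [c3 c30 h3] := grid_mean_scale Hq H1 Hpq Hqq w0' w0.
apply/eqP; rewrite -subr_eq0 -md_eq0 eq_le md_ge0 andbT.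
apply: (@arch_le0 _ (md a * (c1 + 1) * md D' + md a' * (c2 + 1) * md D + md (D * D'))) => [|r r0].
  by rewrite !addr_ge0 ?mulr_ge0 ?addr_ge0 ?md_ge0.
have [k1 k10 hk1] := h1 r r0; have [k2 k20 hk2] := h2 r r0.
have [n hn] : exists n : nat, (k1 + k2 + c3) * r%:R < n%:R.
  by exists (Num.truncn ((k1 + k2 + c3) * r%:R)).+1; rewrite truncnS_gt.
pose P := (n + 4 * r ^ 2)%N; set N := (2 * P + 1)%N.
have N0 : (0 < N)%N by rewrite /N addn1.
have MN : (4 * r ^ 2 <= N)%N by rewrite /N /P; move: (4 * r ^ 2)%N => r4; lia.
have rR : 0 < r%:R :> R by rewrite ltr0n.
have NR : 0 < N%:R :> R by rewrite ltr0n.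
have hkN k : 0 <= k -> k <= k1 + k2 + c3 -> k / N%:R <= 1 / r%:R.
  move=> k0 kk; rewrite ler_pdivrMr // mulrAC ler_pdivlMr // mul1r.
  apply: le_trans (_ : (k1 + k2 + c3) * r%:R <= _); first by rewrite ler_wpM2r.
  by apply: (le_trans (ltW hn)); rewrite ler_nat /N /P mul2n -addnn -!addnA leq_addr.
have b1 := hk1 P MN; have b2 := hk2 P MN; have b3 := h3 N N0.
rewrite -/N -/D in b1; rewrite -/N -/D' in b2.
set m := grid_mean N (E w) in b1 b3; set m' := grid_mean N (E w') in b2 b3.
have d1 : k1 / N%:R <= 1 / r%:R by apply: hkN => //; lra.
have d2 : k2 / N%:R <= 1 / r%:R by apply: hkN => //; lra.
have d3 : c3 / N%:R <= 1 / r%:R by apply: hkN => //; lra.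
have -> : a * theta_lat w * D' - a' * theta_lat w' * D =
  a * (theta_lat w - D * m) * D' - a' * (theta_lat w' - D' * m') * D + (D * D') * (a * m - a' * m') by ring.
rewrite !mulrDl; apply: mdD_le; last first.
  rewrite -[_^-1]mul1r; apply: mdM_le => //.
  exact: le_trans b3 d3.
have e (u v x y : R) : u * v * x * y = u * (v * y) * x by ring.
apply: mdD_le; last rewrite mdN; rewrite e; apply: mdM_le => //; apply: mdM_le => //.
  by apply: (le_trans b1); rewrite mulrDl lerD2l.
by apply: (le_trans b2); rewrite mulrDl lerD2l.
Qed.

End Poisson.

(** * Integrality in the ninth cyclotomic field *)

Section Zeta.
Variables (R : realType) (F : splittingFieldType rat).
Variables (iota : {rmorphism F -> Cplx R}) (zeta : F).
Hypothesis hF : is_Q_zeta9 iota zeta.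
Local Notation C := (Cplx R).
Local Notation u := (iota zeta).
Local Notation K := (realSubfield zeta).

Lemma iota_zeta : u = ee (9%:R^-1 : R).
Proof.
have [_ ->] := hF; rewrite /ee; congr cexp.
Qed.

Lemma u9 : u ^+ 9 = 1.
Proof. by rewrite iota_zeta -eeMn mulfV ?ee1 // pnatr_eq0. Qed.

Lemma u3 : u ^+ 3 != 1.
Proof.
rewrite iota_zeta -eeMn; apply: ee_neq1; apply/andP; split; lra.
Qed.

Lemma zeta9 : zeta ^+ 9 = 1.
Proof. by apply: (fmorph_inj iota); rewrite rmorphXn rmorph1 u9. Qed.

Lemma zeta3 : zeta ^+ 3 != 1.
Proof. by rewrite -(inj_eq (fmorph_inj iota)) rmorphXn rmorph1 u3. Qed.

Lemma root9 (L : fieldType) (v : L) : v ^+ 9 = 1 -> v ^+ 3 != 1 -> v ^+ 6 = - v ^+ 3 - 1.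
Proof.
move=> h9 h3; have : (v ^+ 3 - 1) * (v ^+ 6 + v ^+ 3 + 1) = 0.
  have -> : (v ^+ 3 - 1) * (v ^+ 6 + v ^+ 3 + 1) = v ^+ 9 - 1 by ring.
  by rewrite h9 subrr.
move/eqP; rewrite mulf_eq0 subr_eq0 (negbTE h3) /= => /eqP h.
have -> : v ^+ 6 = (v ^+ 6 + v ^+ 3 + 1) - v ^+ 3 - 1 by ring.
by rewrite h sub0r.
Qed.

Lemma zeta6 : zeta ^+ 6 = - zeta ^+ 3 - 1.
Proof. exact: root9 zeta9 zeta3. Qed.

Lemma zeta_neq0 : zeta != 0.
Proof. by apply/eqP => h; have := zeta9; rewrite h expr0n /= => /eqP; rewrite eq_sym oner_eq0. Qed.

Lemma zetaV : zeta^-1 = zeta ^+ 8.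
Proof. by apply: (mulfI zeta_neq0); rewrite mulfV ?zeta_neq0 // -exprS zeta9. Qed.

Lemma zeta_mod n : zeta ^+ n = zeta ^+ (n %% 9).
Proof. by rewrite {1}(divn_eq n 9) exprD mulnC exprM zeta9 expr1n mul1r. Qed.

Definition zeta_comb (a0 a1 a2 a3 a4 a5 : int) : F :=
  a0%:~R + a1%:~R * zeta + a2%:~R * zeta ^+ 2 + a3%:~R * zeta ^+ 3 +
  a4%:~R * zeta ^+ 4 + a5%:~R * zeta ^+ 5.

(** Membership in Z[zeta], with explicit coordinates: traces of such elements
reduce to integer arithmetic. *)
Definition Zin (x : F) := exists a0 a1 a2 a3 a4 a5, x = zeta_comb a0 a1 a2 a3 a4 a5.

Lemma Zin_int m : Zin m%:~R.
Proof. by exists m, 0, 0, 0, 0, 0; rewrite /zeta_comb !mulr0z !mul0r !addr0. Qed.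

Lemma ZinD x y : Zin x -> Zin y -> Zin (x + y).
Proof.
move=> [a0 [a1 [a2 [a3 [a4 [a5 ->]]]]]] [b0 [b1 [b2 [b3 [b4 [b5 ->]]]]]].
exists (a0 + b0), (a1 + b1), (a2 + b2), (a3 + b3), (a4 + b4), (a5 + b5).
by rewrite /zeta_comb !intrD; ring.
Qed.

Lemma ZinMz m x : Zin x -> Zin (m%:~R * x).
Proof.
move=> [a0 [a1 [a2 [a3 [a4 [a5 ->]]]]]].
exists (m * a0), (m * a1), (m * a2), (m * a3), (m * a4), (m * a5).
by rewrite /zeta_comb !intrM; ring.
Qed.

Lemma ZinN x : Zin x -> Zin (- x).
Proof. by move=> /(ZinMz (-1)); rewrite mulrN1z mulN1r. Qed.

Lemma ZinB x y : Zin x -> Zin y -> Zin (x - y).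
Proof. by move=> hx hy; apply: ZinD => //; apply: ZinN. Qed.

Lemma Zin_mulzeta x : Zin x -> Zin (x * zeta).
Proof.
move=> [a0 [a1 [a2 [a3 [a4 [a5 ->]]]]]].
exists (- a5), a0, a1, (a2 - a5), a3, a4.
have -> : zeta_comb a0 a1 a2 a3 a4 a5 * zeta = a0%:~R * zeta + a1%:~R * zeta ^+ 2 +
   a2%:~R * zeta ^+ 3 + a3%:~R * zeta ^+ 4 + a4%:~R * zeta ^+ 5 + a5%:~R * zeta ^+ 6.
  by rewrite /zeta_comb; ring.
by rewrite zeta6 /zeta_comb intrB rmorphN /=; ring.
Qed.

Lemma Zin_zeta n : Zin (zeta ^+ n).
Proof.
elim: n => [|n IH]; first exact: (Zin_int 1).
by rewrite exprSr; apply: Zin_mulzeta.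
Qed.

Lemma ZinM x y : Zin x -> Zin y -> Zin (x * y).
Proof.
move=> hx [b0 [b1 [b2 [b3 [b4 [b5 ->]]]]]].
have h n : Zin (x * zeta ^+ n).
  by elim: n => [|n IH]; [rewrite mulr1|rewrite exprSr mulrA; apply: Zin_mulzeta].
have -> : x * zeta_comb b0 b1 b2 b3 b4 b5 = b0%:~R * (x * zeta ^+ 0) + b1%:~R * (x * zeta ^+ 1) +
  b2%:~R * (x * zeta ^+ 2) + b3%:~R * (x * zeta ^+ 3) + b4%:~R * (x * zeta ^+ 4) + b5%:~R * (x * zeta ^+ 5).
  by rewrite /zeta_comb expr0 expr1; ring.
by do !apply: ZinD; apply: ZinMz.
Qed.

Lemma Zin1 : Zin 1. Proof. exact: (Zin_int 1). Qed.
Lemma ZinX x n : Zin x -> Zin (x ^+ n).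
Proof. by move=> h; elim: n => [|n IH]; [exact: Zin1|rewrite exprS; apply: ZinM]. Qed.

Lemma aint_zeta : integralOver (intr : int -> F) zeta.
Proof.
exists ('X^9 - 1%:P); first by rewrite monicXnsubC.
by rewrite rmorphB /= map_polyXn map_polyC /= /root !hornerE zeta9 subrr.
Qed.

Lemma aint_int (L : fieldType) (m : int) : integralOver (intr : int -> L) m%:~R.
Proof. exact: integral_id. Qed.

Lemma aintX (L : fieldType) (x : L) n : integralOver (intr : int -> L) x -> integralOver (intr : int -> L) (x ^+ n).
Proof.
move=> h; elim: n => [|n IH]; first exact: integral1.
by rewrite exprS; apply: integral_mul.
Qed.

Lemma Zin_aint x : Zin x -> integralOver (intr : int -> F) x.
Proof.
move=> [a0 [a1 [a2 [a3 [a4 [a5 ->]]]]]].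
by do !apply: integral_add; try exact: aint_int; apply: integral_mul; try exact: aint_int;
  try exact: aint_zeta; apply: aintX; exact: aint_zeta.
Qed.

(** Z is integrally closed, with the target an arbitrary field of
characteristic 0: the numerator and the denominator of y are compared in a
monic integer equation. *)
Lemma int_of_aint (L : numFieldType) (y : L) (N m : int) :
  N != 0 -> N%:~R * y = m%:~R -> integralOver (intr : int -> L) y -> exists k : int, y = k%:~R.
Proof.
move=> N0 Ny [P Pm /rootP Py].
pose r : rat := m%:~R / N%:~R; pose a := denq r; pose b := numq r.
have ab : coprimez a b by rewrite coprimezE coprime_sym; exact: coprime_num_den.
have Nab : N * b = m * a.
  apply: (@intr_inj rat); rewrite !intrM /b numqE -/a /r.
  by field; rewrite intr_eq0.
have ay : a%:~R * y = b%:~R.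
  have NL : (N%:~R : L) != 0 by rewrite intr_eq0.
  by apply: (mulfI NL); rewrite mulrCA Ny -!intrM Nab mulrC.
pose n := (size P).-1.
have sP : size P = n.+1 by rewrite prednK // lt0n size_poly_eq0 monic_neq0.
move: Py; rewrite /map_poly horner_poly sP big_ord_recr /=.
have -> : P`_n = 1 by move/monicP: Pm; rewrite lead_coefE.
rewrite mul1r => Py.
have e : b ^+ n + a * (\sum_(i < n) P`_i * b ^+ i * a ^+ (n - i).-1) = 0.
  apply: (@intr_inj L); rewrite rmorph0 -(mulr0 ((a%:~R : L) ^+ n)) -Py mulrDr addrC.
  rewrite rmorphD /= rmorphXn /= -exprMn ay; congr (_ + _).
  rewrite rmorphM rmorph_sum /= !mulr_sumr; apply: eq_bigr => i _.
  rewrite !rmorphM !rmorphXn /= -ay exprMn.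
  have -> : (a%:~R : L) ^+ n = a%:~R ^+ i * (a%:~R * a%:~R ^+ (n - i).-1).
    by rewrite -exprS -exprD prednK ?subn_gt0 // subnKC // ltnW.
  ring.
have da : (a %| b ^+ n)%Z.
  have -> : b ^+ n = a * - (\sum_(i < n) P`_i * b ^+ i * a ^+ (n - i).-1).
    by apply/eqP; rewrite mulrN -addr_eq0; apply/eqP.
  exact: dvdz_mulr.
have a1 : a = 1.
  have : coprimez a (b ^+ n) by apply: coprimezXr.
  rewrite /coprimez; have -> : gcdz a (b ^+ n) = `|a|%N.
    by apply/eqP; rewrite eqz_nat; apply/eqP/gcdn_idPl; rewrite -dvdzE.
  by rewrite eqz_nat => /eqP h; have := denq_gt0 r; rewrite -/a; lia.
by exists b; rewrite -ay a1 mul1r.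
Qed.

Lemma denZ x : exists2 N : int, N != 0 & Zin (N%:~R * x).
Proof.
have [h1 _] := hF; have : x \in <<1; zeta>>%VS by rewrite h1 memvf.
move=> /Fadjoin_polyP[P /polyOverP hP ->]; rewrite horner_coef.
elim: (size P) => [|n [N N0 IH]].
  by exists 1 => //; rewrite big_ord0 mulr0; exact: (Zin_int 0).
have /vlineP[r hr] := hP n.
exists (N * denq r); first by rewrite mulf_neq0 // denq_neq0.
rewrite big_ord_recr /= mulrDr intrM; apply: ZinD.
  by rewrite mulrAC mulrC; apply: ZinMz.
have -> : P`_n = r%:A by rewrite hr.
have -> : N%:~R * (denq r)%:~R * (r%:A * zeta ^+ n) = (N * numq r)%:~R * zeta ^+ n.
  rewrite intrM -!mulrA; congr (_ * _); rewrite mulrA; congr (_ * _).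
  by rewrite -(scaler_int (denq r) (1 : F)) -scalerAl mul1r scalerA mulrC -numqE scaler_int.
by apply: ZinMz; exact: Zin_zeta.
Qed.

(** Some nonzero integer multiple of each element is an integral polynomial in
zeta. *)
Lemma hom_ext (L : numFieldType) (f h : F -> L) : zmod_morphism f -> zmod_morphism h ->
  monoid_morphism f -> monoid_morphism h -> f zeta = h zeta -> f =1 h.
Proof.
move=> af ah mf mh fh x.
pose ff : {rmorphism F -> L} := HB.pack f (GRing.isZmodMorphism.Build _ _ f af) (GRing.isMonoidMorphism.Build _ _ f mf).
pose hh : {rmorphism F -> L} := HB.pack h (GRing.isZmodMorphism.Build _ _ h ah) (GRing.isMonoidMorphism.Build _ _ h mh).
have [N N0 [a0 [a1 [a2 [a3 [a4 [a5 e]]]]]]] := denZ x.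
have NL : (N%:~R : L) != 0 by rewrite intr_eq0.
apply: (mulfI NL).
have -> : N%:~R * f x = ff (N%:~R * x) by rewrite rmorphM rmorph_int.
have -> : N%:~R * h x = hh (N%:~R * x) by rewrite rmorphM rmorph_int.
have fz n : ff (zeta ^+ n) = hh (zeta ^+ n) by rewrite !rmorphXn /= fh.
have fz1 : ff zeta = hh zeta by exact: fh.
by rewrite e /zeta_comb !rmorphD !(rmorphM _ _%:~R) !rmorph_int !fz fz1.
Qed.

Local Notation eta := (zeta + zeta^-1).

Lemma iota_zetaV : iota zeta^-1 = (iota zeta)^*.
Proof. by rewrite fmorphV iota_zeta ee_conj eeN. Qed.

Lemma etaK : eta \in K.
Proof. exact: memv_adjoin. Qed.

Lemma conj_rat (r : rat) : (iota r%:A)^* = iota r%:A.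
Proof.
pose f : {rmorphism rat -> C} := iota \o in_alg F.
pose g : {rmorphism rat -> C} := Num.conj \o f.
by have := fmorph_eq_rat f r; have := fmorph_eq_rat g r; rewrite /= => -> ->.
Qed.

Lemma iota_K_real x : x \in K -> (iota x)^* = iota x.
Proof.
move=> /Fadjoin_polyP[P /polyOverP hP ->]; rewrite horner_coef !rmorph_sum /=.
apply: eq_bigr => i _; have /vlineP[r ->] := hP i.
rewrite !rmorphM !rmorphXn /= conj_rat; congr (_ * _ ^+ _).
by rewrite !rmorphD /= iota_zetaV conjCK addrC.
Qed.

Lemma u_conj : u^* = u^-1.
Proof. by rewrite -iota_zetaV fmorphV. Qed.

Lemma u_neq0 : u != 0.
Proof. by rewrite fmorph_eq0 zeta_neq0. Qed.

(** K is real, zeta is not. *)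
Lemma zetaNK : zeta \notin K.
Proof.
apply/negP => /iota_K_real; rewrite u_conj => h.
have u2 : u ^+ 2 = 1 by rewrite expr2 -{1}h mulVf ?u_neq0.
have u1 : u = 1.
  by rewrite -u9 (_ : 9 = 2 * 4 + 1)%N // exprD exprM u2 expr1n mul1r expr1.
by move: u3; rewrite u1 expr1n eqxx.
Qed.

(** The polynomial (X - zeta)(X - zeta^-1) has coefficients in K, hence is the
minimal polynomial of zeta over K. *)
Lemma conj_gal : exists2 c : gal_of {:F}, c \in 'Gal({:F} / K)%g & c zeta = zeta^-1.
Proof.
apply: (@normalField_root_minPoly _ _ K fullv); rewrite ?subvf ?memvf ?normalFieldf //.
pose q := ('X - zeta%:P) * ('X - (zeta^-1)%:P).
have qE : q = 'X^2 - eta%:P * 'X + 1.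
  have e : zeta%:P * (zeta^-1)%:P = 1 :> {poly F} by rewrite -polyCM mulfV ?zeta_neq0.
  by rewrite /q polyCD -e; ring.
have qK : q \is a polyOver K.
  rewrite qE rpredD ?rpred1 // rpredB ?rpredX ?polyOverX // rpredM ?polyOverX //.
  by rewrite polyOverC etaK.
have q0 : root q zeta by rewrite /q rootM root_XsubC eqxx.
have dv := minPoly_dvdp qK q0.
have sq : size q = 3%N by rewrite size_Mmonic ?polyXsubC_eq0 ?monicXsubC // !size_XsubC.
have sm : (3 <= size (minPoly K zeta))%N.
  rewrite size_minPoly ltnS.
  have h1 : adjoin_degree K zeta != 1%N by rewrite adjoin_deg_eq1 zetaNK.
  have h0 : (0 < adjoin_degree K zeta)%N by [].
  by move: h0 h1; case: (adjoin_degree K zeta) => [|[|n]].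
have qn0 : q != 0 by rewrite -size_poly_eq0 sq.
have /andP[_ qm] : minPoly K zeta %= q.
  by rewrite -dvdp_size_eqp // eqn_leq dvdp_leq // sq.
by rewrite -dvdp_XsubCl; apply: dvdp_trans qm; rewrite dvdp_XsubCl /q rootM !root_XsubC eqxx orbT.
Qed.

End Zeta.

(** * The embeddings of F *)

Section Embeddings.
Variables (R : realType) (F : splittingFieldType rat).
Variables (iota : {rmorphism F -> Cplx R}) (zeta : F).
Hypothesis hF : is_Q_zeta9 iota zeta.
Local Notation C := (Cplx R).
Local Notation u := (iota zeta).
Local Notation K := (realSubfield zeta).

Lemma conjF_ex : exists c : {rmorphism F -> F}, c zeta = zeta^-1 /\ forall x, iota (c x) = (iota x)^*.
Proof.
have [c _ cz] := conj_gal hF.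
exists (gal_repr c : {rmorphism F -> F}); split=> // x.
pose f : {rmorphism F -> C} := iota \o (gal_repr c : {rmorphism F -> F}).
pose g : {rmorphism F -> C} := Num.conj \o iota.
apply: (@hom_ext _ _ _ _ hF _ f g); try exact: rmorphB; try (split; [exact: rmorph1|exact: rmorphM]).
by rewrite /= cz iota_zetaV.
Qed.

(** The element picked by xget exists, because complex conjugation preserves
F. *)
Lemma conjFE x : iota (conjF iota x) = (iota x)^*.
Proof.
have [c [_ hc]] := conjF_ex; rewrite /conjF; case: xgetP => [y _ //|/(_ (c x))].
by rewrite /= hc.
Qed.

Lemma conjF_is_zmod : zmod_morphism (conjF iota).
Proof. by move=> x y; apply: (fmorph_inj iota); rewrite rmorphB /= !conjFE !rmorphB. Qed.
Lemma conjF_is_monoid : monoid_morphism (conjF iota).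
Proof.
split; first by apply: (fmorph_inj iota); rewrite conjFE !rmorph1.
by move=> x y; apply: (fmorph_inj iota); rewrite rmorphM /= !conjFE !rmorphM.
Qed.
Lemma conjF_zeta : conjF iota zeta = zeta^-1.
Proof. by apply: (fmorph_inj iota); rewrite conjFE (iota_zetaV hF). Qed.

Lemma zeta_prim : 9.-primitive_root zeta.
Proof.
have [m hm] := prim_order_exists (isT : (0 < 9)%N) (zeta9 hF).
have zm := prim_expr_order hm => dm; have : m \in divisors 9 by rewrite -dvdn_divisors.
rewrite (_ : divisors 9 = [:: 1; 3; 9]%N) // !inE => /or3P[] /eqP me.
- by have := zeta3 hF; rewrite -(expr1 zeta) in zm *; rewrite me in zm; rewrite zm expr1n eqxx.
- by have := zeta3 hF; rewrite me in zm; rewrite zm eqxx.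
- by rewrite -me.
Qed.

Definition units9 : seq nat := [:: 1; 2; 4; 5; 7; 8]%N.

Lemma gal_zeta (g : gal_of {:F}) : exists2 k : nat, k \in units9 & g zeta = zeta ^+ k.
Proof.
have h9 : (g zeta) ^+ 9 = 1 by rewrite -rmorphXn (zeta9 hF) rmorph1.
have h3 : (g zeta) ^+ 3 != 1 by rewrite -rmorphXn fmorph_eq1 (zeta3 hF).
have [i gi] := prim_rootP zeta_prim h9; exists (i : nat) => //.
move: h3; rewrite gi -exprM; case: i {gi} => i /= hi.
case: i hi => [|[|[|[|[|[|[|[|[|i]]]]]]]]] //= _.
- by rewrite eqxx.
- by rewrite (zeta9 hF) eqxx.
- by rewrite (_ : 6 * 3 = 9 * 2)%N // exprM (zeta9 hF) expr1n eqxx.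
Qed.

Lemma gal_ext (g g' : gal_of {:F}) : g zeta = g' zeta -> g = g'.
Proof.
move=> e; apply/eqP/gal_eqP => x _; apply: (fmorph_inj iota).
pose f : {rmorphism F -> C} := iota \o (gal_repr g : {rmorphism F -> F}).
pose f' : {rmorphism F -> C} := iota \o (gal_repr g' : {rmorphism F -> F}).
apply: (@hom_ext _ _ _ _ hF _ f f'); try exact: rmorphB; try (split; [exact: rmorph1|exact: rmorphM]).
by rewrite /= e.
Qed.

(** The class of a unit modulo 9 up to sign: these classes index the
embeddings of K. *)
Definition cls (k : nat) : 'I_3 := if k \in [:: 1; 8]%N then 0 else if k \in [:: 2; 7]%N then 1 else 2.
Definition rep (j : 'I_3) : nat := nth 0%N [:: 1; 2; 4]%N j.

Lemma clsP k : k \in units9 -> rep (cls k) = k \/ rep (cls k) = (9 - k)%N.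
Proof.
by rewrite !inE => /or4P[/eqP->|/eqP->|/eqP->|/or3P[]/eqP->]; rewrite /cls /rep /=; auto.
Qed.

Variable sigma : 'I_3 -> gal_of K.
Hypothesis hsigma : is_gal_enum sigma.

Lemma sigma_gal l : sigma l \in 'Gal(K / 1)%g.
Proof. by have [_ <- _] := hsigma; apply/imsetP; exists l. Qed.

Lemma sigma_ext l : exists x : gal_of {:F}, {in K, sigma l =1 x}.
Proof.
have h : kHom 1 K (sigma l) by rewrite -gal_kHom ?sub1v //; exact: sigma_gal.
have [|x _ hx] := @kHom_to_gal _ _ 1%AS K fullv%AS (sigma l) _ (normalFieldf _) h.
  by rewrite sub1v subvf.
by exists x.
Qed.

(** Each sigma_l extends to an embedding E_l of F, sending zeta to a power
u^(k l) of its image. The l-th extension is only determined up to conjugation,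
so the exponents are controlled only through sums of even functions of k l. *)
Lemma embeddings : exists (E : 'I_3 -> {rmorphism F -> C}) (k : 'I_3 -> nat),
  [/\ forall l, E l zeta = u ^+ k l,
      forall l x, x \in K -> iota (sigma l x) = E l x,
      forall (V : nmodType) (h : nat -> V), {in units9, forall j, h (9 - j)%N = h j} ->
        \sum_l h (k l) = h 1%N + h 2 + h 4,
      forall l, k l \in units9 &
      forall x, iota (galTrace 1 fullv x) = \sum_l (E l x + (E l x)^*)].
Proof.
have [xg hx] := choice sigma_ext.
have /choice[k hk] : forall l, exists k, k \in units9 /\ xg l zeta = zeta ^+ k.
  by move=> l; have [k k1 k2] := gal_zeta (xg l); exists k.
pose E l : {rmorphism F -> C} := iota \o (gal_repr (xg l) : {rmorphism F -> F}).
have ku l : k l \in units9 by have [] := hk l.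
have Ez l : E l zeta = u ^+ k l by rewrite /E /= (hk l).2 rmorphXn.
have Es l x : x \in K -> iota (sigma l x) = E l x by move=> xK; rewrite /E /= hx.
have even_cls (V : nmodType) (h : nat -> V) : {in units9, forall j, h (9 - j)%N = h j} ->
    {in units9, forall j, h j = h (rep (cls j))}.
  by move=> hh j ju; have [->|->] := clsP ju; rewrite ?hh.
have cinj : injective (fun l => cls (k l)).
  move=> l l' e; have [si _ _] := hsigma; apply: si; apply/eqP.
  rewrite gal_adjoin_eq ?sigma_gal //; apply/eqP/(fmorph_inj iota).
  rewrite !Es ?etaK // !rmorphD !fmorphV !Ez.
  pose h j := u ^+ j + (u ^+ j)^-1.
  have heven : {in units9, forall j, h (9 - j)%N = h j}.
    move=> j ju; rewrite /h; have j9 : (j <= 9)%N by move: ju; rewrite !inE => /or4P[/eqP->|/eqP->|/eqP->|/or3P[]/eqP->].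
    have -> : u ^+ (9 - j) = (u ^+ j)^-1.
      apply: (mulfI (expf_neq0 j (u_neq0 hF))); rewrite -exprD subnKC // (u9 hF) mulfV //.
      exact: expf_neq0 (u_neq0 hF).
    by rewrite invrK addrC.
  by rewrite -!/(h _) (even_cls _ _ heven _ (ku l)) (even_cls _ _ heven _ (ku l')) e.
have hsum (V : nmodType) (h : nat -> V) : {in units9, forall j, h (9 - j)%N = h j} ->
    \sum_l h (k l) = h 1%N + h 2 + h 4.
  move=> he; rewrite (eq_bigr (fun l => h (rep (cls (k l))))); last first.
    by move=> l _; apply: even_cls.
  rewrite -(@reindex_inj _ _ _ _ (fun l => cls (k l)) xpredT (fun j => h (rep j)) cinj) /=.
  by rewrite !big_ord_recl big_ord0 /rep /= addr0 addrA.
exists E, k; split=> //.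
have [c _ cz] := conj_gal hF.
have /choice[e he] : forall g : gal_of {:F}, exists k, k \in units9 /\ g zeta = zeta ^+ k.
  by move=> g; have [j j1 j2] := gal_zeta g; exists j.
have eq_unit (i j : nat) : i \in units9 -> j \in units9 -> zeta ^+ i = zeta ^+ j -> i = j.
  move=> hi hj /eqP; rewrite (eq_prim_root_expr zeta_prim).
  have lt9 n : n \in units9 -> (n < 9)%N by rewrite !inE => /or4P[/eqP->|/eqP->|/eqP->|/or3P[]/eqP->].
  by rewrite !modn_small ?lt9 // => /eqP.
have pe : perm_eq [seq e g | g <- enum 'Gal({:F} / 1)%g] units9.
  apply: uniq_perm => //.
    rewrite map_inj_in_uniq ?enum_uniq // => g g' _ _ ee'; apply: gal_ext.
    by rewrite (he g).2 (he g').2 ee'.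
  move=> j; apply/mapP/idP => [[g _ ->]|ju]; first by have [] := he g.
  have gal1 (g : gal_of {:F}) : g \in enum 'Gal({:F} / 1)%g.
    by rewrite mem_enum gal_kHom ?sub1v //; exact: k1AHom.
  have [l hl] : exists l, cls (k l) = cls j.
    have [ci _ cK] := injF_bij cinj; by exists (ci (cls j)); rewrite cK.
  have [kj|kj] : k l = j \/ (9 - k l)%N = j.
    have := clsP (ku l); have := clsP ju; rewrite hl.
    have lt9 n : n \in units9 -> (n < 9)%N by rewrite !inE => /or4P[/eqP->|/eqP->|/eqP->|/or3P[]/eqP->].
    by have := lt9 _ (ku l); have := lt9 _ ju; lia.
  - exists (xg l) => //; apply: eq_unit => //; first by have [] := he (xg l).
    by rewrite -(he _).2 (hk l).2 kj.
  - exists (c * xg l)%g => //; apply: eq_unit => //; first by have [] := he (c * xg l)%g.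
    rewrite -(he _).2 galM ?memvf // cz fmorphV /= (hk l).2 -kj.
    have k9 : (k l <= 9)%N by move: (ku l); rewrite !inE => /or4P[/eqP->|/eqP->|/eqP->|/or3P[]/eqP->].
    apply: (mulfI (expf_neq0 (k l) (zeta_neq0 hF))); rewrite -exprD subnKC // (zeta9 hF) mulfV //.
    exact: expf_neq0 (zeta_neq0 hF).
have key n : iota (galTrace 1 fullv (zeta ^+ n)) = \sum_l (E l (zeta ^+ n) + (E l (zeta ^+ n))^*).
  pose h j : C := u ^+ (j * n) + u ^+ ((9 - j) * n).
  have un0 j : u ^+ j != 0 by rewrite expf_neq0 // (u_neq0 hF).
  rewrite (eq_bigr (fun l => h (k l))); last first.
    move=> l _; rewrite !rmorphXn Ez /= !rmorphXn /= (u_conj hF) /h -!exprM; congr (_ + _).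
    have k9 : (k l <= 9)%N by move: (ku l); rewrite !inE => /or4P[/eqP->|/eqP->|/eqP->|/or3P[]/eqP->].
    rewrite exprVn; apply: (mulfI (un0 (k l * n)%N)); rewrite mulfV //.
    by rewrite -exprD -mulnDl subnKC // exprM (u9 hF) expr1n.
  rewrite hsum; last first.
    by move=> j ju; rewrite /h addrC subKn //; move: ju; rewrite !inE => /or4P[/eqP->|/eqP->|/eqP->|/or3P[]/eqP->].
  rewrite /galTrace rmorph_sum (eq_bigr (fun g => u ^+ (e g * n))); last first.
    by move=> g _; rewrite !rmorphXn /= (he g).2 rmorphXn /= -exprM.
  rewrite -big_enum /= -(big_map e xpredT (fun j => u ^+ (j * n))) (perm_big _ pe) /=.
  rewrite /units9 !big_cons big_nil /h /=; ring.
move=> x; have [N N0 [a0 [a1 [a2 [a3 [a4 [a5 ex]]]]]]] := denZ hF x.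
have NC : (N%:~R : C) != 0 by rewrite intr_eq0.
pose T1 y := iota (galTrace 1 fullv y); pose T2 y := \sum_l (E l y + (E l y)^*).
have T1D y z : T1 (y + z) = T1 y + T1 z.
  rewrite /T1 /galTrace -rmorphD -big_split /=; congr (iota _); apply: eq_bigr => g _; exact: rmorphD.
have T2D y z : T2 (y + z) = T2 y + T2 z.
  by rewrite /T2 -big_split /=; apply: eq_bigr => l _; rewrite !rmorphD /=; ring.
have T1Z (m : int) y : T1 (m%:~R * y) = m%:~R * T1 y.
  rewrite /T1 /galTrace -(rmorph_int iota) -rmorphM mulr_sumr; congr (iota _); apply: eq_bigr => g _.
  by rewrite rmorphM rmorph_int.
have T2Z (m : int) y : T2 (m%:~R * y) = m%:~R * T2 y.
  rewrite /T2 mulr_sumr; apply: eq_bigr => l _; rewrite !rmorphM !rmorph_int; ring.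
have keyT n : T1 (zeta ^+ n) = T2 (zeta ^+ n) by exact: key.
have k0 : T1 1 = T2 1 by exact: (keyT 0%N).
have k1 : T1 zeta = T2 zeta by exact: (keyT 1%N).
apply: (mulfI NC); rewrite -[LHS]T1Z -[RHS]T2Z ex /zeta_comb -(mulr1 a0%:~R).
by rewrite !T1D !T2D !T1Z !T2Z k0 k1 !keyT.
Qed.
End Embeddings.

(** * The lattice, its dual and the residue map *)

Section Lattice.
Variables (R : realType) (F : splittingFieldType rat).
Variables (iota : {rmorphism F -> Cplx R}) (zeta : F).
Hypothesis hF : is_Q_zeta9 iota zeta.
Local Notation C := (Cplx R).
Local Notation u := (iota zeta).
Local Notation K := (realSubfield zeta).
Local Notation conjF := (conjF iota).
Local Notation Zin := (Zin zeta).
Local Notation aint := (integralOver (intr : int -> F)).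
Variables (E : 'I_3 -> {rmorphism F -> C}) (k : 'I_3 -> nat).
Hypothesis Ez : forall l, E l zeta = u ^+ k l.
Hypothesis Esum : forall (V : nmodType) (h : nat -> V), {in units9, forall j, h (9 - j)%N = h j} ->
        \sum_l h (k l) = h 1%N + h 2 + h 4.
Hypothesis ku : forall l, k l \in units9.

Lemma conjFB x y : conjF (x - y) = conjF x - conjF y. Proof. exact: (conjF_is_zmod hF). Qed.
Lemma conjFM x y : conjF (x * y) = conjF x * conjF y.
Proof. by have [_] := conjF_is_monoid hF; exact. Qed.
Lemma conjF1 : conjF 1 = 1. Proof. by have [] := conjF_is_monoid hF. Qed.
Lemma conjF0 : conjF 0 = 0. Proof. by have := conjFB 0 0; rewrite !subrr. Qed.
Lemma conjFN x : conjF (- x) = - conjF x. Proof. by rewrite -sub0r conjFB conjF0 sub0r. Qed.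
Lemma conjFD x y : conjF (x + y) = conjF x + conjF y.
Proof. by rewrite -{1}(opprK y) conjFB conjFN opprK. Qed.
Lemma conjFX x n : conjF (x ^+ n) = conjF x ^+ n.
Proof. by elim: n => [|n IH]; rewrite ?expr0 ?conjF1 // !exprS conjFM IH. Qed.
Lemma conjFV x : conjF x^-1 = (conjF x)^-1.
Proof. by apply: (fmorph_inj iota); rewrite (conjFE hF) !fmorphV (conjFE hF). Qed.
Lemma conjFK x : conjF (conjF x) = x.
Proof. by apply: (fmorph_inj iota); rewrite !(conjFE hF) conjCK. Qed.
Lemma conjF_int (m : int) : conjF m%:~R = m%:~R.
Proof.
apply: (fmorph_inj iota); rewrite (conjFE hF) rmorph_int.
by have := rmorph_int (@Num.conj C) m.
Qed.
Lemma conjF_K x : x \in K -> conjF x = x.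
Proof. by move=> xK; apply: (fmorph_inj iota); rewrite (conjFE hF) (iota_K_real hF). Qed.

Lemma E_conj l x : E l (conjF x) = (E l x)^*.
Proof.
pose g : {rmorphism F -> C} := Num.conj \o E l.
apply: (@hom_ext _ _ _ _ hF _ (fun x => E l (conjF x)) g).
- by move=> a b; rewrite conjFB rmorphB.
- exact: rmorphB.
- by split; [rewrite conjF1 rmorph1|move=> a b; rewrite conjFM rmorphM].
- by split; [exact: rmorph1|exact: rmorphM].
rewrite /= (conjF_zeta hF) fmorphV Ez rmorphXn /= (u_conj hF) exprVn //.
Qed.

Definition trF x : C := \sum_l (E l x + (E l x)^*).

Lemma TrD x y : trF (x + y) = trF x + trF y.
Proof. by rewrite /trF -big_split /=; apply: eq_bigr => l _; rewrite !rmorphD /=; ring. Qed.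
Lemma TrZ (m : int) x : trF (m%:~R * x) = m%:~R * trF x.
Proof.
rewrite /trF mulr_sumr; apply: eq_bigr => l _.
by rewrite !rmorphM !rmorph_int; ring.
Qed.
Lemma Tr0 : trF 0 = 0.
Proof. by have := TrZ 0 0; rewrite mulr0z !mul0r. Qed.

Definition tr_zeta_pow (n : nat) : int := if (n %% 9 == 0)%N then 6 else if (n %% 3 == 0)%N then -3 else 0.

(** The Ramanujan sum modulo 9. *)
Lemma Tr_zeta n : trF (zeta ^+ n) = (tr_zeta_pow n)%:~R.
Proof.
have un0 j : u ^+ j != 0 by rewrite expf_neq0 // (u_neq0 hF).
have u9n j : u ^+ j = u ^+ (j %% 9) by rewrite -!rmorphXn (zeta_mod hF).
pose h j : C := u ^+ (j * n) + u ^+ ((9 - j) * n).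
rewrite /trF (eq_bigr (fun l => h (k l))); last first.
  move=> l _; rewrite !rmorphXn Ez /= !rmorphXn /= (u_conj hF) /h -!exprM; congr (_ + _).
  have k9 : (k l <= 9)%N by move: (ku l); rewrite !inE => /or4P[/eqP->|/eqP->|/eqP->|/or3P[]/eqP->].
  rewrite exprVn; apply: (mulfI (un0 (k l * n)%N)); rewrite mulfV //.
  by rewrite -exprD -mulnDl subnKC // exprM (u9 hF) expr1n.
rewrite Esum; last first.
  by move=> j ju; rewrite /h addrC subKn //; move: ju; rewrite !inE => /or4P[/eqP->|/eqP->|/eqP->|/or3P[]/eqP->].
have -> : tr_zeta_pow n = tr_zeta_pow (n %% 9) by rewrite /tr_zeta_pow modn_mod modn_dvdm.
have hh j : u ^+ (j * n) = u ^+ (j * (n %% 9) %% 9) by rewrite u9n modnMmr.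
have u6 : u ^+ 6 = - u ^+ 3 - 1 by rewrite -!rmorphXn (zeta6 hF) rmorphB rmorphN rmorph1.
have u7 : u ^+ 7 = - u ^+ 4 - u by rewrite exprSr u6; ring.
have u8 : u ^+ 8 = - u ^+ 5 - u ^+ 2 by rewrite exprSr u7; ring.
rewrite /h !hh; have := ltn_pmod n (isT : (0 < 9)%N).
by case: (n %% 9)%N => [|[|[|[|[|[|[|[|[|]]]]]]]]] //= _; rewrite /tr_zeta_pow /= /modn /= ?expr0 ?expr1 ?u6 ?u7 ?u8; ring.
Qed.

Lemma Tr_z6 a0 a1 a2 a3 a4 a5 n : trF (zeta_comb zeta a0 a1 a2 a3 a4 a5 * zeta ^+ n) =
  (a0 * tr_zeta_pow n + a1 * tr_zeta_pow n.+1 + a2 * tr_zeta_pow n.+2 + a3 * tr_zeta_pow n.+3 + a4 * tr_zeta_pow n.+4 + a5 * tr_zeta_pow n.+4.+1)%:~R.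
Proof.
have -> : zeta_comb zeta a0 a1 a2 a3 a4 a5 * zeta ^+ n = a0%:~R * zeta ^+ n + a1%:~R * zeta ^+ n.+1 +
   a2%:~R * zeta ^+ n.+2 + a3%:~R * zeta ^+ n.+3 + a4%:~R * zeta ^+ n.+4 + a5%:~R * zeta ^+ n.+4.+1.
  by rewrite /zeta_comb !exprS; ring.
by rewrite !TrD !TrZ !Tr_zeta !intrD !intrM.
Qed.

Lemma Tr_Zin x : Zin x -> exists m : int, trF x = m%:~R.
Proof.
move=> [a0 [a1 [a2 [a3 [a4 [a5 ->]]]]]]; have := Tr_z6 a0 a1 a2 a3 a4 a5 0.
by rewrite expr0 mulr1 => ->; eexists.
Qed.

Lemma E_aint l x : aint x -> integralOver (intr : int -> C) (E l x).
Proof.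
move=> /(integral_rmorph (E l)) [P Pm Pr]; exists P => //.
by move: Pr; rewrite (eq_map_poly (g := (intr : int -> C))) // => m /=; rewrite rmorph_int.
Qed.

Lemma conj_aint (z : C) : integralOver (intr : int -> C) z -> integralOver (intr : int -> C) z^*.
Proof.
move=> /(integral_rmorph (@Num.conj C)) [P Pm Pr]; exists P => //.
by move: Pr; rewrite (eq_map_poly (g := (intr : int -> C))) // => m /=; rewrite rmorph_int.
Qed.

Lemma sum_aint (I : Type) (r : seq I) (f : I -> C) :
  (forall i, integralOver (intr : int -> C) (f i)) -> integralOver (intr : int -> C) (\sum_(i <- r) f i).
Proof.
move=> h; elim/big_ind: _ => //; first exact: mxpoly.integral0.
by move=> a b; apply: integral_add.
Qed.

Lemma Tr_rat x : exists N m : int, N != 0 /\ N%:~R * trF x = m%:~R.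
Proof.
have [N N0 /Tr_Zin[m hm]] := denZ hF x; exists N, m; split=> //.
by rewrite -TrZ.
Qed.

Lemma Tr_aint x : aint x -> exists m : int, trF x = m%:~R.
Proof.
move=> ax; have [N [m [N0 hm]]] := Tr_rat x.
apply: int_of_aint N0 hm _; apply: sum_aint => l.
by apply: integral_add; [|apply: conj_aint]; apply: E_aint.
Qed.

(** For a real algebraic integer the trace from F is twice the trace from K.
This parity makes theta_0 invariant under all translations by integers of K.
*)
Lemma Tr_even x : aint x -> conjF x = x -> exists m : int, trF x = (2 * m)%:~R.
Proof.
move=> ax cx; have [n hn] := Tr_aint ax.
have h2 : trF x = (2%:~R : C) * \sum_l E l x.
  rewrite /trF mulr_sumr; apply: eq_bigr => l _; rewrite -E_conj cx.
  by rewrite (_ : 2%:~R = 2%:R :> C) //; ring.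
have [m hm] : exists m : int, \sum_l E l x = m%:~R.
  apply: (@int_of_aint _ _ 2 n) => //; first by rewrite -h2.
  by apply: sum_aint => l; apply: E_aint.
by exists m; rewrite h2 hm intrM.
Qed.

Local Notation Pi := (1 - zeta).
Lemma Phi0 : zeta ^+ 6 + zeta ^+ 3 + 1 = 0.
Proof. by rewrite (zeta6 hF); ring. Qed.
(** Identities in Z[zeta] are checked by exhibiting a multiple of the
cyclotomic polynomial. *)
Lemma modPhi x y q : x - y = (zeta ^+ 6 + zeta ^+ 3 + 1) * q -> x = y.
Proof. by rewrite Phi0 mul0r => /eqP; rewrite subr_eq0 => /eqP. Qed.

Lemma ZinPi : Zin Pi.
Proof. by apply: ZinB; [exact: Zin1|exact: (Zin_zeta hF 1)]. Qed.

Lemma Pi_neq0 : Pi != 0.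
Proof.
rewrite subr_eq0 eq_sym; apply/eqP => h; have := zeta3 hF; by rewrite h expr1n eqxx.
Qed.

Lemma char0 (m : int) : m != 0 -> (m%:~R : F) != 0.
Proof. by move=> m0; rewrite -(fmorph_eq0 iota) rmorph_int intr_eq0. Qed.

Lemma three_neq0 : (3 : F) != 0.
Proof. exact: (@char0 3). Qed.

Definition einv : F := zeta_comb zeta 10 11 7 10 4 (-4).

(** 3 is totally ramified: einv is the unit 3 / (1 - zeta)^6, written on the
power basis. *)
Lemma three_Pi6 : (3 : F) = Pi ^+ 6 * einv.
Proof.
apply/esym; apply: (@modPhi _ _ (- 4%:R * zeta ^+ 5 + 28%:R * zeta ^+ 4 - 74%:R * zeta ^+ 3 + 91%:R * zeta ^+ 2 - 49%:R * zeta  + 7%:R)).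
rewrite /einv /zeta_comb; ring.
Qed.

Lemma Zin_einv : Zin einv. Proof. by exists 10, 11, 7, 10, 4, (-4). Qed.

(** Otherwise 1/3 would be an algebraic integer. *)
Lemma invPi_naint : ~ aint Pi^-1.
Proof.
move=> h; have h6 : aint (Pi ^+ 6)^-1 by rewrite -exprVn; exact: aintX.
pose e := zeta_comb zeta 0 (-2) 5 (-7) 5 (-2).
have e3 : (3 : F) * e = Pi ^+ 6.
  by apply/esym/(@modPhi _ _ 1); rewrite /e /zeta_comb; ring.
have a3 : aint (3 : F)^-1.
  have -> : (3 : F)^-1 = e * (Pi ^+ 6)^-1.
    rewrite -e3 invfM mulrCA mulfV ?mulr1 //.
    by apply/eqP => e0; move: e3; rewrite e0 mulr0 => /esym/eqP; rewrite expf_eq0 (negbTE Pi_neq0).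
  by apply: integral_mul => //; apply: (Zin_aint hF); exists 0, (-2), 5, (-7), 5, (-2).
have [||m hm] := @int_of_aint C (E 0 (3 : F)^-1) 3 1 isT.
- by rewrite fmorphV !rmorph_nat mulfV // pnatr_eq0.
- exact: E_aint.
move: hm; rewrite fmorphV rmorph_nat => /(congr1 (fun z => 3%:R * z)).
rewrite mulfV ?pnatr_eq0 // -[3%:R]/((3%:Z)%:~R) -intrM => /eqP.
by rewrite -[1]/(1%:~R) eqr_int => /eqP; lia.
Qed.

(** The residue field of 1 - zeta is F_3; residues are kept as integers, so
that they can be used in exponents. Only their class modulo 3 is determined.
*)
Definition residue (x : F) (a : int) := exists2 w, Zin w & x = a%:~R + Pi * w.

Lemma residue_Zin x a : residue x a -> Zin x.
Proof. by move=> [w wZ ->]; apply: ZinD; [exact: Zin_int|apply: (ZinM hF) => //; exact: ZinPi]. Qed.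
Lemma residueD x y a b : residue x a -> residue y b -> residue (x + y) (a + b).
Proof. by move=> [w wZ ->] [v vZ ->]; exists (w + v); [exact: ZinD|rewrite intrD; ring]. Qed.
Lemma residueZ m x a : residue x a -> residue (m%:~R * x) (m * a).
Proof. by move=> [w wZ ->]; exists (m%:~R * w); [exact: ZinMz|rewrite intrM; ring]. Qed.
Lemma residueN x a : residue x a -> residue (- x) (- a).
Proof. by move=> /(residueZ (-1)); rewrite mulrN1z !mulN1r. Qed.
Lemma residueM x y a b : residue x a -> residue y b -> residue (x * y) (a * b).
Proof.
move=> [w wZ ->] [v vZ ->]; exists (a%:~R * v + w * (b%:~R + Pi * v)).
  apply: ZinD; first exact: ZinMz.
  by apply: (ZinM hF) => //; apply: ZinD; [exact: Zin_int|apply: (ZinM hF) => //; exact: ZinPi].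
by rewrite intrM; ring.
Qed.
Lemma residue_int m : residue m%:~R m.
Proof. by exists 0; [exact: (Zin_int zeta 0)|rewrite mulr0 addr0]. Qed.
Lemma residue_zeta n : residue (zeta ^+ n) 1.
Proof.
elim: n => [|n IH]; first exact: (residue_int 1).
rewrite exprS -[1]mulr1; apply: residueM => //; exists (-1); last by ring.
by apply: ZinN; exact: Zin1.
Qed.
Lemma Zin_Res x : Zin x -> exists a, residue x a.
Proof.
move=> [a0 [a1 [a2 [a3 [a4 [a5 ->]]]]]].
exists (a0 * 1 + a1 * 1 + a2 * 1 + a3 * 1 + a4 * 1 + a5 * 1).
have h m n : residue (m%:~R * zeta ^+ n) (m * 1) by apply: residueZ; exact: residue_zeta.
have h0 : residue a0%:~R (a0 * 1) by rewrite mulr1; exact: residue_int.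
have h1 : residue (a1%:~R * zeta) (a1 * 1) by exact: (h a1 1%N).
by rewrite /zeta_comb; do 5 (apply: residueD; last by []).
Qed.
Lemma residue_3 m : residue 3 (3 * m) .
Proof.
have h : residue (3 : F) 0.
  exists (Pi ^+ 5 * einv); last by rewrite three_Pi6 add0r; ring.
  apply: (ZinM hF); [apply: (ZinX hF); exact: ZinPi|exact: Zin_einv].
have [w wZ e] := h; exists (w - (m%:~R) * w); first by apply: ZinB => //; exact: ZinMz.
rewrite e; have -> : (3 * m)%:~R = m%:~R * (Pi * w).
  by rewrite intrM mulrC; congr (_ * _); rewrite -[LHS]/(3 : F) e add0r.
by rewrite add0r; ring.
Qed.
Lemma residue_mod x a b : residue x a -> (exists m, b = a + 3 * m) -> residue x b.
Proof.
move=> hx [m ->]; rewrite -[x]addr0 -(subrr (3 : F)); apply: residueD => //.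
have := residueD (residue_3 m) (residueN (residue_3 0)); rewrite mulr0 oppr0 addr0 //.
Qed.

Lemma residue_aint x a : residue x a -> aint (x / Pi) -> exists m, a = 3 * m.
Proof.
move=> [w wZ ->] h; have ha : aint (a%:~R / Pi).
  have -> : a%:~R / Pi = (a%:~R + Pi * w) / Pi - w by field; exact: Pi_neq0.
  by apply: integral_sub => //; exact: (Zin_aint hF).
have h3 : aint (3 / Pi).
  have -> : 3 / Pi = Pi ^+ 5 * einv by rewrite three_Pi6; field; exact: Pi_neq0.
  apply: (Zin_aint hF); apply: (ZinM hF); [apply: (ZinX hF); exact: ZinPi|exact: Zin_einv].
have [a3|a3] := boolP (3 %| a)%Z; first by have /dvdzP[m ->] := a3; exists m; rewrite mulrC.
have co : coprimez a 3 by rewrite coprimez_sym coprimezE prime_coprime.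
have [[p q] /= pq] := coprimezP _ _ co; case: invPi_naint.
have -> : Pi^-1 = p%:~R * (a%:~R / Pi) + q%:~R * (3 / Pi).
  rewrite !mulrA -mulrDl -[3]/((3%:Z)%:~R) -!intrM -intrD pq mul1r //.
by apply: integral_add; apply: integral_mul => //; exact: aint_int.
Qed.

Lemma residue_uniq x a b : residue x a -> residue x b -> exists m, b = a + 3 * m.
Proof.
move=> ha hb; have := residueD hb (residueN ha); rewrite subrr => h0.
have [|m hm] := residue_aint h0; first by rewrite mul0r; exact: mxpoly.integral0.
by exists m; lia.
Qed.

(** The residue of y vanishes when y / (1 - zeta) is integral, and then one
factor 1 - zeta can be taken out of y within Z[zeta]. *)
Lemma Zin_divPi y : Zin y -> aint (y / Pi) -> Zin (y / Pi).
Proof.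
move=> /Zin_Res[a ha] h; have [m hm] := residue_aint ha h.
have [w wZ ->] := ha; rewrite hm.
have -> : ((3 * m)%:~R + Pi * w) / Pi = m%:~R * (Pi ^+ 5 * einv) + w.
  by rewrite intrM -[3%:~R]/(3 : F) three_Pi6; field; exact: Pi_neq0.
apply: ZinD => //; apply: ZinMz; apply: (ZinM hF); [apply: (ZinX hF); exact: ZinPi|exact: Zin_einv].
Qed.

Lemma Zin_div3 y : Zin y -> aint (y / 3) -> Zin (y / 3).
Proof.
move=> yZ h; pose e := zeta_comb zeta 0 (-2) 5 (-7) 5 (-2).
have eZ : Zin e by exists 0, (-2), 5, (-7), 5, (-2).
have e3 : (3 : F) * e = Pi ^+ 6 by apply/esym/(@modPhi _ _ 1); rewrite /e /zeta_comb; ring.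
suff H n : (n <= 6)%N -> Zin (y / Pi ^+ n).
  have -> : y / 3 = y / Pi ^+ 6 * e.
    rewrite -e3; field; rewrite three_neq0 /= andbT.
    by apply/eqP => e0; move: e3; rewrite e0 mulr0 => /esym/eqP; rewrite expf_eq0 (negbTE Pi_neq0).
  by apply: (ZinM hF) => //; exact: H.
elim: n => [|n IH] n6; first by rewrite expr0 divr1.
have -> : y / Pi ^+ n.+1 = y / Pi ^+ n / Pi by rewrite exprSr invfM mulrA.
apply: Zin_divPi; first by apply: IH; exact: ltnW.
have -> : y / Pi ^+ n / Pi = y / 3 * (Pi ^+ (6 - n.+1) * einv).
  rewrite {1}three_Pi6 -(subnK n6) addnK exprD exprSr.
  field; rewrite !expf_neq0 ?Pi_neq0 //= andbT.
  by apply/eqP => e0; have := three_neq0; rewrite three_Pi6 e0 mulr0 eqxx.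
apply: integral_mul => //; apply: (Zin_aint hF); apply: (ZinM hF); last exact: Zin_einv.
by apply: (ZinX hF); exact: ZinPi.
Qed.

(** Traces against powers of zeta show that 9 x is in Z[zeta]; since 9 is a
power of 1 - zeta up to a unit, Zin_div3 removes it. *)
Lemma Zin_of_aint x : aint x -> Zin x.
Proof.
move=> ax; have [N N0 [a0 [a1 [a2 [a3 [a4 [a5 ex]]]]]]] := denZ hF x.
have ht n : exists m : int, N * m = a0 * tr_zeta_pow n + a1 * tr_zeta_pow n.+1 + a2 * tr_zeta_pow n.+2 + a3 * tr_zeta_pow n.+3 + a4 * tr_zeta_pow n.+4 + a5 * tr_zeta_pow n.+4.+1.
  have [|m hm] := @Tr_aint (x * zeta ^+ n).
    by apply: integral_mul => //; apply: (Zin_aint hF); exact: (Zin_zeta hF).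
  exists m; apply: (@intr_inj C); rewrite intrM -hm -TrZ mulrA ex; exact: Tr_z6.
(* the traces against zeta^9, ..., zeta^4 determine 9 x *)
have [m0 e0] := ht 9%N; have [m1 e1] := ht 8%N; have [m2 e2] := ht 7%N.
have [m3 e3] := ht 6%N; have [m4 e4] := ht 5%N; have [m5 e5] := ht 4%N.
rewrite /tr_zeta_pow /= in e0 e1 e2 e3 e4 e5.
have Z9 : Zin (9%:~R * x).
  exists (2 * m0 + m3), (2 * m1 + m4), (2 * m2 + m5), (2 * m3 + m0), (2 * m4 + m1), (2 * m5 + m2).
  apply: (mulfI (char0 N0)); rewrite mulrCA ex /zeta_comb.
  have f0 : N * (2 * m0 + m3) = 9 * a0 by lia.
  have f1 : N * (2 * m1 + m4) = 9 * a1 by lia.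
  have f2 : N * (2 * m2 + m5) = 9 * a2 by lia.
  have f3 : N * (2 * m3 + m0) = 9 * a3 by lia.
  have f4 : N * (2 * m4 + m1) = 9 * a4 by lia.
  have f5 : N * (2 * m5 + m2) = 9 * a5 by lia.
  by rewrite !mulrDr !mulrA -!intrM f0 f1 f2 f3 f4 f5.
have h3 : 9%:~R = (3 : F) * 3 by rewrite -[3]/((3%:Z)%:~R) -intrM.
have Z3 : Zin (3 * x).
  have -> : 3 * x = (9%:~R * x) / 3 by rewrite h3; field; exact: three_neq0.
  apply: Zin_div3 => //; have -> : (9%:~R * x) / 3 = 3 * x by rewrite h3; field; exact: three_neq0.
  by apply: integral_mul => //; exact: (aint_int F 3).
have -> : x = (3 * x) / 3 by field; exact: three_neq0.
by apply: Zin_div3 => //; have -> : (3 * x) / 3 = x by field; exact: three_neq0.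
Qed.

Lemma ZinE x : ringOfIntegersF x <-> Zin x.
Proof. by split; [exact: Zin_of_aint|exact: (Zin_aint hF)]. Qed.

(** Polynomials in zeta as lists of coefficients, from the exponent n on;
their traces are computed by tr_zeta_poly, so that divisibility of traces can
be decided by evaluation. *)
Fixpoint zeta_poly (s : seq int) (n : nat) : F :=
  if s is a :: s' then a%:~R * zeta ^+ n + zeta_poly s' n.+1 else 0.
Fixpoint tr_zeta_poly (s : seq int) (n : nat) : int :=
  if s is a :: s' then a * tr_zeta_pow n + tr_zeta_poly s' n.+1 else 0.

Lemma Tr_ev s n : trF (zeta_poly s n) = (tr_zeta_poly s n)%:~R.
Proof.
elim: s n => [|a s IH] n /=; first by rewrite Tr0.
by rewrite TrD TrZ Tr_zeta IH intrD intrM.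
Qed.

Lemma ev_mulz s m n : zeta_poly s m * zeta ^+ n = zeta_poly s (m + n).
Proof.
elim: s m => [|a s IH] m /=; first by rewrite mul0r.
by rewrite mulrDl IH -mulrA -exprD addSn.
Qed.

Lemma tev_mod s m n : m = n %[mod 9] -> tr_zeta_poly s m = tr_zeta_poly s n.
Proof.
elim: s m n => [//|a s IH] m n e /=; congr (a * _ + _).
  have t k' : tr_zeta_pow k' = tr_zeta_pow (k' %% 9) by rewrite /tr_zeta_pow modn_mod modn_dvdm.
  by rewrite t e -t.
by apply: IH; rewrite -[m.+1]addn1 -[n.+1]addn1 -modnDml e modnDml.
Qed.

Definition div9 (s : seq int) := all (fun n => (9 %| tr_zeta_poly s n)%Z) (seq.iota 0 9).

Lemma div9P s : div9 s -> forall n, exists m, tr_zeta_poly s n = 9 * m.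
Proof.
move=> /allP h n; rewrite -(tev_mod s (modn_mod n 9)).
have /dvdzP[m ->] : (9 %| tr_zeta_poly s (n %% 9))%Z by apply: h; rewrite mem_iota /= ltn_pmod.
by exists m; rewrite mulrC.
Qed.

Lemma Tr_div9 s y : div9 s -> Zin y -> exists m : int, trF (zeta_poly s 0 * y) = (9 * m)%:~R.
Proof.
move=> /div9P h [a0 [a1 [a2 [a3 [a4 [a5 ->]]]]]].
have [m0 e0] := h 0%N; have [m1 e1] := h 1%N; have [m2 e2] := h 2%N.
have [m3 e3] := h 3%N; have [m4 e4] := h 4%N; have [m5 e5] := h 5%N.
exists (a0 * m0 + a1 * m1 + a2 * m2 + a3 * m3 + a4 * m4 + a5 * m5).
have -> : zeta_poly s 0 * zeta_comb zeta a0 a1 a2 a3 a4 a5 = a0%:~R * (zeta_poly s 0 * zeta ^+ 0) + a1%:~R * (zeta_poly s 0 * zeta ^+ 1) +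
  a2%:~R * (zeta_poly s 0 * zeta ^+ 2) + a3%:~R * (zeta_poly s 0 * zeta ^+ 3) + a4%:~R * (zeta_poly s 0 * zeta ^+ 4) + a5%:~R * (zeta_poly s 0 * zeta ^+ 5).
  by rewrite /zeta_comb expr0 expr1; ring.
rewrite !ev_mulz !add0n !TrD !TrZ !Tr_ev e0 e1 e2 e3 e4 e5 -!intrM -!intrD.
by congr (_%:~R); ring.
Qed.

Lemma Tr_conj x : trF (conjF x) = trF x.
Proof. by rewrite /trF; apply: eq_bigr => l _; rewrite E_conj conjCK addrC. Qed.

Lemma conj_zeta_n i j : (i + j = 18)%N -> conjF (zeta ^+ i) = zeta ^+ j.
Proof.
move=> ij; rewrite conjFX (conjF_zeta hF) exprVn; apply: (mulfI (expf_neq0 i (zeta_neq0 hF))).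
by rewrite mulfV ?expf_neq0 ?(zeta_neq0 hF) // -exprD ij (_ : 18 = 9 * 2)%N // exprM (zeta9 hF) expr1n.
Qed.

Lemma zeta_int (m : int) (n : nat) (q : int) : n%:Z = m + 9 * q -> zeta ^ m = zeta ^+ n.
Proof.
move=> e; rewrite exprnP e expfzDr ?(zeta_neq0 hF) // -exprz_exp -exprnP (zeta9 hF) exp1rz mulr1 //.
Qed.

(** By dualE the dual lattice is 3^-1 (1 - zeta^4) Z[zeta]; the residue is
that of the factor in Z[zeta]. *)
Definition dual_residue (x : F) (a : int) := exists2 y, residue y a & x = 3^-1 * (1 - zeta ^+ 4) * y.

Lemma dual_residueD x y a b : dual_residue x a -> dual_residue y b -> dual_residue (x + y) (a + b).
Proof. by move=> [v hv ->] [w hw ->]; exists (v + w); [exact: residueD|rewrite [RHS]mulrDr]. Qed.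
Lemma dual_residueZ m x a : dual_residue x a -> dual_residue (m%:~R * x) (m * a).
Proof. by move=> [v hv ->]; exists (m%:~R * v); [exact: residueZ|rewrite mulrCA]. Qed.
Lemma dual_residueN x a : dual_residue x a -> dual_residue (- x) (- a).
Proof. by move=> /(dual_residueZ (-1)); rewrite mulrN1z !mulN1r. Qed.
Lemma dual_residue_mod x a b : dual_residue x a -> (exists m, b = a + 3 * m) -> dual_residue x b.
Proof. by move=> [v hv ->] h; exists v => //; apply: residue_mod hv h. Qed.
Lemma dual_residue0 : dual_residue 0 0.
Proof. by exists 0; [exact: (residue_int 0)|rewrite mulr0]. Qed.

Lemma z4_neq0 : 1 - zeta ^+ 4 != 0.
Proof.
rewrite subr_eq0 eq_sym; apply/eqP => h; have := zeta3 hF.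
have -> : zeta ^+ 3 = 1; last by rewrite eqxx.
have e : zeta ^+ 12 = 1 by rewrite (_ : 12 = 4 * 3)%N // exprM h expr1n.
by move: e; rewrite (_ : 12 = 9 + 3)%N // exprD (zeta9 hF) mul1r.
Qed.

Lemma dual_residue_uniq x a b : dual_residue x a -> dual_residue x b -> exists m, b = a + 3 * m.
Proof.
move=> [v hv ->] [w hw e]; apply: residue_uniq hv _.
suff -> : v = w by [].
by apply: (mulfI _ e); rewrite mulf_neq0 ?invr_eq0 ?three_neq0 ?z4_neq0.
Qed.

(** Lambda is the index 3 subgroup of residue 0, since (1 - zeta^4)(1 - zeta)
and (1 - zeta)(1 - zeta^-1) differ by a unit. *)
Lemma Lambda_residue x : Lambda zeta x <-> dual_residue x 0.
Proof.
have z0 := zeta_neq0 hF.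
have z8 : zeta^-1 = zeta ^+ 8 := zetaV hF.
split=> [[y /ZinE yZ <-]|[_ [w wZ ->] ->]].
  exists (Pi * (- zeta ^+ 8 * (- zeta - zeta ^+ 5) * y)).
    exists (- zeta ^+ 8 * (- zeta - zeta ^+ 5) * y); last by rewrite add0r.
    apply: (ZinM hF) => //; apply: (ZinM hF); first by apply: ZinN; exact: (Zin_zeta hF).
    by apply: ZinB; [apply: ZinN; exact: (Zin_zeta hF 1)|exact: (Zin_zeta hF)].
  rewrite z8.
  have e1 : 1 - zeta = (1 - zeta ^+ 4) * (- zeta - zeta ^+ 5).
    have e9 := zeta9 hF; have -> : (1 - zeta ^+ 4) * (- zeta - zeta ^+ 5) = zeta ^+ 9 - zeta by ring.
    by rewrite e9.
  have e2 : 1 - zeta ^+ 8 = (1 - zeta) * (- zeta ^+ 8).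
    by rewrite -{1}(zeta9 hF); ring.
  rewrite e2 -!mulrA; congr (_ * _); rewrite {1}e1; ring.
exists (- zeta * (1 + zeta + zeta ^+ 2 + zeta ^+ 3) * w).
  apply/ZinE; apply: (ZinM hF) => //; apply: (ZinM hF); first by apply: ZinN; exact: (Zin_zeta hF 1).
  by do !apply: ZinD; [exact: Zin1|exact: (Zin_zeta hF 1)|exact: (Zin_zeta hF)|exact: (Zin_zeta hF)].
by field; rewrite z0 three_neq0.
Qed.

(** fdual j = 3^-1 (1 - zeta^4) fdual_num j, with nonnegative exponents
(zeta^9 = 1). *)
Definition fdual_num (j : 'I_6) : F := if (j < 3)%N then zeta ^+ (j + 7) else zeta ^+ (j + 7) + zeta ^+ (j + 4).

Lemma fdualE j : fdual zeta j = 3^-1 * (1 - zeta ^+ 4) * fdual_num j.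
Proof.
rewrite /fdual /fdual_num.
have e1 : zeta ^ (j.+1%:Z - 3) = zeta ^+ (j + 7) by apply: (@zeta_int _ _ 1); lia.
have e2 : zeta ^ (j.+1%:Z - 6) = zeta ^+ (j + 4) by apply: (@zeta_int _ _ 1); lia.
by rewrite e1 e2.
Qed.

Lemma dual_residue_fdual j : dual_residue (fdual zeta j) (if (j < 3)%N then 1 else 2).
Proof.
rewrite fdualE; exists (fdual_num j) => //; rewrite /fdual_num; case: ifP => _; first exact: residue_zeta.
by apply: (residueD (a := 1) (b := 1)); exact: residue_zeta.
Qed.

(** The basis f_(i+1) of Lambda, dual to fdual. *)
Definition fbasis (i : 'I_6) : F := 3^-1 * (1 - zeta) * (1 - zeta ^+ 2) * zeta ^+ i.

Lemma fb_Lambda i : Lambda zeta (fbasis i).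
Proof.
exists ((- zeta - zeta ^+ 2) * zeta ^+ i).
  apply/ZinE; apply: (ZinM hF); last exact: (Zin_zeta hF).
  by apply: ZinB; [apply: ZinN; exact: (Zin_zeta hF 1)|exact: (Zin_zeta hF)].
rewrite /fbasis !mulrA; congr (_ * _); have z0 := zeta_neq0 hF; field.
by rewrite z0 three_neq0.
Qed.

(** The coefficients of (1 - zeta)(1 - zeta^2)(1 - zeta^5), to which nine
times the pairings reduce. *)
Definition pair_seq : seq int := [:: 1; -1; -1; 1; 0; -1; 1; 1; -1].

Definition pairN (i j : nat) : int :=
  tr_zeta_poly pair_seq (i + (11 - j)) + (if (j < 3)%N then 0 else tr_zeta_poly pair_seq (i + (14 - j))).

Lemma pairN_delta (i j : 'I_6) : pairN i j = 9 * (i == j)%:Z.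
Proof.
have h : all (fun i => all (fun j => pairN i j == 9 * (i == j)%:Z) (seq.iota 0 6)) (seq.iota 0 6).
  by vm_compute.
have io (n : 'I_6) : (n : nat) \in seq.iota 0 6 by rewrite mem_iota /= ltn_ord.
by have /eqP := allP (allP h _ (io i)) _ (io j).
Qed.

Lemma Tr_pair i j : trF (fbasis i * conjF (fdual zeta j)) = (i == j)%:R.
Proof.
have hc (y : F) : conjF (3^-1 * (1 - zeta ^+ 4) * y) = 3^-1 * (1 - zeta ^+ 5) * conjF y.
  rewrite !conjFM conjFV conjFB conjF1 (_ : (3 : F) = 3%:~R) // conjF_int.
  by rewrite (@conj_zeta_n 4 14) // (_ : 14 = 9 + 5)%N // exprD (zeta9 hF) mul1r.
have h9 : 9%:~R * (fbasis i * conjF (fdual zeta j)) =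
  zeta_poly pair_seq (i + (11 - j)) + (if (j < 3)%N then 0 else zeta_poly pair_seq (i + (14 - j))).
  rewrite -[(i + (11 - j))%N]add0n -[(i + (14 - j))%N]add0n -!ev_mulz !exprD.
  have -> : conjF (fdual zeta j) = 3^-1 * (1 - zeta ^+ 5) * (zeta ^+ (11 - j) + (if (j < 3)%N then 0 else zeta ^+ (14 - j))).
    have lj := ltn_ord j; rewrite fdualE hc /fdual_num; congr (_ * _); case: ifP => _.
      by rewrite addr0 (@conj_zeta_n _ (11 - j)) //; lia.
    by rewrite conjFD (@conj_zeta_n _ (11 - j)) ?(@conj_zeta_n _ (14 - j)) //; lia.
  have eD : zeta_poly pair_seq 0 = (1 - zeta) * (1 - zeta ^+ 2) * (1 - zeta ^+ 5).
    by rewrite /zeta_poly /pair_seq !(mulrN1z, mulr1z, mulr0z); ring.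
  rewrite eD /fbasis (_ : (9%:~R : F) = 3 * 3); last by rewrite -[9%:~R]/(9 : F); ring.
  by case: ifP => _; field; exact: three_neq0.
have C9 : (9%:~R : C) != 0 by rewrite intr_eq0.
apply: (mulfI C9); rewrite -TrZ h9.
have -> : (i == j)%:R = ((i == j)%:Z)%:~R :> C by [].
rewrite -intrM -pairN_delta /pairN TrD Tr_ev intrD; congr (_ + _).
by case: ifP => _; rewrite ?Tr0 ?Tr_ev.
Qed.

Hypothesis Etr : forall x, iota (galTrace 1 fullv x) = trF x.

Lemma Zin_conj x : Zin x -> Zin (conjF x).
Proof.
move=> [a0 [a1 [a2 [a3 [a4 [a5 ->]]]]]]; rewrite /zeta_comb -[X in conjF (_ + _ * X + _ + _ + _ + _)]expr1.
rewrite !conjFD !(conjFM _%:~R) !conjF_int (@conj_zeta_n 1 17) // (@conj_zeta_n 2 16) //.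
rewrite (@conj_zeta_n 3 15) // (@conj_zeta_n 4 14) // (@conj_zeta_n 5 13) //.
by do !apply: ZinD; try exact: Zin_int; apply: ZinMz; exact: (Zin_zeta hF).
Qed.

Lemma residue_conj x a : residue x a -> residue (conjF x) a.
Proof.
move=> [w wZ ->]; exists (- zeta ^+ 8 * conjF w).
  by apply: (ZinM hF); [apply: ZinN; exact: (Zin_zeta hF)|exact: Zin_conj].
rewrite conjFD conjF_int conjFM conjFB conjF1 (conjF_zeta hF) (zetaV hF) mulrA; congr (_ + _ * _).
by rewrite -{1}(zeta9 hF); ring.
Qed.

Lemma conj3 : conjF 3^-1 = 3^-1.
Proof. by rewrite conjFV (_ : (3 : F) = 3%:~R) // conjF_int. Qed.

Lemma conj_z4 : conjF (1 - zeta ^+ 4) = 1 - zeta ^+ 5.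
Proof. by rewrite conjFB conjF1 (@conj_zeta_n 4 14) // (_ : 14 = 9 + 5)%N // exprD (zeta9 hF) mul1r. Qed.

Lemma C9 : (9%:~R : C) != 0. Proof. by rewrite intr_eq0. Qed.

(** The list consists of the coefficients of (1 - zeta^4)(2 - zeta - zeta^8),
where 2 - zeta - zeta^8 = (1 - zeta)(1 - zeta^-1). *)
Lemma Tr_DL x y a : dual_residue x a -> Lambda zeta y -> exists m : int, trF (x * conjF y) = m%:~R.
Proof.
move=> [v hv ->] [w /ZinE wZ <-].
have [|m hm] := @Tr_div9 [:: 2;-1;0;0;-2;1;0;0;-1;0;0;0;1] (v * conjF w) isT.
  by apply: (ZinM hF); [exact: residue_Zin hv|exact: Zin_conj].
exists m; apply: (mulfI C9); rewrite -TrZ -intrM -hm; congr trF.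
rewrite !conjFM !conjFB conj3 conjF1 conjFV (conjF_zeta hF) invrK (zetaV hF) /zeta_poly.
rewrite !(mulrN1z, mulr1z, mulr0z) (_ : (9%:~R : F) = 3 * 3); last by rewrite -[9%:~R]/(9 : F); ring.
have e9 : ((1 : F) - zeta ^+ 8) * (1 - zeta) = 2 - zeta - zeta ^+ 8.
  have -> : (2 : F) = 1 + zeta ^+ 9 by rewrite (zeta9 hF).
  by ring.
rewrite -(mulrA 3^-1 (1 - zeta ^+ 8)) e9.
by field; exact: three_neq0.
Qed.

Lemma dual_of_D x a : dual_residue x a -> dualLambda iota zeta x.
Proof.
move=> hx y /(Tr_DL hx)[m hm]; exists m; apply: (fmorph_inj iota).
by rewrite Etr hm rmorph_int.
Qed.

Definition emb_basis (i : 'I_6) l : C := E l (fbasis i).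
Definition emb_basisC (i : 'I_6) l : C := (emb_basis i l)^*.
Definition emb_dual (i : 'I_6) l : C := E l (fdual zeta i).
Definition emb_dualC (i : 'I_6) l : C := (emb_dual i l)^*.

Lemma pair1 i j : \sum_l (emb_basis i l * emb_dualC j l + emb_basisC i l * emb_dual j l) = (i == j)%:R.
Proof.
rewrite -Tr_pair /trF; apply: eq_bigr => l _.
rewrite rmorphM E_conj [(_ * _)^*]rmorphM /= conjCK //.
Qed.

(** The duality of the two bases says that two 6 x 6 matrices are inverse on
one side; these are the relations on the other side. *)
Lemma pair2 : [/\ forall l l', \sum_i emb_basis i l * emb_dualC i l' = (l == l')%:R,
  forall l l', \sum_i emb_basisC i l * emb_dual i l' = (l == l')%:R,
  forall l l', \sum_i emb_basis i l * emb_dual i l' = 0 &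
  forall l l', \sum_i emb_basisC i l * emb_dualC i l' = 0].
Proof.
pose A : 'M[C]_(6, 3 + 3) := \matrix_(i < 6, j < 3 + 3) match fintype.split j with inl l => emb_basis i l | inr l => emb_basisC i l end.
pose B : 'M[C]_(3 + 3, 6) := \matrix_(j < 3 + 3, i < 6) match fintype.split j with inl l => emb_dualC i l | inr l => emb_dual i l end.
have AB : A *m B = 1%:M.
  apply/matrixP => i j; rewrite mxE [RHS]mxE -pair1 big_split_ord /= big_split /=.
  congr (_ + _); apply: eq_bigr => l _; rewrite !mxE.
    by rewrite (unsplitK (inl l)).
  by rewrite (unsplitK (inr l)).
have BA : B *m A = 1%:M := mulmx1C AB.
have h (j j' : 'I_3 + 'I_3) :
  \sum_i match j with inl l => emb_basis i l | inr l => emb_basisC i l end * match j' with inl l => emb_dualC i l | inr l => emb_dual i l end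
   = (j' == j)%:R.
  have /matrixP/(_ (fintype.unsplit j') (fintype.unsplit j)) := BA.
  rewrite !mxE (can_eq (@unsplitK 3 3)) => <-.
  by apply: eq_bigr => i _; rewrite !mxE !unsplitK mulrC.
split=> l l'.
- by rewrite (h (inl l) (inl l')) eq_sym.
- by rewrite (h (inr l) (inr l')) eq_sym.
- by rewrite (h (inl l) (inr l')).
- by rewrite (h (inr l) (inl l')).
Qed.

Definition comb_basis (c : {ffun 'I_6 -> int}) : F := \sum_i (c i)%:~R * fbasis i.
Definition comb_dual (c : {ffun 'I_6 -> int}) : F := \sum_i (c i)%:~R * fdual zeta i.

Lemma E_comb l c : E l (comb_basis c) = \sum_i (c i)%:~R * emb_basis i l.
Proof. by rewrite rmorph_sum; apply: eq_bigr => i _; rewrite rmorphM rmorph_int. Qed.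
Lemma E_combD l c : E l (comb_dual c) = \sum_i (c i)%:~R * emb_dual i l.
Proof. by rewrite rmorph_sum; apply: eq_bigr => i _; rewrite rmorphM rmorph_int. Qed.

(** Expansion of x on the dual basis; both sides agree under one embedding. *)
Lemma expD x (c : {ffun 'I_6 -> int}) : (forall i, trF (x * conjF (fbasis i)) = (c i)%:~R) -> x = comb_dual c.
Proof.
have [_ Hqp Hpp _] := pair2.
move=> hc; apply: (fmorph_inj (E 0)); rewrite E_combD.
rewrite (eq_bigr (fun i => \sum_l (E l x * (emb_basisC i l * emb_dual i 0) + (E l x)^* * (emb_basis i l * emb_dual i 0)))); last first.
  move=> i _; rewrite -hc /trF mulr_suml; apply: eq_bigr => l _.
  by rewrite !rmorphM /= E_conj conjCK -/(emb_basis i l) -/(emb_basisC i l); ring.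
rewrite exchange_big /= (bigD1 0) //= big_split /= -!mulr_sumr Hqp Hpp eqxx mulr0 addr0 mulr1.
rewrite big1 ?addr0 // => l l0; rewrite big_split /= -!mulr_sumr Hqp Hpp (negbTE l0) !mulr0 addr0 //.
Qed.

Lemma expL x (c : {ffun 'I_6 -> int}) : (forall i, trF (x * conjF (fdual zeta i)) = (c i)%:~R) -> x = comb_basis c.
Proof.
have [Hpq _ Hpp _] := pair2.
move=> hc; apply: (fmorph_inj (E 0)); rewrite E_comb.
rewrite (eq_bigr (fun i => \sum_l (E l x * (emb_basis i 0 * emb_dualC i l) + (E l x)^* * (emb_basis i 0 * emb_dual i l)))); last first.
  move=> i _; rewrite -hc /trF mulr_suml; apply: eq_bigr => l _.
  by rewrite !rmorphM /= E_conj conjCK -/(emb_dual i l) -/(emb_dualC i l); ring.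
rewrite exchange_big /= (bigD1 0) //= big_split /= -!mulr_sumr Hpq Hpp eqxx mulr0 addr0 mulr1.
rewrite big1 ?addr0 // => l l0; rewrite big_split /= -!mulr_sumr Hpq Hpp eq_sym (negbTE l0) !mulr0 addr0 //.
Qed.

Lemma Tr_sum (f : 'I_6 -> F) : trF (\sum_i f i) = \sum_i trF (f i).
Proof. by elim/big_ind2: _ => [|a b c d <- <-|//]; [exact: Tr0|exact: TrD]. Qed.

Lemma combL_coord c j : trF (comb_basis c * conjF (fdual zeta j)) = (c j)%:~R.
Proof.
rewrite mulr_suml Tr_sum (bigD1 j) //= -mulrA TrZ Tr_pair eqxx mulr1 big1 ?addr0 // => i ij.
by rewrite -mulrA TrZ Tr_pair (negbTE ij) mulr0.
Qed.

Lemma combD_coord c j : trF (comb_dual c * conjF (fbasis j)) = (c j)%:~R.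
Proof.
have h i : trF (fdual zeta i * conjF (fbasis j)) = (j == i)%:R.
  by rewrite -Tr_conj conjFM conjFK mulrC Tr_pair.
rewrite mulr_suml Tr_sum (bigD1 j) //= -mulrA TrZ h eqxx mulr1 big1 ?addr0 // => i ij.
by rewrite -mulrA TrZ h eq_sym (negbTE ij) mulr0.
Qed.

Lemma combL_inj : injective comb_basis.
Proof. by move=> c d e; apply/ffunP => j; apply: (@intr_inj C); rewrite -!combL_coord e. Qed.
Lemma combD_inj : injective comb_dual.
Proof. by move=> c d e; apply/ffunP => j; apply: (@intr_inj C); rewrite -!combD_coord e. Qed.

Lemma dual_residue_sum (c : {ffun 'I_6 -> int}) (f : 'I_6 -> F) (r : 'I_6 -> int) :
  (forall i, dual_residue (f i) (r i)) -> dual_residue (\sum_i (c i)%:~R * f i) (\sum_i c i * r i).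
Proof. by move=> h; elim/big_ind2: _ => [|a b x y|i _]; [exact: dual_residue0|exact: dual_residueD|exact: dual_residueZ]. Qed.

Lemma combL_Lambda c : Lambda zeta (comb_basis c).
Proof.
apply/Lambda_residue; have := @dual_residue_sum c fbasis (fun=> 0) (fun i => (Lambda_residue _).1 (fb_Lambda i)).
rewrite [X in dual_residue _ X]big1; last by move=> i _; rewrite mulr0.
exact.
Qed.

Lemma Lambda_comb x : Lambda zeta x -> exists c, x = comb_basis c.
Proof.
move=> hx; have /choice[c hc] i : exists m : int, trF (x * conjF (fdual zeta i)) = m%:~R.
  have [m hm] := Tr_DL (dual_residue_fdual i) hx; exists m.
  by rewrite -hm -Tr_conj conjFM conjFK mulrC.
by exists [ffun i => c i]; apply: expL => i; rewrite ffunE.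
Qed.

Definition res_coords (c : {ffun 'I_6 -> int}) : int := \sum_i c i * (if (i < 3)%N then 1 else 2).

Lemma combD_D c : dual_residue (comb_dual c) (res_coords c).
Proof. exact: dual_residue_sum dual_residue_fdual. Qed.

Lemma dual_comb x : dualLambda iota zeta x -> exists c, x = comb_dual c.
Proof.
move=> hx; have /choice[c hc] i : exists m : int, trF (x * conjF (fbasis i)) = m%:~R.
  have [m hm] := hx _ (fb_Lambda i); exists m.
  by rewrite -Etr hm rmorph_int.
by exists [ffun i => c i]; apply: expD => i; rewrite ffunE.
Qed.

Lemma dualE x : dualLambda iota zeta x <-> exists a, dual_residue x a.
Proof.
split=> [/dual_comb[c ->]|[a]]; last exact: dual_of_D.
by exists (res_coords c); exact: combD_D.
Qed.

Lemma F3_3 (m : int) : (3 * m)%:~R = 0 :> 'F_3.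
Proof. by rewrite intrM (_ : 3%:~R = 0 :> 'F_3) ?mul0r //; apply/eqP. Qed.

Lemma dual_residue_F3 x a b : dual_residue x a -> dual_residue x b -> a%:~R = b%:~R :> 'F_3.
Proof. by move=> ha hb; have [m ->] := dual_residue_uniq ha hb; rewrite intrD F3_3 addr0. Qed.

(** The coordinates of x on fdual are unique, and the residue of fdual j is 1
for the first three vectors and 2, that is -1, for the last three. *)
Lemma rhoE x a : dual_residue x a -> rho zeta x = a%:~R.
Proof.
move=> hx; rewrite /rho /fdual_coords; case: xgetP => [c _ /= ex|/= ne]; last first.
  have [c ec] := dual_comb (dual_of_D hx).
  case: (ne (\row_j c j)); rewrite ec /comb_dual /=; apply: eq_bigr => j _; by rewrite mxE.
pose d : {ffun 'I_6 -> int} := [ffun j => c 0 j].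
have hd : dual_residue x (res_coords d).
  by have := combD_D d; rewrite /comb_dual (eq_bigr (fun j => (c 0 j)%:~R * fdual zeta j)) -?ex // => j _; rewrite ffunE.
rewrite (dual_residue_F3 hx hd).
have -> : res_coords d = \sum_(j < 6 | (j < 3)%N) c 0 j + (\sum_(j < 6 | (3 <= j)%N) c 0 j) * 2.
  rewrite /res_coords (bigID (fun j : 'I_6 => (j < 3)%N)) /= mulr_suml; congr (_ + _).
    by apply: eq_bigr => j ->; rewrite ffunE mulr1.
  by apply: eq_big => j; rewrite -leqNgt // => /leq_gtF ->; rewrite ffunE.
set S1 := \sum_(i < 6 | _) _; set S2 := \sum_(i < 6 | _) _.
have -> : S1 + S2 * 2 = S1 - S2 + 3 * S2 by ring.
by rewrite [RHS]intrD F3_3 addr0.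
Qed.

(** Write x = 3^-1 (1 - zeta^4) y, so that nine times the trace is Tr(lam U)
with U = be y ybar of residue r = b a^2 and lam = (1 - zeta^4)(1 - zeta^5). As
Tr(lam) = 12 and Tr(lam (1 - zeta) w) is divisible by 9, this is 12 r + 9 m;
Tr_even makes m even. *)
Lemma Tr_quad x a be b : dual_residue x a -> ringOfIntegersK zeta be -> residue be b ->
  exists m : int, 9 * trF (be * (x * conjF x)) = (12 * (b * a * a) + 18 * m)%:~R.
Proof.
move=> [y hy ->] [bK bI] hb; set r := b * a * a.
pose U := be * y * conjF y.
pose lam := 2 - zeta ^+ 4 - zeta ^+ 5.
have hU : residue U r by apply: residueM; [exact: residueM|exact: residue_conj].
have e : 9%:~R * (be * (3^-1 * (1 - zeta ^+ 4) * y * conjF (3^-1 * (1 - zeta ^+ 4) * y))) = lam * U.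
  rewrite !conjFM conj3 conj_z4 (_ : (9%:~R : F) = 3 * 3); last by rewrite -[9%:~R]/(9 : F); ring.
  have -> : lam = (1 - zeta ^+ 4) * (1 - zeta ^+ 5).
    have e9 := zeta9 hF; have -> : (1 - zeta ^+ 4) * (1 - zeta ^+ 5) = 1 + zeta ^+ 9 - zeta ^+ 4 - zeta ^+ 5 by ring.
    by rewrite e9 /lam; ring.
  by rewrite /U; field; exact: three_neq0.
have [w wZ eU] := hU.
have [m hm] := @Tr_div9 [:: 2;-2;0;0;-1;0;1] w isT wZ.
have e1 : trF (lam * U) = (12 * r + 9 * m)%:~R.
  have -> : lam * U = r%:~R * lam + zeta_poly [:: 2;-2;0;0;-1;0;1] 0 * w.
    rewrite eU /lam /zeta_poly !(mulrN1z, mulr1z, mulr0z) (_ : (-2)%:~R = - 2 :> F) ?rmorphN //; ring.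
  rewrite TrD hm TrZ.
  have -> : lam = zeta_poly [:: 2; 0; 0; 0; -1; -1] 0 by rewrite /lam /zeta_poly !(mulrN1z, mulr1z, mulr0z); ring.
  rewrite Tr_ev (_ : tr_zeta_poly _ 0 = 12) // -intrM -intrD mulrC //.
have [t ht] : exists t : int, trF (lam * U) = (2 * t)%:~R.
  apply: Tr_even.
    apply: integral_mul; last by apply: (Zin_aint hF); exact: residue_Zin hU.
    apply: (Zin_aint hF); apply: ZinB; last exact: (Zin_zeta hF).
    by apply: ZinB; [exact: (Zin_int zeta 2)|exact: (Zin_zeta hF)].
  rewrite conjFM; congr (_ * _).
    rewrite /lam !conjFB (_ : (2 : F) = 2%:~R) // conjF_int (@conj_zeta_n 4 14) // (@conj_zeta_n 5 13) //.
    by rewrite (_ : 14 = 9 + 5)%N // (_ : 13 = 9 + 4)%N // !exprD (zeta9 hF) !mul1r addrAC.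
  by rewrite /U !conjFM conjFK (conjF_K bK); ring.
have em : 12 * r + 9 * m = 2 * t by apply: (@intr_inj C); rewrite -e1 ht.
have [m' em'] : exists m', m = 2 * m' by exists (t - 6 * r - 4 * m); lia.
exists m'; rewrite -[9]/(9%:~R) -TrZ e e1 em'; congr (_%:~R); ring.
Qed.

Lemma quad_ee x a be b : dual_residue x a -> ringOfIntegersK zeta be -> residue be b ->
  cexp ((Complex 0 pi : C) * \sum_l E l be * (2 * (E l x * (E l x)^*))) = ee (2 * (b * a * a)%:~R / 3 : R).
Proof.
move=> hx hbe hb; have [m hm] := Tr_quad hx hbe hb.
set r := b * a * a in hm *.
have -> : \sum_l E l be * (2 * (E l x * (E l x)^*)) = trF (be * (x * conjF x)).
  rewrite /trF; apply: eq_bigr => l _; rewrite !rmorphM /= !E_conj conjCK.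
  have -> : (E l be)^* = E l be by rewrite -E_conj conjF_K //; case: hbe.
  ring.
have C9' : (9 : C) != 0 by rewrite pnatr_eq0.
have -> : trF (be * (x * conjF x)) = RC (4 * r%:~R / 3 + 2 * m%:~R : R).
  apply: (mulfI C9'); rewrite hm -(RCn R 9) -RCM.
  have -> : 9 * (4 * r%:~R / 3 + 2 * m%:~R : R) = (12 * r + 18 * m)%:~R :> R.
    by rewrite intrD !intrM -[12%:~R]/(12%:R) -[18%:~R]/(18%:R); field.
  by rewrite /RC rmorph_int.
have -> : (Complex 0 pi : C) * RC (4 * r%:~R / 3 + 2 * m%:~R) = Complex 0 (2 * pi * (2 * r%:~R / 3 + m%:~R)).
  apply/eqP; rewrite eq_complex /= !mul0r !mulr0 subr0 eqxx /=; apply/eqP; by field.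
exact: (eeDZ (2 * r%:~R / 3) m).
Qed.

End Lattice.

(** * Theta series as sums over Z^6 *)

Section Theta.
Variables (R : realType) (F : splittingFieldType rat).
Variables (iota : {rmorphism F -> Cplx R}) (zeta : F).
Variable sigma : 'I_3 -> gal_of (realSubfield zeta).
Hypothesis hF : is_Q_zeta9 iota zeta.
Local Notation C := (Cplx R).
Local Notation u := (iota zeta).
Local Notation K := (realSubfield zeta).
Local Notation conjF := (conjF iota).
Local Notation lat := {ffun 'I_6 -> int}.
Variables (E : 'I_3 -> {rmorphism F -> C}) (k : 'I_3 -> nat).
Hypothesis Ez : forall l, E l zeta = u ^+ k l.
Hypothesis Es : forall l x, x \in K -> iota (sigma l x) = E l x.
Hypothesis Esum : forall (V : nmodType) (h : nat -> V), {in units9, forall j, h (9 - j)%N = h j} ->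
        \sum_l h (k l) = h 1%N + h 2 + h 4.
Hypothesis ku : forall l, k l \in units9.
Hypothesis Etr : forall x, iota (galTrace 1 fullv x) = trF E x.
Local Notation combL := (comb_basis zeta).
Local Notation combD := (comb_dual zeta).
Local Notation pL := (emb_basis zeta E).
Local Notation qL := (emb_basisC zeta E).
Local Notation pD := (emb_dual zeta E).
Local Notation qD := (emb_dualC zeta E).

Lemma zetapow_K n : zeta ^+ n + zeta^-1 ^+ n \in K.
Proof.
have z0 := zeta_neq0 hF.
suff [] : (zeta ^+ n + zeta^-1 ^+ n \in K) /\ (zeta ^+ n.+1 + zeta^-1 ^+ n.+1 \in K) by [].
elim: n => [|n [h0 h1]]; first by rewrite !expr0 !expr1 etaK rpredD ?rpred1.
split=> //; have -> : zeta ^+ n.+2 + zeta^-1 ^+ n.+2 =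
   (zeta + zeta^-1) * (zeta ^+ n.+1 + zeta^-1 ^+ n.+1) - (zeta ^+ n + zeta^-1 ^+ n).
  have e : zeta * zeta^-1 = 1 by rewrite mulfV.
  by rewrite -[zeta ^+ n]mul1r -[zeta^-1 ^+ n]mul1r -e !exprS; ring.
by rewrite rpredB ?rpredM ?etaK.
Qed.

(** Chebyshev recursion: zeta^n + zeta^-n is a polynomial in zeta + zeta^-1.
*)
Lemma trace_K w : w + conjF w \in K.
Proof.
have [N N0 [a0 [a1 [a2 [a3 [a4 [a5 e]]]]]]] := denZ hF w.
have -> : w + conjF w = N%:~R^-1 * (N%:~R * w + conjF (N%:~R * w)).
  by rewrite (conjFM hF) (conjF_int hF) -mulrDr mulKf // (char0 iota).
have zn n : conjF (zeta ^+ n) = zeta^-1 ^+ n by rewrite (conjFX hF) (conjF_zeta hF).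
rewrite rpredM ?rpredV ?rpred_int // e /zeta_comb.
rewrite !(conjFD hF) !((conjFM hF) _%:~R) !(conjF_int hF) !zn (conjF_zeta hF).
have h (a : int) n : a%:~R * (zeta ^+ n + zeta^-1 ^+ n) \in K.
  by rewrite rpredM ?rpred_int ?zetapow_K.
have -> : forall x0 x1 x2 x3 x4 x5 y0 y1 y2 y3 y4 y5 : F, x0 + x1 + x2 + x3 + x4 + x5 + (y0 + y1 + y2 + y3 + y4 + y5) =
  (x0 + y0) + (x1 + y1) + (x2 + y2) + (x3 + y3) + (x4 + y4) + (x5 + y5) by move=> *; ring.
by rewrite -!mulrDr !rpredD ?rpred_int // ?h // (h a1 1%N).
Qed.

Definition qform (z : 'rV[C]_3) x : C := \sum_l z 0 l * (2 * (E l x * (E l x)^*)).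
Definition theta_term z x : C := cexp ((Complex 0 pi : C) * qform z x).

Lemma trzsqE n (z : 'rV[C]_3) (v : 'rV[F]_n) : trzsq iota sigma z v = \sum_i qform z (v 0 i).
Proof.
rewrite /trzsq /qform exchange_big /=; apply: eq_bigr => l _; rewrite -mulr_sumr; congr (_ * _).
have hw (w : F) : w * conjF w + conjF w * w \in K.
  by have := trace_K (w * conjF w); rewrite (conjFM hF) (conjFK hF).
rewrite Es /dotF; last by apply: rpred_sum => i _; exact: hw.
rewrite rmorph_sum; apply: eq_bigr => i _; rewrite rmorphD !rmorphM /= (E_conj hF Ez).
by rewrite mulr2n mulrDl mul1r [X in _ + X]mulrC.
Qed.

Lemma tt_EE z x c : theta_term z (x + combL c) =
  gauss pL qL (z 0) (fun l => E l x) (fun l => (E l x)^*) (gridpt R 1 c).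
Proof.
have hl l : lincomb pL (gridpt R 1 c) l = E l (combL c).
  by rewrite /lincomb E_comb; apply: eq_bigr => i _; rewrite /gridpt divr1 /RC rmorph_int.
have hq l : lincomb qL (gridpt R 1 c) l = (E l (combL c))^*.
  by rewrite (linqE (p := pL)) ?hl.
rewrite /theta_term /gauss; congr cexp.
have -> : two_pi_i R = (Complex 0 pi : C) * 2.
  by rewrite -(RCn R 2); apply/eqP; rewrite eq_complex /two_pi_i /=; apply/andP; split; apply/eqP; ring.
rewrite -mulrA mulr_sumr; congr (_ * _); apply: eq_bigr => l _.
by rewrite hl hq !rmorphD /=; ring.
Qed.

Lemma asum_tt z x : upperHalfPlane3 z -> asum (fun c => theta_term z (x + combL c)).
Proof.
move=> hz; have [Hpq Hqp Hpp Hqq] := pair2 hF Ez Esum ku.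
have [c0 c00 hc0] := exists_lb hz.
have [W _ hW] := exists_ub (z 0); have [S _ hS] := exists_ub (fun l => E l x).
have [M M0 h] := @gauss_dom1 _ _ _ pL qL pD qD (fun i l => erefl) (pair1 hF Ez Esum ku) c0 W S c00.
have -> : (fun c => theta_term z (x + combL c)) = (fun c => gauss pL qL (z 0) (fun l => E l x) (fun l => (E l x)^*) (gridpt R 1 c)).
  by apply/funext => c; exact: tt_EE.
apply: (@dominated_asum _ _ M) => //; apply: h => // l; by rewrite md_conj.
Qed.

Definition coset_theta (a : 'I_3) (z : 'rV[C]_3) : C :=
  summability.sum ((fun c : lat => theta_term z (cosetRep zeta a + combL c)) : lat -> C).

Lemma thetaE a z : upperHalfPlane3 z -> theta iota sigma a z = coset_theta a z.
Proof.
move=> hz; rewrite /theta /thetaSeries.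
pose h (c : lat) : 'rV[F]_1 := const_mx (cosetRep zeta a + combL c).
set f := patch _ _ _.
have fh : f \o h = fun c => theta_term z (cosetRep zeta a + combL c).
  apply/funext => c; rewrite /f /patch /= ifT.
    by rewrite trzsqE big_ord1 /h mxE.
  by apply/mem_set; exists (combL c) => //; exact: (combL_Lambda hF Ez Esum ku).
rewrite (@sum_inj _ _ _ h) ?fh //.
- move=> c d /(congr1 (fun v : 'rV_1 => v 0 0)); rewrite !mxE => /addrI.
  exact: (combL_inj hF Ez Esum ku).
- move=> v hv; rewrite /f /patch ifF //; apply/negbTE/negP => /set_mem[y hy ev].
  by have [c ec] := Lambda_comb hF Ez Esum ku hy; case: (hv c); rewrite /h -ev ec.
- exact: asum_tt.
Qed.

Lemma tt_EED z c : theta_term z (combD c) = gauss pD qD (z 0) (fun=> 0) (fun=> 0) (gridpt R 1 c).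
Proof.
have hl l : lincomb pD (gridpt R 1 c) l = E l (combD c).
  by rewrite /lincomb E_combD; apply: eq_bigr => i _; rewrite /gridpt divr1 /RC rmorph_int.
have hq l : lincomb qD (gridpt R 1 c) l = (E l (combD c))^*.
  by rewrite (linqE (p := pD)) ?hl.
rewrite /theta_term /gauss; congr cexp.
have -> : two_pi_i R = (Complex 0 pi : C) * 2.
  by rewrite -(RCn R 2); apply/eqP; rewrite eq_complex /two_pi_i /=; apply/andP; split; apply/eqP; ring.
rewrite -mulrA mulr_sumr; congr (_ * _); apply: eq_bigr => l _.
by rewrite hl hq; ring.
Qed.

Lemma cr0 : cosetRep zeta 0 = 0. Proof. by []. Qed.
Lemma cr1 : cosetRep zeta 1 = fdual zeta ord0. Proof. by []. Qed.
Lemma cr2 : cosetRep zeta 2 = - fdual zeta ord0. Proof. by []. Qed.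

Lemma theta_lat_coset (z : 'rV[C]_3) : theta_lat pL qL (z 0) = coset_theta 0 z.
Proof.
have e1 : (fun l => E l 0) = (fun=> 0) by apply/funext => l; exact: rmorph0.
have e2 : (fun l => (E l 0)^*) = (fun=> 0) by apply/funext => l; rewrite rmorph0 conjC0.
rewrite /theta_lat /coset_theta; congr (summability.sum _); apply/funext => c.
by have := tt_EE z 0 c; rewrite e1 e2 cr0 => ->.
Qed.

Lemma ord3P (a : 'I_3) : [\/ a = 0, a = 1 | a = 2].
Proof.
case: a => [[|[|[|a]]] ha] //; [constructor 1|constructor 2|constructor 3]; exact: val_inj.
Qed.

Definition coset_res (a : 'I_3) : int := nth 0 [:: 0; 1; -1] a.

Lemma dual_residue_coset a c : dual_residue zeta (cosetRep zeta a + combL c) (coset_res a).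
Proof.
rewrite -[coset_res a]addr0; apply: dual_residueD; last by apply/(Lambda_residue hF Ez Esum ku); exact: (combL_Lambda hF Ez Esum ku).
have h1 : dual_residue zeta (fdual zeta ord0) 1 := dual_residue_fdual hF ord0.
case: (ord3P a) => ->; rewrite ?cr0 ?cr1 ?cr2; [exact: dual_residue0|exact: h1|exact: (dual_residueN h1)].
Qed.

Lemma F3P (v : 'F_3) : [\/ v = 0, v = 1 | v = -1].
Proof.
case: v => [[|[|[|a]]] ha] //; [constructor 1|constructor 2|constructor 3]; exact: val_inj.
Qed.

(** The element of F_3 represented by -1 corresponds to the coset of x_2. *)
Definition coset_of (v : 'F_3) : 'I_3 := if v == 0 then 0 else if v == 1 then 1 else 2.

Lemma rs_Ix v : (coset_res (coset_of v))%:~R = v.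
Proof. by case: (F3P v) => ->; rewrite /coset_of //=; apply: val_inj. Qed.

Lemma Ix_rs a : coset_of (coset_res a)%:~R = a.
Proof. by case: (ord3P a) => ->; apply: val_inj. Qed.

Lemma coset_inj a a' c c' : cosetRep zeta a + combL c = cosetRep zeta a' + combL c' -> a = a' /\ c = c'.
Proof.
move=> e; have aa : a = a'.
  have h := dual_residue_coset a c; rewrite e in h.
  by rewrite -(Ix_rs a) -(Ix_rs a') (dual_residue_F3 hF E h (dual_residue_coset a' c')).
by split=> //; move: e; rewrite aa => /addrI; exact: (combL_inj hF Ez Esum ku).
Qed.

Lemma coset_ex x a : dual_residue zeta x a -> exists c, x = cosetRep zeta (coset_of a%:~R) + combL c.
Proof.
move=> hx; set i := coset_of _.
have hd : dual_residue zeta (x - cosetRep zeta i) (a - coset_res i).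
  apply: dual_residueD => //; have := dual_residue_coset i [ffun=> 0].
  have -> : combL [ffun=> 0] = 0 by rewrite /comb_basis big1 // => j _; rewrite ffunE mulr0z mul0r.
  by rewrite addr0 => /dual_residueN.
have [|c ec] := @Lambda_comb _ _ _ _ hF _ _ Ez Esum ku (x - cosetRep zeta i); last first.
  by exists c; rewrite -ec; ring.
apply/(Lambda_residue hF Ez Esum ku); apply: (dual_residue_mod hF) hd _.
have e3 : (a - coset_res i)%:~R = 0 :> 'F_3 by rewrite intrB rs_Ix subrr.
have : (3 %| a - coset_res i)%Z by rewrite (dvdz_pcharf (pchar_Fp (isT : prime 3))) e3.
by move=> /dvdzP[m em]; exists (- m); rewrite em; ring.
Qed.

(** The dual lattice is the union of the three cosets of Lambda. *)
Lemma theta_dual_coset (z : 'rV[C]_3) : upperHalfPlane3 z -> theta_dual pD qD (z 0) = coset_theta 0 z + coset_theta 1 z + coset_theta 2 z.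
Proof.
move=> hz; rewrite /theta_dual.
have -> : (fun m => gauss pD qD (z 0) (fun=> 0) (fun=> 0) (gridpt R 1 m)) = (fun m => theta_term z (combD m)).
  by apply/funext => m; rewrite tt_EED.
have /choice[h hh] : forall ac : 'I_3 * lat, exists d, cosetRep zeta ac.1 + combL ac.2 = combD d.
  move=> [a c]; have := dual_of_D hF Ez Esum ku Etr (dual_residue_coset a c).
  by move=> /(dual_comb hF Ez Esum ku Etr)[d ->]; exists d.
rewrite (@sum_partition _ _ _ _ (fun a c => h (a, c)) (fun m => theta_term z (combD m))).
- rewrite !big_ord_recl big_ord0 addr0 addrA; congr (_ + _ + _); congr (summability.sum _);
   apply/funext => c /=; by rewrite -hh.
- by move=> a a' c c' e; apply: coset_inj; rewrite (hh (a, c)) (hh (a', c')) e.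
- move=> d hd; have [c ec] := coset_ex (combD_D hF d).
  case: (hd (coset_of (res_coords d)%:~R) c); apply: (combD_inj hF Ez Esum ku).
  by rewrite -hh -ec.
- move=> a; have -> : (fun m => theta_term z (combD m)) \o (fun c => h (a, c)) = (fun c => theta_term z (cosetRep zeta a + combL c)).
    by apply/funext => c /=; rewrite -hh.
  exact: asum_tt.
Qed.

Lemma ttN z x : theta_term z (- x) = theta_term z x.
Proof. by rewrite /theta_term /qform; congr cexp; congr (_ * _); apply: eq_bigr => l _; rewrite !rmorphN /=; ring. Qed.

(** x_2 = - x_1, and the quadratic form is even. *)
Lemma coset_theta_opp z : upperHalfPlane3 z -> coset_theta 2 z = coset_theta 1 z.
Proof.
move=> hz; pose h (c : lat) : lat := [ffun i => - c i].
have hK c : h (h c) = c by apply/ffunP => i; rewrite !ffunE opprK.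
have hc c : combL (h c) = - combL c.
  rewrite /comb_basis -sumrN; apply: eq_bigr => i _; by rewrite ffunE mulrNz mulNr.
have e : (fun c => theta_term z (cosetRep zeta 2 + combL c)) \o h = (fun c => theta_term z (cosetRep zeta 1 + combL c)).
  by apply/funext => c /=; rewrite hc cr1 cr2 -opprD ttN.
rewrite {1}/coset_theta (@sum_inj _ _ _ h) ?e //.
- exact: (can_inj hK).
- by move=> c hcc; case: (hcc (h c)).
- exact: asum_tt.
Qed.

(** The weight enumerator of the code: a vector of Gamma_C is a code word
together with, at each place, an element of the corresponding coset of Lambda.
*)
Lemma thetaCodeE n (Cd : {vspace 'rV['F_3]_n}) z : upperHalfPlane3 z ->
  thetaCode iota sigma Cd z = \sum_(v : 'rV['F_3]_n | v \in Cd) \prod_i coset_theta (coset_of (v 0 i)) z.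
Proof.
move=> hz; rewrite /thetaCode /thetaSeries; set f := patch _ _ _.
pose h (v : 'rV['F_3]_n) (c : {ffun 'I_n -> lat}) : 'rV[F]_n :=
  \row_i (cosetRep zeta (coset_of (v 0 i)) + combL (c i)).
pose G (v : 'rV['F_3]_n) (i : 'I_n) (c : lat) := theta_term z (cosetRep zeta (coset_of (v 0 i)) + combL c).
have rhoh v c : \row_i rho zeta (h v c 0 i) = v.
  by apply/rowP => i; rewrite !mxE (rhoE hF Ez Esum ku Etr (dual_residue_coset _ _)) rs_Ix.
have fh v : f \o h v = if v \in Cd then (fun c => \prod_i G v i (c i)) else (fun=> 0).
  apply/funext => c; rewrite /= /f /patch; case: (boolP (v \in Cd)) => vC.
    rewrite ifT.
      rewrite trzsqE mulr_sumr cexp_sum; apply: eq_bigr => i _; by rewrite /G /theta_term mxE.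
    apply/mem_set; split; last by rewrite rhoh.
    by move=> i; rewrite mxE; apply: (dual_of_D hF Ez Esum ku Etr (dual_residue_coset _ _)).
  by rewrite ifF //; apply/negbTE/negP => /set_mem[_]; rewrite rhoh (negbTE vC).
have aG v : asum (fun c : {ffun 'I_n -> lat} => \prod_i G v i (c i)).
  by apply: asum_prod => i; exact: asum_tt.
rewrite (@sum_partition _ _ _ _ h f).
- rewrite [RHS]big_mkcond /=; apply: eq_bigr => v _; rewrite fh; case: ifP => _.
    by rewrite sum_prod // => i; exact: asum_tt.
  by apply: hasSumE; exact: hasSum0.
- move=> v v' c c' e.
  have ei i : coset_of (v 0 i) = coset_of (v' 0 i) /\ c i = c' i.
    by apply: coset_inj; have := congr1 (fun x : 'rV_n => x 0 i) e; rewrite !mxE.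
  split; [apply/rowP => i|apply/ffunP => i]; have [e1 e2] := ei i => //.
  by rewrite -(rs_Ix (v 0 i)) e1 rs_Ix.
- move=> x hx; rewrite /f /patch ifF //; apply/negbTE/negP => /set_mem[hd _].
  have /choice[a ha] : forall i, exists a, dual_residue zeta (x 0 i) a by move=> i; apply/(dualE hF Ez Esum ku Etr); exact: hd.
  have /choice[c hc] : forall i, exists c, x 0 i = cosetRep zeta (coset_of (a i)%:~R) + combL c by move=> i; exact: coset_ex.
  case: (hx (\row_i (a i)%:~R) [ffun i => c i]); apply/rowP => i.
  by rewrite !mxE ffunE -hc.
- move=> v; rewrite fh; case: ifP => _ //; exists 0 => B; rewrite big1 // => i _; exact: md0.
Qed.

End Theta.

(** * Translations and inversion *)

Section Transform.
Variables (R : realType) (F : splittingFieldType rat).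
Variables (iota : {rmorphism F -> Cplx R}) (zeta : F).
Variable sigma : 'I_3 -> gal_of (realSubfield zeta).
Hypothesis hF : is_Q_zeta9 iota zeta.
Local Notation C := (Cplx R).
Local Notation u := (iota zeta).
Local Notation K := (realSubfield zeta).
Local Notation lat := {ffun 'I_6 -> int}.
Variables (E : 'I_3 -> {rmorphism F -> C}) (k : 'I_3 -> nat).
Hypothesis Ez : forall l, E l zeta = u ^+ k l.
Hypothesis Es : forall l x, x \in K -> iota (sigma l x) = E l x.
Hypothesis Esum : forall (V : nmodType) (h : nat -> V), {in units9, forall j, h (9 - j)%N = h j} ->
        \sum_l h (k l) = h 1%N + h 2 + h 4.
Hypothesis ku : forall l, k l \in units9.
Hypothesis Etr : forall x, iota (galTrace 1 fullv x) = trF E x.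
Local Notation combL := (comb_basis zeta).
Local Notation pL := (emb_basis zeta E).
Local Notation qL := (emb_basisC zeta E).
Local Notation pD := (emb_dual zeta E).
Local Notation qD := (emb_dualC zeta E).

Local Notation TH := (coset_theta zeta E).
Local Notation tt := (theta_term E).
Local Notation H3 := (@upperHalfPlane3 R).

Lemma sum_real (I : choiceType) (g : I -> R) : (forall i, 0 <= g i) -> asum (fun i => RC (g i)) ->
  exists s : R, summability.sum ((fun i => RC (g i)) : I -> C) = RC s /\ forall i, g i <= s.
Proof.
move=> g0 /asum_has; set s := summability.sum _ => hs.
have hIm : complex.Im s = 0.
  apply/eqP; rewrite -normr_le0; apply/ler_addgt0Pr => e e0; rewrite add0r.
  have [A /(_ A (fsubset_refl _)) hA] := hs _ e0.
  apply: le_trans (ltW hA); rewrite -RC_sum; apply: le_trans (Im_md _).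
  by case: s {hs hA} => a b; rewrite /RC /= sub0r normrN.
exists (complex.Re s); split; first by apply/eqP; rewrite eq_complex /= eqxx hIm eqxx.
move=> i; apply/ler_addgt0Pr => e e0; have [A hA] := hs _ e0.
have [h1 h2] : (A `<=` i |` A)%fset /\ g i <= \sum_(j <- (i |` A)%fset) g j.
  split; first exact: fsubsetU1.
  rewrite (big_fsetD1 i) ?fset1U1 //= lerDl; exact: sumr_ge0.
have h3 := hA _ h1; rewrite -RC_sum in h3; set S := \sum_(j <- _) _ in h2 h3 *.
have h4 : S - complex.Re s <= md (RC S - s).
  apply: le_trans (Re_md _); apply: le_trans (ler_norm _).
  by case: s {hs hA hIm h3}.
by lra.
Qed.

Definition point_i : 'rV[C]_3 := const_mx (Complex 0 1).
Definition inv_z (z : 'rV[C]_3) : 'rV[C]_3 := \row_l (- (z 0 l)^-1).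
Definition shift_z (be : F) (z : 'rV[C]_3) : 'rV[C]_3 := \row_l (z 0 l + E l be).
Definition norm_z (z : 'rV[C]_3) : C := \prod_l z 0 l.

Lemma H3_zi : H3 point_i. Proof. by move=> l; rewrite mxE /=. Qed.
Lemma H3_Sz z : H3 z -> H3 (inv_z z). Proof. by move=> h l; rewrite mxE; exact: im_inv. Qed.
Lemma H3_neq0 z : H3 z -> forall l, z 0 l != 0.
Proof. by move=> h l; apply/eqP => e; have := h l; rewrite e ltxx. Qed.
Lemma NN_neq0 z : H3 z -> norm_z z != 0.
Proof. by move=> h; apply/prodf_neq0 => l _; exact: H3_neq0. Qed.
Lemma NN_Sz z : norm_z (inv_z z) = - (norm_z z)^-1.
Proof.
rewrite /norm_z (eq_bigr (fun l => - 1 * (z 0 l)^-1)); last by move=> l _; rewrite mxE mulN1r.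
by rewrite big_split /= prodfV prodr_const card_ord; ring.
Qed.
Lemma SzK z : inv_z (inv_z z) = z.
Proof. by apply/rowP => l; rewrite !mxE invrN invrK opprK. Qed.

Lemma E_real l x : x \in K -> complex.Im (E l x) = 0.
Proof.
move=> xK; have := E_conj hF Ez l x; rewrite (conjF_K hF xK).
by case: (E l x) => a b [/eqP]; rewrite -subr_eq0 opprK -mulr2n mulrn_eq0 /= => /eqP ->.
Qed.

Lemma H3_Tz be z : be \in K -> H3 z -> H3 (shift_z be z).
Proof.
move=> bK h l; rewrite mxE; have := h l; have := E_real l bK.
by case: (z 0 l) (E l be) => a b [a' b'] /= ->; rewrite addr0.
Qed.

Lemma coset_theta_shift a be b z : H3 z -> ringOfIntegersK zeta be -> residue zeta be b ->
  TH a (shift_z be z) = ee (2 * (b * coset_res a * coset_res a)%:~R / 3 : R) * TH a z.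
Proof.
move=> hz hbe hb; rewrite /coset_theta -sumZ; last exact: (asum_tt hF Ez Esum ku).
congr (summability.sum _); apply/funext => c.
rewrite -(quad_ee hF Ez Esum ku (dual_residue_coset hF Ez Esum ku a c) hbe hb) /theta_term -cexpD; congr cexp.
rewrite -mulrDr -big_split /=; congr (_ * _); apply: eq_bigr => l _; rewrite mxE; ring.
Qed.

Lemma tt_zi x : tt point_i x = RC (expR (- (2 * pi * \sum_l md (E l x) ^+ 2))).
Proof.
rewrite /theta_term /qform (_ : _ * _ = RC (- (2 * pi * \sum_l md (E l x) ^+ 2))).
  by apply/eqP; rewrite eq_complex /cexp /RC /= cos0 sin0 mulr1 mulr0 !eqxx.
have -> : \sum_l point_i 0 l * (2 * (E l x * (E l x)^*)) = (Complex 0 1 : C) * RC (2 * \sum_l md (E l x) ^+ 2).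
  rewrite RCM RC_sum !mulr_sumr; apply: eq_bigr => l _; rewrite mxE mulconj RCn //.
by apply/eqP; rewrite eq_complex /=; apply/andP; split; apply/eqP; ring.
Qed.

Lemma coset_theta_zi a : exists s : R, TH a point_i = RC s /\ 0 < s.
Proof.
have h := asum_tt hF Ez Esum ku (cosetRep zeta a) H3_zi.
have e : (fun c : lat => tt point_i (cosetRep zeta a + combL c)) =
  (fun c => RC (expR (- (2 * pi * \sum_l md (E l (cosetRep zeta a + combL c)) ^+ 2)))).
  by apply/funext => c; exact: tt_zi.
rewrite e in h; have [|s [hs hge]] := sum_real _ h; first by move=> c; exact: expR_ge0.
by exists s; rewrite /coset_theta e; split=> //; apply: lt_le_trans (hge [ffun=> 0]); exact: expR_gt0.
Qed.

(** The constant of poisson is evaluated at the fixed point (i, i, i) of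
inversion, where all terms are positive; only its argument is found here. *)
Lemma coset_theta0_inv : exists2 r : R, 0 < r & forall z, H3 z ->
  TH 0 (inv_z z) = (Complex 0 r) * norm_z z * (TH 0 z + 2 * TH 1 z).
Proof.
have [s0 [e0 s00]] := coset_theta_zi 0; have [s1 [e1 s10]] := coset_theta_zi 1.
have s2 : 0 < s0 + 2 * s1 by lra.
exists (s0 / (s0 + 2 * s1)) => [|z hz]; first exact: divr_gt0.
have [Hpq Hqp Hpp Hqq] := pair2 hF Ez Esum ku.
have := @poisson R 6 3 pL qL pD qD (fun _ _ => erefl) (fun _ _ => erefl) (pair1 hF Ez Esum ku) Hpq Hqp Hpp Hqq
  ((inv_z z) 0) (point_i 0) (H3_Sz hz) H3_zi.
have -> : (fun l => - (point_i 0 l)^-1) = point_i 0.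
  by apply/funext => l; rewrite !mxE; apply/eqP; rewrite eq_complex /= ; apply/andP; split; apply/eqP; field.
have -> : (fun l => - (inv_z z 0 l)^-1) = z 0.
  by apply/funext => l; rewrite !mxE invrN invrK opprK.
rewrite !theta_lat_coset !(theta_dual_coset hF Ez Esum ku Etr) //; last exact: H3_zi.
rewrite (coset_theta_opp hF Ez Esum ku hz) (coset_theta_opp hF Ez Esum ku H3_zi) e0 e1 -/(norm_z _) NN_Sz -/(norm_z point_i).
have -> : norm_z point_i = - (Complex 0 1 : C).
  rewrite /norm_z !big_ord_recl big_ord0 !mxE; apply/eqP; rewrite eq_complex /=; apply/andP; split; apply/eqP; ring.
have n0 := NN_neq0 hz; have S2 : RC (s0 + 2 * s1) != 0 by rewrite /RC fmorph_eq0 gt_eqF.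
have -> : (Complex 0 (s0 / (s0 + 2 * s1)) : C) = (Complex 0 1 : C) * RC s0 / RC (s0 + 2 * s1).
  rewrite -RCV -mulrA -RCM; apply/eqP; rewrite eq_complex /=; apply/andP; split; apply/eqP; ring.
have -> : RC s0 + RC s1 + RC s1 = RC (s0 + 2 * s1) by rewrite -!RCD; congr RC; ring.
set X := coset_theta _ _ _ (inv_z z); move: S2; move: (RC (s0 + 2 * s1)) => Q Q0 h.
have -> : X = - norm_z z * (- (norm_z z)^-1 * X * Q) / Q by field; rewrite n0 Q0.
by rewrite h; field; exact: Q0.
Qed.

Definition omega3 : C := ee (3^-1 : R).
Local Notation W := (omega3 ^+ 2).

Lemma omE : [/\ omega3 ^+ 3 = 1, W = - omega3 - 1, 0 < complex.Im omega3 & complex.Re W <= 1].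
Proof.
have o3 : omega3 ^+ 3 = 1 by rewrite /omega3 -eeMn mulfV ?ee1 // pnatr_eq0.
have o1 : omega3 != 1 by apply: ee_neq1; apply/andP; split; lra.
split=> //.
- have : (omega3 - 1) * (W + omega3 + 1) = 0.
    have -> : (omega3 - 1) * (W + omega3 + 1) = omega3 ^+ 3 - 1 by ring.
    by rewrite o3 subrr.
  by move=> /eqP; rewrite mulf_eq0 subr_eq0 (negbTE o1) /= => /eqP h; rewrite -[LHS]subr0 -h; ring.
- rewrite /omega3 /ee /cexp /= expR0 mul1r; apply: sin_gt0_pi; have := pi_gt0 R.
  by move=> p0; apply/andP; split; [apply: mulr_gt0|]; lra.
- apply: le_trans (ler_norm _) _; apply: le_trans (Re_md _) _.
  by rewrite expr2 mdM /omega3 [X in X * _]md_ee [X in _ * X]md_ee mulr1.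
Qed.

(** If a vector is mapped to its opposite by the cube of a 2 x 2 matrix, then
-1 is an eigenvalue of the cube; the left-hand side is its characteristic
polynomial at -1, in terms of the trace a + f and the determinant. *)
Lemma det_M3 (L : fieldType) (a b e f x y : L) : x != 0 -> 
  x = - (a * (a * (a * x + b * y) + b * (e * x + f * y)) + b * (e * (a * x + b * y) + f * (e * x + f * y))) ->
  y = - (e * (a * (a * x + b * y) + b * (e * x + f * y)) + f * (e * (a * x + b * y) + f * (e * x + f * y))) ->
  2 + ((a + f) ^+ 3 - 3 * (a + f) * (a * f - b * e)) - 1 + (a * f - b * e) ^+ 3 = 0.
Proof.
move=> x0 h1 h2; apply: (mulfI x0); rewrite mulr0.
pose p11 := a * (a * a + b * e) + b * (e * a + f * e).
pose p12 := a * (a * b + b * f) + b * (e * b + f * f).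
pose p21 := e * (a * a + b * e) + f * (e * a + f * e).
pose p22 := e * (a * b + b * f) + f * (e * b + f * f).
have k1 : (1 + p11) * x + p12 * y = 0.
  by rewrite mulrDl mul1r [X in X + _ + _]h1 /p11 /p12; ring.
have k2 : p21 * x + (1 + p22) * y = 0.
  by rewrite [(1 + p22) * y]mulrDl mul1r [X in _ + (X + _)]h2 /p21 /p22; ring.
have -> : x * (2 + ((a + f) ^+ 3 - 3 * (a + f) * (a * f - b * e)) - 1 + (a * f - b * e) ^+ 3) =
  (1 + p22) * ((1 + p11) * x + p12 * y) - p12 * (p21 * x + (1 + p22) * y).
  by rewrite /p11 /p12 /p21 /p22; ring.
by rewrite k1 k2; ring.
Qed.

Definition inv_shift_z z := inv_z (shift_z 1 z).
Lemma H3_Uz z : H3 z -> H3 (inv_shift_z z).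
Proof. by move=> hz; apply: H3_Sz; apply: H3_Tz => //; exact: rpred1. Qed.

(** z -> -1/(z + 1) has order 3; the factors of automorphy multiply to (-1)^3
over the three embeddings. *)
Lemma U_cycle z : H3 z -> inv_shift_z (inv_shift_z (inv_shift_z z)) = z /\
  norm_z (shift_z 1 z) * norm_z (shift_z 1 (inv_shift_z z)) * norm_z (shift_z 1 (inv_shift_z (inv_shift_z z))) = -1.
Proof.
move=> z0H; have z1H := H3_Uz z0H; have z2H := H3_Uz z1H.
have z1n y : H3 y -> forall l, y 0 l + 1 != 0.
  move=> hy l; have := H3_neq0 (H3_Tz (rpred1 _) hy) l; by rewrite mxE rmorph1.
split.
  apply/rowP => l; rewrite !mxE !rmorph1.
  have := z1n _ z1H l; have := z1n _ z0H l.
  rewrite !mxE !rmorph1; move: (z 0 l) => w h1 h2.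
  have e1 : - (w + 1)^-1 + 1 = w / (w + 1) by field.
  rewrite e1 in h2 *; have w0 : w != 0 by apply: contraNneq h2 => ->; rewrite mul0r.
  rewrite invf_div (_ : - ((w + 1) / w) + 1 = - w^-1); last by field.
  by rewrite invrN invrK opprK.
rewrite /norm_z -!big_split /= (eq_bigr (fun=> -1)); last first.
  move=> l _; rewrite !mxE !rmorph1.
  have := z1n _ z1H l; have := z1n _ z0H l.
  rewrite !mxE !rmorph1; move: (z 0 l) => w h1 h2.
  have e1 : - (w + 1)^-1 + 1 = w / (w + 1) by field.
  rewrite e1 in h2 *; have w0 : w != 0 by apply: contraNneq h2 => ->; rewrite mul0r.
  by rewrite invf_div; field; rewrite h1 w0.
by rewrite prodr_const card_ord; ring.
Qed.

(** Applying the inversion of theta_0 twice gives the inversion of theta_1 in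
terms of the constant c. On the cycle of z -> -1/(z + 1) through (i, i, i),
det_M3 yields (t - om)^2 (t + 2 om) = 0 for t = c (1 - om^2), and the
positivity of c / i excludes the second root. *)
Lemma S_transform : exists c : C, [/\ c * (1 - W) = omega3, 3 * c ^+ 2 = -1 &
  forall z, H3 z -> TH 0 (inv_z z) = c * norm_z z * (TH 0 z + 2 * TH 1 z) /\
                    TH 1 (inv_z z) = c * norm_z z * (TH 0 z - TH 1 z)].
Proof.
have [r r0 hS0] := coset_theta0_inv; set c : C := Complex 0 r in hS0.
have [w3 WE imo reW] := omE.
have c0 : c != 0 by rewrite eq_complex /= eqxx /= gt_eqF.
pose kk : C := (c + c^-1) / 2.
have two0 : (2 : C) != 0 by rewrite pnatr_eq0.
have hS1 z : H3 z -> TH 1 (inv_z z) = norm_z z * (- kk * TH 0 z - c * TH 1 z).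
  move=> hz; have := hS0 _ (H3_Sz hz); rewrite SzK hS0 // NN_Sz => h.
  apply: (mulfI two0); move: (NN_neq0 hz) h; set n := norm_z z; set t0 := coset_theta _ _ 0 z; set t1 := coset_theta _ _ 1 z.
  set X := coset_theta _ _ 1 (inv_z z) => n0 h.
  have -> : 2 * X = - (n / c) * (c * - n^-1 * (c * n * (t0 + 2 * t1) + 2 * X)) - c * n * (t0 + 2 * t1).
    by field; rewrite n0 c0.
  by rewrite -h /kk; field; exact: c0.
have K1 : ringOfIntegersK zeta 1.
  by split; [exact: rpred1|exact: integral1].
have R1 : residue zeta 1 1 by exact: (residue_int zeta 1).
have hT0 z : H3 z -> TH 0 (shift_z 1 z) = TH 0 z.
  by move=> hz; rewrite (coset_theta_shift 0 hz K1 R1) /coset_res /= !mulr0 mul0r ee0 mul1r.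
have hT1 z : H3 z -> TH 1 (shift_z 1 z) = W * TH 1 z.
  move=> hz; rewrite (coset_theta_shift 1 hz K1 R1) /coset_res /= !mulr1; congr (_ * _).
  by rewrite /omega3 -eeMn.
pose U := inv_shift_z.
have hU : forall z, H3 z -> H3 (U z) := H3_Uz.
have hU0 z : H3 z -> TH 0 (U z) = norm_z (shift_z 1 z) * (c * TH 0 z + 2 * c * W * TH 1 z).
  move=> hz; rewrite /U /inv_shift_z hS0 ?hT0 ?hT1 //; first by ring.
  by apply: H3_Tz => //; exact: rpred1.
have hU1 z : H3 z -> TH 1 (U z) = norm_z (shift_z 1 z) * (- kk * TH 0 z + (- c * W) * TH 1 z).
  move=> hz; rewrite /U /inv_shift_z hS1 ?hT0 ?hT1 //; first by ring.
  by apply: H3_Tz => //; exact: rpred1.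
have z0H := H3_zi; have z1H := hU _ z0H; have z2H := hU _ z1H.
have [U3 N3] := U_cycle z0H; rewrite -/U in U3 N3.
have [s0 [e0 s00]] := coset_theta_zi 0.
have x0 : TH 0 point_i != 0 by rewrite e0 /RC fmorph_eq0 gt_eqF.
have E0 := hU0 _ z2H; have E1 := hU1 _ z2H.
rewrite U3 (hU0 _ z1H) (hU1 _ z1H) (hU0 _ z0H) (hU1 _ z0H) in E0 E1.
have hdet : 2 + ((c + - c * W) ^+ 3 - 3 * (c + - c * W) * (c * (- c * W) - 2 * c * W * - kk)) - 1 +
    (c * (- c * W) - 2 * c * W * - kk) ^+ 3 = 0.
  apply: (@det_M3 C c (2 * c * W) (- kk) (- c * W) (TH 0 point_i) (TH 1 point_i) x0);
    [apply: (etrans E0)|apply: (etrans E1)]; rewrite -[RHS]mulN1r -N3; ring.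
have hk : 2 * c * kk = c ^+ 2 + 1 by rewrite /kk; field; exact: c0.
set t := c * (1 - W).
have ht : (t - omega3) ^+ 2 * (t + 2 * omega3) = 0.
  have -> : (t - omega3) ^+ 2 * (t + 2 * omega3) = t ^+ 3 - 3 * t * W + 2 * omega3 ^+ 3 by ring.
  have W3 : W ^+ 3 = 1 by rewrite -exprM mulnC exprM w3 expr1n.
  have d : c * (- c * W) - 2 * c * W * - kk = W.
    have -> : c * (- c * W) - 2 * c * W * - kk = W * (2 * c * kk - c ^+ 2) by ring.
    by rewrite hk; ring.
  have a : c + - c * W = t by rewrite /t; ring.
  by rewrite w3 -[RHS]hdet d W3 a; ring.
have tn : t + 2 * omega3 != 0.
  apply/eqP => h; have : complex.Im (t + 2 * omega3) = 0 by rewrite h.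
  have hh (x : C) : complex.Im (c * x) = r * complex.Re x by case: x => a b /=; ring.
  have hW : complex.Re (1 - W) = 1 - complex.Re W by case: W.
  rewrite ImD -(RCn R 2) Im_RCM hh hW => h1.
  have : 0 <= r * (1 - complex.Re W) by apply: mulr_ge0; lra.
  by lra.
have te : t = omega3.
  by move: ht => /eqP; rewrite mulf_eq0 (negbTE tn) orbF expf_eq0 /= subr_eq0 => /eqP.
have c2 : 3 * c ^+ 2 = -1.
  have W0 : W != 0 by rewrite expf_neq0 // ee_neq0.
  have W2 : W ^+ 2 = omega3 by rewrite -exprM (_ : 2 * 2 = 3 + 1)%N // exprD w3 mul1r.
  apply: (mulfI W0); have -> : W * -1 = - t ^+ 2 by rewrite te; ring.
  have -> : t ^+ 2 = c ^+ 2 * (1 - 2 * W + W ^+ 2) by rewrite /t; ring.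
  by rewrite W2 WE; ring.
exists c; split=> // z hz; split; first exact: hS0.
rewrite hS1 //; have -> : kk = - c.
  apply: (mulfI two0); apply: (mulfI c0); rewrite mulrA [c * 2]mulrC hk.
  have e : 1 = - (3 * c ^+ 2) by rewrite c2 opprK.
  by rewrite {1}e; ring.
by ring.
Qed.

End Transform.

(** * Generation of SL_2 over the integers of K *)

(** The covering radius of the hexagonal lattice: in the triangle that
contains the point, the average of the squared distances to the vertices, with
barycentric weights, is at most 1/3. *)
Lemma A2_cover (R : realType) (p q : R) : exists m n : int,
  (p - m%:~R) ^+ 2 - (p - m%:~R) * (q - n%:~R) + (q - n%:~R) ^+ 2 <= 1 / 3.
Proof.
suff H (x y : R) : 0 <= x -> 0 <= y -> x <= 1 -> y <= 1 -> exists m n : int,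
  (x - m%:~R) ^+ 2 - (x - m%:~R) * (y - n%:~R) + (y - n%:~R) ^+ 2 <= 1 / 3.
  have hp := ge_floor p; have hq := ge_floor q; have hp1 := floorD1_gt p; have hq1 := floorD1_gt q.
  rewrite intrD in hp1; rewrite intrD in hq1.
  have [||||m [n hmn]] := H (p - (Num.floor p)%:~R) (q - (Num.floor q)%:~R); try lra.
  exists (Num.floor p + m), (Num.floor q + n); rewrite !intrD.
  by move: hmn; rewrite !opprD !addrA.
wlog xy : x y / y <= x.
  move=> H x0 y0 x1 y1; have [xy|/ltW xy] := leP y x; first exact: H.
  have [m [n h]] := H y x xy y0 x0 y1 x1; exists n, m.
  by apply: le_trans h; lra.
move=> x0 y0 x1 y1.
have key : (1 - x) * (x ^+ 2 - x * y + y ^+ 2) + (x - y) * ((x - 1) ^+ 2 - (x - 1) * y + y ^+ 2) +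
   y * ((x - 1) ^+ 2 - (x - 1) * (y - 1) + (y - 1) ^+ 2) <= 1 / 3.
  have : 0 <= (1 - x - (x - y)) ^+ 2 + (x - y - y) ^+ 2 + (y - (1 - x)) ^+ 2.
    by rewrite !addr_ge0 ?sqr_ge0.
  by nra.
have [h0|h0] := leP (x ^+ 2 - x * y + y ^+ 2) (1 / 3); first by exists 0, 0; rewrite !subr0.
have [h1|h1] := leP ((x - 1) ^+ 2 - (x - 1) * y + y ^+ 2) (1 / 3); first by exists 1, 0; rewrite !subr0.
have [h2|h2] := leP ((x - 1) ^+ 2 - (x - 1) * (y - 1) + (y - 1) ^+ 2) (1 / 3); first by exists 1, 1.
exfalso; move: key h0 h1 h2; set f0 := x ^+ 2 - _ + _; set f1 := _ - _ * y + _; set f2 := _ + (y - 1) ^+ 2.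
move=> key h0 h1 h2.
have k0 : 0 <= (1 - x) * (f0 - 1 / 3) by apply: mulr_ge0; lra.
have k1 : 0 <= (x - y) * (f1 - 1 / 3) by apply: mulr_ge0; lra.
have k2 : 0 <= y * (f2 - 1 / 3) by apply: mulr_ge0; lra.
have [hx|hx] := ltP x 1.
  have : 0 < (1 - x) * (f0 - 1 / 3) by apply: mulr_gt0; lra.
  by lra.
have ex : x = 1 by lra.
have [hy|hy] := ltP y x.
  have : 0 < (x - y) * (f1 - 1 / 3) by apply: mulr_gt0; lra.
  by lra.
have : 0 < y * (f2 - 1 / 3) by apply: mulr_gt0; lra.
by lra.
Qed.

(** 27 x y z <= (x + y + z)^3, and (11/4)^3 < 27. *)
Lemma amgm3 (R : realType) (x y z : R) : 0 <= x -> 0 <= y -> 0 <= z -> x + y + z <= 11 / 4 -> x * y * z < 1.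
Proof.
move=> x0 y0 z0 h.
have e : (x + y + z) ^+ 3 - 27 * (x * y * z) =
  (x + y + z) * ((x - y) ^+ 2 + (y - z) ^+ 2 + (z - x) ^+ 2) / 2 +
  3 * (x * (y - z) ^+ 2 + y * (z - x) ^+ 2 + z * (x - y) ^+ 2) by field.
have p : 0 <= (x + y + z) ^+ 3 - 27 * (x * y * z).
  have q1 := mulr_ge0 x0 (sqr_ge0 (y - z)); have q2 := mulr_ge0 y0 (sqr_ge0 (z - x)).
  have q3 := mulr_ge0 z0 (sqr_ge0 (x - y)).
  have q4 : 0 <= (x + y + z) * ((x - y) ^+ 2 + (y - z) ^+ 2 + (z - x) ^+ 2).
    by apply: mulr_ge0; rewrite !addr_ge0 ?sqr_ge0.
  by rewrite e; lra.
have q : (x + y + z) ^+ 3 <= (11 / 4) ^+ 3 by rewrite lerXn2r ?nnegrE ?addr_ge0 //; lra.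
have q1 : (11 / 4 : R) ^+ 3 = 1331 / 64 by field.
rewrite q1 in q; move: p q; move: ((x + y + z) ^+ 3) (x * y * z) => P Q p q; lra.
Qed.

Section Euclid.
Variables (R : realType) (F : splittingFieldType rat).
Variables (iota : {rmorphism F -> Cplx R}) (zeta : F).
Variable sigma : 'I_3 -> gal_of (realSubfield zeta).
Hypothesis hF : is_Q_zeta9 iota zeta.
Local Notation C := (Cplx R).
Local Notation u := (iota zeta).
Local Notation K := (realSubfield zeta).
Local Notation conjF := (conjF iota).
Variables (E : 'I_3 -> {rmorphism F -> C}) (k : 'I_3 -> nat).
Hypothesis Ez : forall l, E l zeta = u ^+ k l.
Hypothesis Es : forall l x, x \in K -> iota (sigma l x) = E l x.
Hypothesis Esum : forall (V : nmodType) (h : nat -> V), {in units9, forall j, h (9 - j)%N = h j} ->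
        \sum_l h (k l) = h 1%N + h 2 + h 4.
Hypothesis ku : forall l, k l \in units9.
Hypothesis Etr : forall x, iota (galTrace 1 fullv x) = trF E x.

Local Notation OK := (ringOfIntegersK zeta).

Lemma OKD x y : OK x -> OK y -> OK (x + y).
Proof. by move=> [xK xi] [yK yi]; split; [exact: rpredD|exact: integral_add]. Qed.
Lemma OKM x y : OK x -> OK y -> OK (x * y).
Proof. by move=> [xK xi] [yK yi]; split; [exact: rpredM|exact: integral_mul]. Qed.
Lemma OKint m : OK m%:~R.
Proof. by split; [exact: rpred_int|exact: (aint_int F)]. Qed.
Lemma OKN x : OK x -> OK (- x).
Proof. by move=> /(OKM (OKint (-1))); rewrite mulrN1z mulN1r. Qed.
Lemma OK1 : OK 1. Proof. exact: (OKint 1). Qed.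
Lemma OK0 : OK 0. Proof. exact: (OKint 0). Qed.

Local Notation eta1 := (zeta + zeta ^+ 8).
Local Notation eta2 := (zeta ^+ 2 + zeta ^+ 7).

Lemma OKeta : OK eta1 /\ OK eta2.
Proof.
have hz n m : (n + m = 9)%N -> OK (zeta ^+ n + zeta ^+ m).
  move=> nm; split.
    have -> : zeta ^+ m = zeta^-1 ^+ n; last exact: zetapow_K hF n.
    have z0 : zeta ^+ n != 0 by rewrite expf_neq0 // (zeta_neq0 hF).
    by apply: (mulfI z0); rewrite -exprD nm (zeta9 hF) exprVn mulfV.
  by apply: integral_add; apply: (Zin_aint hF); exact: (Zin_zeta hF).
by split; [exact: (hz 1 8)%N|exact: (hz 2 7)%N].
Qed.

(** 1, eta1, eta2 is a basis of K over Q; the third conjugate of eta1 is -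
eta1 - eta2 and zeta^3 + zeta^6 = -1. *)
Lemma K_repr x : x \in K -> exists M A B G : int, M != 0 /\
  M%:~R * x = A%:~R + B%:~R * eta1 + G%:~R * eta2.
Proof.
move=> xK; have [N N0 [a0 [a1 [a2 [a3 [a4 [a5 e]]]]]]] := denZ hF x.
exists (2 * N), (2 * a0 - a3), (a1 - a4 - a5), (a2 - a4 - a5); split; first by rewrite mulf_neq0.
have e2 : (2 * N)%:~R * x = N%:~R * x + conjF (N%:~R * x).
  by rewrite (conjFM hF) (conjF_int hF) (conjF_K hF xK) intrM; ring.
rewrite e2 e /zeta_comb -[X in conjF (_ + _ * X + _ + _ + _ + _)]expr1.
rewrite !(conjFD hF) !((conjFM hF) _%:~R) !(conjF_int hF) (@conj_zeta_n _ _ _ _ hF 1 17) // (@conj_zeta_n _ _ _ _ hF 2 16) //.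
rewrite (@conj_zeta_n _ _ _ _ hF 3 15) // (@conj_zeta_n _ _ _ _ hF 4 14) // (@conj_zeta_n _ _ _ _ hF 5 13) //.
have z9 := zeta9 hF; have z6 := zeta6 hF.
have z7 : zeta ^+ 7 = - zeta ^+ 4 - zeta by rewrite exprSr z6; ring.
have z8 : zeta ^+ 8 = - zeta ^+ 5 - zeta ^+ 2 by rewrite exprSr z7; ring.
rewrite (_ : 17 = 9 + 8)%N // (_ : 16 = 9 + 7)%N // (_ : 15 = 9 + 6)%N // (_ : 14 = 9 + 5)%N // (_ : 13 = 9 + 4)%N //.
rewrite !exprD z9 z8 z7 z6 !intrB !intrM; ring.
Qed.

Lemma E_sq l x : x \in K -> RC (md (E l x) ^+ 2) = E l (x ^+ 2).
Proof.
move=> xK; rewrite -mulconj -(E_conj hF Ez) (conjF_K hF xK) rmorphXn /= expr2 //.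
Qed.

(** The trace form of K is 3 A^2 plus six times the hexagonal form; the trace
from F is its double. *)
Lemma Tr_sq (A B G : int) (x := A%:~R + B%:~R * eta1 + G%:~R * eta2) :
  trF E (x ^+ 2) = (2 * (3 * A ^+ 2 + 6 * (B ^+ 2 - B * G + G ^+ 2)))%:~R.
Proof.
(* x ^+ 2 on the powers of zeta *)
pose s : seq int := [:: A ^+ 2 + 2 * B ^+ 2 + 2 * G ^+ 2; 2 * A * B + 2 * B * G; B ^+ 2 + 2 * A * G; 2 * B * G;
  G ^+ 2; G ^+ 2; 2 * B * G; B ^+ 2 + 2 * A * G; 2 * A * B + 2 * B * G].
have -> : x ^+ 2 = zeta_poly zeta s 0.
  have z9 := zeta9 hF.
  have h1 : eta1 ^+ 2 = zeta ^+ 2 + 2 + zeta ^+ 7.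
    have -> : eta1 ^+ 2 = zeta ^+ 2 + 2 * zeta ^+ 9 + zeta ^+ 9 * zeta ^+ 7 by ring.
    by rewrite z9; ring.
  have h2 : eta2 ^+ 2 = zeta ^+ 4 + 2 + zeta ^+ 5.
    have -> : eta2 ^+ 2 = zeta ^+ 4 + 2 * zeta ^+ 9 + zeta ^+ 9 * zeta ^+ 5 by ring.
    by rewrite z9; ring.
  have h3 : eta1 * eta2 = zeta ^+ 3 + zeta ^+ 8 + zeta + zeta ^+ 6.
    have -> : eta1 * eta2 = zeta ^+ 3 + zeta ^+ 8 + zeta ^+ 9 * zeta + zeta ^+ 9 * zeta ^+ 6 by ring.
    by rewrite z9; ring.
  have -> : x ^+ 2 = A%:~R ^+ 2 + B%:~R ^+ 2 * eta1 ^+ 2 + G%:~R ^+ 2 * eta2 ^+ 2 + 2 * A%:~R * B%:~R * eta1 +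
     2 * A%:~R * G%:~R * eta2 + 2 * B%:~R * G%:~R * (eta1 * eta2) by rewrite /x; ring.
  by rewrite h1 h2 h3 /zeta_poly /s !intrD !intrM; ring.
rewrite (Tr_ev hF Ez Esum ku) /tr_zeta_poly /s /tr_zeta_pow /=; congr (_%:~R); ring.
Qed.

(** Z_K is norm-Euclidean: rounding in the lattice Z + A_2 leaves a trace of
squares at most 3/4 + 2 = 11/4 < 3, and the arithmetic-geometric inequality
bounds the norm. *)
Lemma euclidK x : x \in K -> exists2 be, OK be & \prod_l md (E l (x + be)) < 1.
Proof.
move=> xK; have [M [A [B [G [M0 hM]]]]] := K_repr xK.
have MR : (M%:~R : R) != 0 by rewrite intr_eq0.
have [m1 [m2 h12]] := A2_cover (B%:~R / M%:~R : R) (G%:~R / M%:~R : R).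
pose m0 : int := Num.floor (A%:~R / M%:~R + 1 / 2 : R).
have h0 : (A%:~R / M%:~R - m0%:~R : R) ^+ 2 <= 1 / 4.
  have a1 := ge_floor (A%:~R / M%:~R + 1 / 2 : R); have := floorD1_gt (A%:~R / M%:~R + 1 / 2 : R).
  rewrite intrD -/m0 => a2; rewrite -/m0 in a1; nra.
have [e1O e2O] := OKeta.
pose be : F := - (m0%:~R + m1%:~R * eta1 + m2%:~R * eta2).
have bO : OK be.
  apply: OKN; apply: OKD; last by apply: OKM => //; exact: OKint.
  by apply: OKD; [exact: OKint|apply: OKM => //; exact: OKint].
exists be => //; set y := x + be.
have yK : y \in K by rewrite rpredD //; case: bO.
have eM : M%:~R * y = (A - m0 * M)%:~R + (B - m1 * M)%:~R * eta1 + (G - m2 * M)%:~R * eta2.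
  by rewrite mulrDr hM /be !intrB !intrM; ring.
have hs : \sum_l md (E l y) ^+ 2 <= 11 / 4.
  have : RC (\sum_l md (E l y) ^+ 2) = RC (3 * (A%:~R / M%:~R - m0%:~R) ^+ 2 +
     6 * ((B%:~R / M%:~R - m1%:~R) ^+ 2 - (B%:~R / M%:~R - m1%:~R) * (G%:~R / M%:~R - m2%:~R) + (G%:~R / M%:~R - m2%:~R) ^+ 2)).
    have M2 : RC (M%:~R ^+ 2 : R) != 0 by rewrite /RC fmorph_eq0 expf_neq0.
    apply: (mulfI M2); rewrite RC_sum (eq_bigr (fun l => E l (y ^+ 2))); last by move=> l _; exact: E_sq.
    have two0 : (2 : C) != 0 by rewrite pnatr_eq0.
    have hM2 : RC (M%:~R ^+ 2 : R) * (\sum_l E l (y ^+ 2)) = \sum_l E l ((M%:~R * y) ^+ 2).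
      rewrite mulr_sumr; apply: eq_bigr => l _; rewrite [in RHS]exprMn [in RHS]rmorphM; congr (_ * _).
      by rewrite rmorphXn /= rmorph_int /RC rmorphXn /= rmorph_int.
    apply: (mulfI two0); rewrite hM2 -RCM -(RCn R 2) -RCM.
    have -> : RC 2%:R * (\sum_l E l ((M%:~R * y) ^+ 2)) = trF E ((M%:~R * y) ^+ 2).
      rewrite /trF mulr_sumr; apply: eq_bigr => l _.
      rewrite -(E_conj hF Ez) (conjF_K hF) ?RCn; first by rewrite mulrDl mul1r.
      by rewrite rpredX // rpredM // rpred_int.
    rewrite eM Tr_sq -(rmorph_int (real_complex R)); congr RC.
    rewrite !expr2 !(intrM, intrD, mulrNz).
    by field.
  by move=> /(@complexI R) ->; lra.
suff h2 : \prod_l md (E l y) ^+ 2 < 1.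
  have p0 : 0 <= \prod_l md (E l y) by apply: prodr_ge0 => l _; exact: md_ge0.
  rewrite prodrXl in h2; rewrite ltNge; apply/negP => h1.
  by move: h2; rewrite ltNge exprn_ege1.
rewrite !big_ord_recl big_ord0 mulr1 mulrA; apply: amgm3; try exact: sqr_ge0.
by move: hs; rewrite !big_ord_recl big_ord0 addr0 addrA.
Qed.

(** The norm is an algebraic integer, and Newton identities show that six
times it is an integer. *)
Lemma norm_int x : OK x -> exists m : int, \prod_l E l x = m%:~R.
Proof.
move=> [xK xi]; have two0 : (2 : C) != 0 by rewrite pnatr_eq0.
have hp n : exists m : int, \sum_l E l x ^+ n = m%:~R.
  have cx : conjF (x ^+ n) = x ^+ n by rewrite (conjF_K hF) ?rpredX.
  have [m hm] := Tr_even hF Ez Esum ku (aintX n xi) cx.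
  exists m; apply: (mulfI two0); rewrite -[X in _ = X * _]/(2%:~R) -intrM -hm /trF mulr_sumr.
  by apply: eq_bigr => l _; rewrite -(E_conj hF Ez) cx rmorphXn /= mulrDl mul1r.
have [m1 h1] := hp 1%N; have [m2 h2] := hp 2%N; have [m3 h3] := hp 3%N.
apply: (@int_of_aint _ _ 6 (m1 ^+ 3 - 3 * m1 * m2 + 2 * m3)) => //.
  rewrite !(intrD, intrM, mulrNz) -h1 -h2 -h3 !big_ord_recl !big_ord0.
  set X := E _ x; set Y := E _ x; set Z := E _ x.
  ring.
by rewrite !big_ord_recl big_ord0; do !apply: integral_mul; try exact: mxpoly.integral1; exact: (E_aint E).
Qed.

(** Stated on entries: right multiplication by S and T^be maps (a, b, c, d) to
(b, -a, d, -c) and (a, a be + b, c, c be + d). The Euclidean algorithm on the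
bottom row (c, d) leads to (0, u) with u a unit, and a few more steps to (0,
1). *)
Theorem SL2_ind (P : F -> F -> F -> F -> Prop) :
  (forall b, OK b -> P 1 b 0 1) ->
  (forall a b c d, OK a -> OK b -> OK c -> OK d -> a * d - b * c = 1 -> P a b c d -> P b (- a) d (- c)) ->
  (forall a b c d be, OK a -> OK b -> OK c -> OK d -> OK be -> a * d - b * c = 1 ->
     P a b c d -> P a (a * be + b) c (c * be + d)) ->
  forall a b c d, OK a -> OK b -> OK c -> OK d -> a * d - b * c = 1 -> P a b c d.
Proof.
move=> hB hS hT.
have bS a b c d : OK a -> OK b -> OK c -> OK d -> a * d - b * c = 1 -> P b (- a) d (- c) -> P a b c d.
  move=> aO bO cO dO det h.
  have det2 : b * (- c) - (- a) * d = 1 by rewrite -det; ring.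
  have det3 : (- a) * (- d) - (- b) * (- c) = 1 by rewrite -det; ring.
  have det4 : (- b) * c - a * (- d) = 1 by rewrite -det; ring.
  have := hS _ _ _ _ bO (OKN aO) dO (OKN cO) det2 h.
  move=> /(hS _ _ _ _ (OKN aO) (OKN bO) (OKN cO) (OKN dO) det3).
  rewrite !opprK => h3; have := hS _ _ _ _ (OKN bO) aO (OKN dO) cO det4 h3.
  by rewrite !opprK.
have bT a b c d be : OK a -> OK b -> OK c -> OK d -> OK be -> a * d - b * c = 1 ->
    P a (a * be + b) c (c * be + d) -> P a b c d.
  move=> aO bO cO dO beO det h.
  have det2 : a * (c * be + d) - (a * be + b) * c = 1 by rewrite -det; ring.
  have := hT _ _ _ _ (- be) aO (OKD (OKM aO beO) bO) cO (OKD (OKM cO beO) dO) (OKN beO) det2 h.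
  have -> : a * - be + (a * be + b) = b by ring.
  by have -> : c * - be + (c * be + d) = d by ring.
have h0 a b d : OK a -> OK b -> OK d -> a * d = 1 -> P a b 0 d.
  move=> aO bO dO ad; have O0 := OK0; have O1 := OK1.
  have e1 : a * d - b * 0 = 1 by rewrite mulr0 subr0.
  apply: (bS) => //; rewrite oppr0.
  apply: (bT _ _ _ _ a) => //; [exact: OKN|by rewrite mulr0 mulNr opprK add0r|].
  have -> : d * a + 0 = 1 by rewrite addr0 mulrC.
  set b' := b * a + - a; have b'O : OK b' by apply: OKD; [exact: OKM|exact: OKN].
  have e2 : b * 1 - b' * d = 1.
    have -> : b * 1 - b' * d = b - b * (a * d) + a * d by rewrite /b'; ring.
    by rewrite ad; ring.
  apply: (bS) => //; apply: (bT _ _ _ _ d) => //; try exact: OKN; first by rewrite -[RHS]e2; ring.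
  have -> : 1 * d + - d = 0 by ring.
  have -> : b' * d + - b = -1.
    have -> : b' * d + - b = - (b * 1 - b' * d) by ring.
    by rewrite e2.
  have O1' : OK (-1) by exact: OKN.
  apply: (bS) => //; first by ring.
  apply: (bS) => //; [exact: OKN|by ring|].
  rewrite oppr0 opprK.
  apply: (bS) => //; try exact: OKN; first by ring.
  by rewrite !opprK; exact: hB b'O.
have H n : forall a b c d, OK a -> OK b -> OK c -> OK d -> a * d - b * c = 1 ->
    (exists2 m : int, \prod_l E l c = m%:~R & (absz m < n)%N) -> P a b c d.
  elim: n => [|n IH] a b c d aO bO cO dO det [m hm mn] //.
  have [c0|c0] := eqVneq c 0.
    by move: det; rewrite c0 mulr0 subr0 => ad; exact: h0.
  have [be beO hbe] := @euclidK (d / c) (rpredM dO.1 (rpredVr cO.1)).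
  apply: (bT _ _ _ _ be) => //; apply: (bS) => //; try (by apply: OKD => //; exact: OKM).
    by rewrite -det; ring.
  apply: IH; try exact: OKN; try exact: OKD; try (by apply: OKD => //; exact: OKM) => //.
    by rewrite -det; ring.
  have [m' hm'] := norm_int (OKD (OKM cO beO) dO); exists m' => //.
  have lt1 : md (\prod_l E l (c * be + d)) < md (\prod_l E l c).
    have -> : c * be + d = c * (d / c + be) by field.
    rewrite !md_prod (eq_bigr (fun l => md (E l c) * md (E l (d / c + be)))); last by move=> l _; rewrite rmorphM mdM.
    rewrite big_split /= gtr_pMr //; apply: prodr_gt0 => l _.
    by rewrite lt0r md_ge0 andbT md_eq0 fmorph_eq0.
  have mdz (z : int) : md (z%:~R : C) = (absz z)%:R.
    by rewrite -(rmorph_int (real_complex R)) mdRC natr_absz intr_norm.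
  move: lt1; rewrite hm hm' !mdz ltr_nat => lt1; exact: leq_trans lt1 _.
move=> a b c d aO bO cO dO det; have [m hm] := norm_int cO.
by apply: (H (absz m).+1) => //; exists m.
Qed.

End Euclid.

(** * The action of SL_2 on the two theta series *)

Section Modular.
Variables (R : realType) (F : splittingFieldType rat).
Variables (iota : {rmorphism F -> Cplx R}) (zeta : F).
Variable sigma : 'I_3 -> gal_of (realSubfield zeta).
Hypothesis hF : is_Q_zeta9 iota zeta.
Local Notation C := (Cplx R).
Local Notation u := (iota zeta).
Local Notation K := (realSubfield zeta).
Variables (E : 'I_3 -> {rmorphism F -> C}) (k : 'I_3 -> nat).
Hypothesis Ez : forall l, E l zeta = u ^+ k l.
Hypothesis Es : forall l x, x \in K -> iota (sigma l x) = E l x.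
Hypothesis Esum : forall (V : nmodType) (h : nat -> V), {in units9, forall j, h (9 - j)%N = h j} ->
        \sum_l h (k l) = h 1%N + h 2 + h 4.
Hypothesis ku : forall l, k l \in units9.
Hypothesis Etr : forall x, iota (galTrace 1 fullv x) = trF E x.

Local Notation TH := (coset_theta zeta E).
Local Notation H3 := (@upperHalfPlane3 R).
Local Notation OK := (ringOfIntegersK zeta).
Local Notation NN := (@norm_z R).
Local Notation Sz := (@inv_z R).
Local Notation Tz := (@shift_z R F E).
Local Notation om := (omega3 R).
Local Notation Res := (residue zeta).
Local Notation W := (om ^+ 2).

(** The action and its factor of automorphy, in terms of the embeddings E_l,
for matrices given by their entries. *)
Definition moebiusE (a b c d : F) (z : 'rV[C]_3) : 'rV[C]_3 :=
  \row_l ((E l a * z 0 l + E l b) / (E l c * z 0 l + E l d)).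
Definition factorE (c d : F) (z : 'rV[C]_3) : C := \prod_l (E l c * z 0 l + E l d).

Lemma mob_S a b c d z : H3 z -> moebiusE b (- a) d (- c) z = moebiusE a b c d (Sz z).
Proof.
move=> hz; apply/rowP => l; rewrite !mxE; have z0 := H3_neq0 hz l.
rewrite !rmorphN.
have -> : E l a * - (z 0 l)^-1 + E l b = (E l b * z 0 l - E l a) / z 0 l by field.
have -> : E l c * - (z 0 l)^-1 + E l d = (E l d * z 0 l - E l c) / z 0 l by field.
by rewrite invf_div mulrA divfK.
Qed.

Lemma nf_S c d z : H3 z -> factorE d (- c) z = factorE c d (Sz z) * NN z.
Proof.
move=> hz; rewrite /factorE /norm_z -big_split /=; apply: eq_bigr => l _.
by rewrite !mxE rmorphN /=; have z0 := H3_neq0 hz l; field.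
Qed.

Lemma mob_T a b c d be z : moebiusE a (a * be + b) c (c * be + d) z = moebiusE a b c d (Tz be z).
Proof.
apply/rowP => l; rewrite !mxE; congr (_ / _); rewrite rmorphD rmorphM /=; ring.
Qed.

Lemma nf_T c d be z : factorE c (c * be + d) z = factorE c d (Tz be z).
Proof. by apply: eq_bigr => l _; rewrite !mxE rmorphD rmorphM /=; ring. Qed.

Lemma mob_1 b z : moebiusE 1 b 0 1 z = Tz b z.
Proof. by apply/rowP => l; rewrite !mxE !rmorph1 rmorph0 !mul1r mul0r add0r divr1. Qed.

Lemma nf_1 z : factorE 0 1 z = 1.
Proof. by rewrite /factorE big1 // => l _; rewrite rmorph0 rmorph1 mul0r add0r. Qed.

Lemma OK_H3_Tz be z : OK be -> H3 z -> H3 (Tz be z).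
Proof. by case=> bK _; exact: (H3_Tz hF Ez). Qed.

Section Fixed.
Variable c0 : C.
Hypothesis hc1 : c0 * (1 - W) = om.
Hypothesis hc2 : 3 * c0 ^+ 2 = -1.
Hypothesis hST : forall z, H3 z -> TH 0 (Sz z) = c0 * NN z * (TH 0 z + 2 * TH 1 z) /\
                    TH 1 (Sz z) = c0 * NN z * (TH 0 z - TH 1 z).

(** The character by which translations of residue e act on theta_1. *)
Definition chi (e : int) : C := ee (2 * e%:~R / 3 : R).

Lemma chiD e f : chi (e + f) = chi e * chi f.
Proof. by rewrite /chi -eeD; congr ee; rewrite intrD; field. Qed.
Lemma chi_mod e f : (exists m, f = e + 3 * m) -> chi f = chi e.
Proof.
move=> [m ->]; rewrite /chi -[RHS](eeDZ _ (2 * m)); congr ee; rewrite !(intrD, intrM).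
by field.
Qed.
Lemma chi0 : chi 0 = 1. Proof. by rewrite /chi mulr0 mul0r ee0. Qed.
Lemma chi1 : chi 1 = W.
Proof. by rewrite /chi /omega3 -eeMn mulr1. Qed.
Lemma chiN1 : chi (-1) = om.
Proof.
rewrite (_ : chi (-1) = chi 2); last by apply: chi_mod; exists (-1).
have [w3 _ _ _] := omE R.
by rewrite (_ : 2 = 1 + 1) // chiD chi1 -exprD (_ : 2 + 2 = 3 + 1)%N // exprD w3 mul1r.
Qed.

(** The relation S D^e S = e D^-e S D^-e with D = diag(1, chi 1), in terms of
entries; it is where c0 (1 - omega3^2) = omega3 is used. *)
Lemma chi_rel e : e = 1 \/ e = -1 ->
  [/\ c0 * (1 + 2 * chi e) = e%:~R, c0 * (1 - chi e) = e%:~R * chi (- e) &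
      1 + chi e + chi (- e) = 0].
Proof.
have [w3 WE _ _] := omE R.
have n1 : 1 - W != 0.
  apply/eqP => h; have := hc1; rewrite h mulr0 => /esym/eqP; apply/negP; exact: ee_neq0.
have k1 : c0 * (1 + 2 * W) = 1.
  apply: (mulIf n1); rewrite mulrAC hc1 mul1r.
  have -> : om * (1 + 2 * W) = om + 2 * om ^+ 3 by ring.
  by rewrite w3 WE; ring.
have k2 : c0 * (1 - om) = - W.
  apply: (mulIf n1); rewrite mulrAC hc1 mulrBr mulr1.
  have -> : - W * (1 - W) = - W + om ^+ 3 * om by ring.
  by rewrite w3; ring.
move=> [->|->]; rewrite ?opprK ?chi1 ?chiN1 ?mulrN1z ?mulr1z; split.
- exact: k1.
- by rewrite mul1r.
- by rewrite WE; ring.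
- have -> : 1 + 2 * om = - (1 + 2 * W) by rewrite WE; ring.
  by rewrite mulrN k1.
- by rewrite k2 mulN1r.
- by rewrite WE; ring.
Qed.

Lemma coset_theta_chi be r z : H3 z -> OK be -> Res be r ->
  TH 0 (Tz be z) = TH 0 z /\ TH 1 (Tz be z) = chi r * TH 1 z.
Proof.
move=> hz hbe hr; have h a := coset_theta_shift hF Ez Esum ku a hz hbe hr.
by rewrite !h /coset_res /= !mulr0 !mulr1 mul0r ee0 mul1r.
Qed.

(** Representatives of Z/3, for which the class 1 or -1 of a unit is itself
the sign that occurs in the action. *)
Definition small_res (a : int) := (a == 0) || (a == 1) || (a == -1).

Lemma small_ex (m : int) : exists2 a, small_res a & exists k, a = m + 3 * k.
Proof.
have h := divz_eq m 3; set q := (m %/ 3)%Z in h; set r := (m %% 3)%Z in h.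
have r0 : 0 <= r by apply: modz_ge0.
have r3 : r < 3 by apply: ltz_pmod.
have [r2|r2] := ltP r 2; last by exists (-1) => //; exists (- q - 1); lia.
by exists r; [rewrite /small_res; lia|exists (- q); lia].
Qed.

(** The Weil representation of SL_2(F_3) on the pair (x, y) = (theta_0,
theta_1): with D = diag(1, chi 1), a matrix acts by d D^(b d) if c = 0 and by
c D^(a c) S D^(d c) otherwise. *)
Definition weil (ra rb rc rd : int) (N x y x' y' : C) : Prop :=
  if rc == 0 then x' = N * (rd%:~R * x) /\ y' = N * (rd%:~R * chi (rb * rd) * y)
  else x' = N * (rc%:~R * c0 * (x + 2 * chi (rd * rc) * y)) /\
       y' = N * (rc%:~R * chi (ra * rc) * c0 * (x - chi (rd * rc) * y)).

Definition has_weil_action (a b c d : F) := exists ra rb rc rd : int,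
  [/\ [/\ small_res ra, small_res rb, small_res rc & small_res rd],
      [/\ Res a ra, Res b rb, Res c rc & Res d rd],
      (exists j, ra * rd - rb * rc = 1 + 3 * j) &
      forall z, H3 z -> H3 (moebiusE a b c d z) /\
        weil ra rb rc rd (factorE c d z) (TH 0 z) (TH 1 z) (TH 0 (moebiusE a b c d z)) (TH 1 (moebiusE a b c d z))].

Lemma OK_Res x : OK x -> exists2 r, small_res r & Res x r.
Proof.
move=> [_ xi]; have [m hm] := Zin_Res hF (Zin_of_aint hF Ez Esum ku xi).
by have [a sa [k' ek]] := small_ex m; exists a => //; apply: (residue_mod hF) hm _; exists k'.
Qed.

(** The formula of weil is compatible with right multiplication by the
generators; when neither c nor d vanishes modulo 3, this is chi_rel for e = c
d. *)
Lemma weil_action_SL2 a b c d : OK a -> OK b -> OK c -> OK d -> a * d - b * c = 1 -> has_weil_action a b c d.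
Proof.
apply: (SL2_ind hF Ez Esum ku) => {a b c d}.
- move=> b hb; have [rb sb hrb] := OK_Res hb.
  exists 1, rb, 0, 1; split=> //.
  + by split=> //; [exact: (residue_int zeta 1)|exact: (residue_int zeta 0)|exact: (residue_int zeta 1)].
  + by exists 0; rewrite mulr0 mulr1.
  move=> z hz; rewrite mob_1 nf_1; split; first exact: OK_H3_Tz.
  have [-> ->] := coset_theta_chi hz hb hrb.
  by rewrite /weil eqxx !mul1r mulr1.
- move=> a b c d aO bO cO dO det [ra [rb [rc [rd [[sa sb sc sd] [ha hb hc hd] [j hj] h]]]]].
  exists rb, (- ra), rd, (- rc); split.
  + by split=> //; move: sa sb sc sd; rewrite /small_res; lia.
  + by split=> //; exact: residueN.
  + by exists j; rewrite -hj; ring.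
  move=> z hz; rewrite (mob_S _ _ _ _ hz) (nf_S _ _ hz).
  have [h1 h2] := h _ (H3_Sz hz); split=> //.
  move: h2; have [-> ->] := hST hz; set x := TH 0 z; set y := TH 1 z.
  set x' := TH 0 _; set y' := TH 1 _; set N := factorE _ _ _; set M := NN z.
  rewrite /weil; have [rc0|rc0] := eqVneq rc 0.
    have rd0 : rd != 0 by apply/eqP => e; move: hj; rewrite rc0 e; lia.
    rewrite (negbTE rd0) rc0 => -[-> ->]; rewrite oppr0 mul0r chi0.
    by split; ring.
  have [rd0|rd0] := eqVneq rd 0.
    rewrite rd0 mul0r chi0 mulrNN => -[-> ->].
    have e3 : c0 * c0 * 3 = -1 by rewrite -hc2; ring.
    split.
      transitivity (N * M * rc%:~R * (c0 * c0 * 3) * x); first by ring.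
      by rewrite e3 intrN; ring.
    transitivity (N * M * rc%:~R * chi (ra * rc) * (c0 * c0 * 3) * y); first by ring.
    by rewrite e3 intrN; ring.
  have rcd : rd * rc = 1 \/ rd * rc = -1 by move: sc sd rc0 rd0; rewrite /small_res; nia.
  have [k1 k2 k3] := chi_rel rcd.
  have rc2 : rc * rc = 1 by move: sc rc0; rewrite /small_res; nia.
  have rd2 : rd * rd = 1 by move: sd rd0; rewrite /small_res; nia.
  set e := rd * rc in rcd k1 k2 k3 *.
  have ec : rc%:~R * e%:~R = rd%:~R :> C by rewrite -intrM /e mulrCA rc2 mulr1.
  have -> : - rc * rd = - e by rewrite /e; ring.
  have e4 : c0 * (2 + chi e) = e%:~R * (1 + chi (- e)) by rewrite [RHS]mulrDr mulr1 -k2 -k1; ring.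
  have k4 : 1 + chi (- e) = - chi e by apply/eqP; rewrite -addr_eq0 addrAC k3.
  have kk : chi e * chi (- e) = 1 by rewrite -chiD subrr chi0.
  have kab : chi (rb * rd) = chi (ra * rc) * chi (- e).
    rewrite -chiD; apply: chi_mod; have ee2 : e * e = 1 by rewrite /e mulrACA rc2 rd2.
    have : e * (ra * rd - rb * rc) = ra * rc * (rd * rd) - rb * rd * (rc * rc) by rewrite /e; ring.
    rewrite hj rc2 rd2 !mulr1 => h3; exists (- (e * j)); lia.
  move=> [-> ->]; split.
    transitivity (N * M * rc%:~R * c0 * (c0 * (1 + 2 * chi e) * x + 2 * (c0 * (1 - chi e)) * y)); first by ring.
    rewrite k1 k2; transitivity (N * M * (rc%:~R * e%:~R) * c0 * (x + 2 * chi (- e) * y)); first by ring.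
    by rewrite ec; ring.
  transitivity (N * M * rc%:~R * chi (ra * rc) * c0 * (c0 * (1 - chi e) * x + c0 * (2 + chi e) * y)); first by ring.
  rewrite k2 e4 k4 kab.
  transitivity (N * M * (rc%:~R * e%:~R) * chi (ra * rc) * c0 * (chi (- e) * x - chi e * y)); first by ring.
  rewrite ec.
  have kee : chi e = chi (- e) * chi (- e) by rewrite -chiD; apply: chi_mod; exists e; ring.
  by rewrite {1}kee; ring.
- move=> a b c d be aO bO cO dO beO det [ra [rb [rc [rd [[sa sb sc sd] [ha hb hc hd] [j hj] h]]]]].
  have [r _ hr] := OK_Res beO.
  have [rb' sb' [k1 e1]] := small_ex (ra * r + rb); have [rd' sd' [k2 e2]] := small_ex (rc * r + rd).
  exists ra, rb', rc, rd'; split.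
  + by split.
  + split=> //.
      by apply: (residue_mod hF) (residueD (residueM hF ha hr) hb) _; exists k1.
    by apply: (residue_mod hF) (residueD (residueM hF hc hr) hd) _; exists k2.
  + by exists (j + ra * k2 - k1 * rc); rewrite e1 e2; lia.
  move=> z hz; rewrite mob_T nf_T.
  have [h1 h2] := h _ (OK_H3_Tz beO hz); split=> //.
  move: h2; have [-> ->] := coset_theta_chi hz beO hr.
  rewrite /weil; have [rc0|rc0] := eqVneq rc 0.
    have rdd : rd' = rd by move: sd sd' e2; rewrite rc0 /small_res; lia.
    have rad : ra * rd = 1 by move: sa sd hj; rewrite rc0 /small_res; nia.
    rewrite rdd => -[-> ->]; split=> //.
    have -> : chi (rb' * rd) = chi (r + rb * rd).
      apply: chi_mod; exists (k1 * rd); rewrite e1.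
      have -> : (ra * r + rb + 3 * k1) * rd = (ra * rd) * r + rb * rd + 3 * (k1 * rd) by ring.
      by rewrite rad mul1r.
    by rewrite chiD; ring.
  have rc2 : rc * rc = 1 by move: sc rc0; rewrite /small_res; nia.
  have -> : chi (rd' * rc) = chi (r + rd * rc).
    apply: chi_mod; exists (k2 * rc); rewrite e2.
    have -> : (rc * r + rd + 3 * k2) * rc = (rc * rc) * r + rd * rc + 3 * (k2 * rc) by ring.
    by rewrite rc2 mul1r.
  by rewrite chiD => -[-> ->]; split; ring.
Qed.

(** For residues (1, 0, 0, 1) the formula of weil is the identity. *)
Lemma level_coset_theta a b c d z : OK a -> OK b -> OK c -> OK d -> a * d - b * c = 1 ->
  Res a 1 -> Res b 0 -> Res c 0 -> Res d 1 -> H3 z ->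
  H3 (moebiusE a b c d z) /\ forall i : 'I_3, (i < 2)%N -> TH i (moebiusE a b c d z) = factorE c d z * TH i z.
Proof.
move=> aO bO cO dO det ha hb hc hd hz.
have [ra [rb [rc [rd [[sa sb sc sd] [ha' hb' hc' hd'] _ h]]]]] := weil_action_SL2 aO bO cO dO det.
have [h1 h2] := h _ hz; split=> //.
have [m1 e1] := residue_uniq hF E hd hd'; have [m2 e2] := residue_uniq hF E hc hc'; have [m3 e3] := residue_uniq hF E hb hb'.
have rc0 : rc = 0 by move: sc; rewrite /small_res; lia.
have rd1 : rd = 1 by move: sd; rewrite /small_res; lia.
have rb0 : rb = 0 by move: sb; rewrite /small_res; lia.
move: h2; rewrite /weil rc0 eqxx rd1 rb0 mul0r chi0 !mul1r => -[t0 t1] i i2.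
case: (ord3P i) i2 => -> //.
Qed.

End Fixed.
End Modular.

(** * The theta function of a self-dual code *)

Section Code.
Variables (R : realType) (F : splittingFieldType rat).
Variables (iota : {rmorphism F -> Cplx R}) (zeta : F).
Variable sigma : 'I_3 -> gal_of (realSubfield zeta).
Hypothesis hF : is_Q_zeta9 iota zeta.
Local Notation C := (Cplx R).
Local Notation u := (iota zeta).
Local Notation K := (realSubfield zeta).
Variables (E : 'I_3 -> {rmorphism F -> C}) (k : 'I_3 -> nat).
Hypothesis Ez : forall l, E l zeta = u ^+ k l.
Hypothesis Es : forall l x, x \in K -> iota (sigma l x) = E l x.
Hypothesis Esum : forall (V : nmodType) (h : nat -> V), {in units9, forall j, h (9 - j)%N = h j} ->
        \sum_l h (k l) = h 1%N + h 2 + h 4.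
Hypothesis ku : forall l, k l \in units9.
Hypothesis Etr : forall x, iota (galTrace 1 fullv x) = trF E x.

Local Notation TH := (coset_theta zeta E).
Local Notation H3 := (@upperHalfPlane3 R).
Local Notation OK := (ringOfIntegersK zeta).
Local Notation NN := (@norm_z R).
Local Notation Sz := (@inv_z R).
Local Notation Tz := (@shift_z R F E).
Local Notation Uz := (@inv_shift_z R F E).
Local Notation zi := (@point_i R).
Local Notation om := (omega3 R).
Local Notation W := (om ^+ 2).
Local Notation mob := (moebiusE E).
Local Notation nf := (factorE E).

Variable c0 : C.
Hypothesis hST : forall z, H3 z -> TH 0 (Sz z) = c0 * NN z * (TH 0 z + 2 * TH 1 z) /\
                    TH 1 (Sz z) = c0 * NN z * (TH 0 z - TH 1 z).

(** The additive character of F_3, as a power of omega3. *)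
Definition addchar (a : 'F_3) : C := om ^+ (a : nat).

Lemma addcharD a b : addchar (a + b) = addchar a * addchar b.
Proof. by rewrite /addchar -exprD /= expr_mod //; have [] := omE R. Qed.

Lemma addchar0 : addchar 0 = 1. Proof. by rewrite /addchar expr0. Qed.
Lemma addchar_neq1 a : a != 0 -> addchar a != 1.
Proof.
have [w3 WE wi _] := omE R; have w1 : om != 1 by apply/eqP => h; move: wi; rewrite h ltxx.
case: (F3P a) => ->; rewrite ?eqxx // => _; rewrite /addchar.
apply/eqP => h; have : om ^+ 3 = om by rewrite exprSr; have -> : W = 1 := h; rewrite mul1r.
by rewrite w3 => /eqP; rewrite eq_sym (negbTE w1).
Qed.

Lemma addchar_sum (I : Type) (r : seq I) (f : I -> 'F_3) : addchar (\sum_(i <- r) f i) = \prod_(i <- r) addchar (f i).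
Proof. by elim/big_rec2: _ => [|i y z _ <-]; [exact: addchar0|exact: addcharD]. Qed.

Lemma sumF3 (h : 'F_3 -> C) : \sum_b h b = h 0 + h 1 + h (-1).
Proof.
rewrite (bigD1 0) // (bigD1 1) //= (bigD1 (-1)) //= big1 ?addr0 ?addrA //.
by move=> i; case: (F3P i) => ->.
Qed.

(** In terms of the three cosets, inversion is the Fourier transform on F_3.
*)
Lemma coset_theta_inv a z : H3 z -> TH (coset_of a) (Sz z) = c0 * NN z * \sum_b addchar (a * b) * TH (coset_of b) z.
Proof.
move=> hz; rewrite sumF3 mulr0 mulr1 addchar0 mul1r.
have [w3 WE _ _] := omE R; have [h0 h1] := hST hz.
have I0 : coset_of 0 = 0 by []. have I1 : coset_of 1 = 1 by []. have I2 : coset_of (-1) = 2 by [].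
have X1 : addchar 1 = om by []. have X2 : addchar (-1) = W by [].
have t2 := coset_theta_opp hF Ez Esum ku hz; have t2S := coset_theta_opp hF Ez Esum ku (H3_Sz hz).
case: (F3P a) => ->.
- by rewrite !mul0r addchar0 I0 I1 I2 t2 h0; ring.
- by rewrite mul1r X1 X2 I0 I1 I2 t2 h1 WE; ring.
- by rewrite mulN1r opprK X1 X2 I0 I1 I2 t2 t2S h1 WE; ring.
Qed.

Variables (n : nat) (Cd : {vspace 'rV['F_3]_n}).
Hypothesis hC : euclideanSelfDual Cd.

Definition code_theta z : C := \sum_(v : 'rV['F_3]_n | v \in Cd) \prod_i TH (coset_of (v 0 i)) z.

(** A code word contributes the factor chi (r sum_i v_i^2), and sum_i v_i^2 =
0 by self-orthogonality. *)
Lemma code_theta_shift be z : H3 z -> OK be -> code_theta (Tz be z) = code_theta z.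
Proof.
move=> hz beO; apply: eq_bigr => v vC.
have [r _ hr] := OK_Res hF Ez Esum ku beO.
rewrite (eq_bigr (fun i => ee (2 * (r * coset_res (coset_of (v 0 i)) * coset_res (coset_of (v 0 i)))%:~R / 3 : R) * TH (coset_of (v 0 i)) z)); last first.
  by move=> i _; exact: (coset_theta_shift hF Ez Esum ku (coset_of (v 0 i)) hz beO hr).
rewrite big_split /= -[RHS]mul1r; congr (_ * _).
pose S := \sum_i coset_res (coset_of (v 0 i)) * coset_res (coset_of (v 0 i)).
have S3 : (3 %| S)%Z.
  rewrite (dvdz_pcharf (pchar_Fp (isT : prime 3))) /S rmorph_sum /=.
  have [/(_ vC) h _] := hC v; have := h v vC => h0.
  rewrite -[X in _ == X]h0; apply/eqP; apply: eq_bigr => i _.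
  by rewrite intrM !rs_Ix.
have [m hm] := dvdzP S3.
have -> : \prod_i ee (2 * (r * coset_res (coset_of (v 0 i)) * coset_res (coset_of (v 0 i)))%:~R / 3 : R) = ee (2 * (r * S)%:~R / 3 : R).
  rewrite -ee_sum; congr ee; rewrite /S mulr_sumr rmorph_sum /= mulr_sumr mulr_suml.
  by apply: eq_bigr => i _; rewrite mulrA.
have -> : 2 * (r * S)%:~R / 3 = (2 * (r * m))%:~R :> R.
  by rewrite hm !intrM -[3%:~R]/(3 : R) -[2%:~R]/(2 : R); field.
exact: eeZ.
Qed.

(** Orthogonality of characters on the code, which is its own dual. *)
Lemma dual_sum (w : 'rV['F_3]_n) :
  \sum_(v : 'rV['F_3]_n | v \in Cd) addchar (\sum_i v 0 i * w 0 i) =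
  if w \in Cd then \sum_(v : 'rV['F_3]_n | v \in Cd) 1 else 0.
Proof.
case: ifP => wC.
  apply: eq_bigr => v vC; have [/(_ vC) h _] := hC v; by rewrite h // addchar0.
have [v0 v0C hv0] : exists2 v0, v0 \in Cd & \sum_i v0 0 i * w 0 i != 0.
  have nw : ~ (forall y, y \in Cd -> \sum_i w 0 i * y 0 i = 0).
    by move=> h; have [_ /(_ h)] := hC w; rewrite wC.
  have [y hy] : exists y, ~ (y \in Cd -> \sum_i w 0 i * y 0 i = 0) by apply/existsNP.
  have yC : y \in Cd by apply: contrapT => hyn; apply: hy => hyC.
  exists y => //; apply/eqP => h0; apply: hy => _; apply: etrans h0; apply: eq_bigr => i _; exact: mulrC.
set S := LHS; have : S = addchar (\sum_i v0 0 i * w 0 i) * S.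
  rewrite {1}/S (reindex_inj (addrI v0)) /= mulr_sumr; apply: eq_big => v.
    by rewrite rpredDl.
  move=> _; rewrite -addcharD -big_split /=; congr addchar; apply: eq_bigr => i _; by rewrite !mxE mulrDl.
move=> /eqP; rewrite -subr_eq0 -{1}[S]mul1r -mulrBl mulf_eq0 subr_eq0 eq_sym (negbTE (addchar_neq1 hv0)) /=.
by move=> /eqP.
Qed.

Definition code_const : C := c0 ^+ n * \sum_(v : 'rV['F_3]_n | v \in Cd) 1.

(** The MacWilliams identity for the complete weight enumerator. *)
Lemma code_theta_S0 z : H3 z -> code_theta (Sz z) = code_const * NN z ^+ n * code_theta z.
Proof.
move=> hz; rewrite /code_theta (eq_bigr (fun v : 'rV_n => (c0 * NN z) ^+ n *
   \sum_(w : 'rV['F_3]_n) addchar (\sum_i v 0 i * w 0 i) * \prod_i TH (coset_of (w 0 i)) z)); last first.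
  move=> v _; rewrite (eq_bigr (fun i => c0 * NN z * \sum_b addchar (v 0 i * b) * TH (coset_of b) z)); last first.
    by move=> i _; exact: coset_theta_inv.
  rewrite big_split /= prodr_const card_ord; congr (_ * _).
  rewrite bigA_distr_bigA /= (reindex (fun w : 'rV['F_3]_n => [ffun i => w 0 i])) /=; last first.
    exists (fun w : {ffun 'I_n -> 'F_3} => \row_i w i) => w _.
      by apply/rowP => i; rewrite mxE ffunE.
    by apply/ffunP => i; rewrite ffunE mxE.
  apply: eq_bigr => w _; rewrite addchar_sum -big_split /=; apply: eq_bigr => i _; by rewrite ffunE.
rewrite -mulr_sumr exchange_big /= /code_const exprMn.
rewrite (eq_bigr (fun w : 'rV_n => (if w \in Cd then \sum_(v : 'rV['F_3]_n | v \in Cd) 1 else 0) * \prod_i TH (coset_of (w 0 i)) z)); last first.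
  by move=> w _; rewrite -dual_sum mulr_suml.
rewrite (bigID (fun w => w \in Cd)) /= [X in _ * (_ + X)]big1 ?addr0; last first.
  by move=> w /negbTE ->; rewrite mul0r.
rewrite (eq_bigr (fun w : 'rV_n => (\sum_(v : 'rV['F_3]_n | v \in Cd) 1) * \prod_i TH (coset_of (w 0 i)) z)); last first.
  by move=> w ->.
by rewrite -mulr_sumr; ring.
Qed.

(** All terms are positive at (i, i, i). *)
Lemma code_theta_zi : code_theta zi != 0.
Proof.
have /choice[s hs] : forall a, exists s : R, TH a zi = RC s /\ 0 < s.
  by move=> a; exact: (coset_theta_zi hF Ez Esum ku).
have -> : code_theta zi = RC (\sum_(v : 'rV['F_3]_n | v \in Cd) \prod_i s (coset_of (v 0 i))).
  rewrite RC_sum; apply: eq_bigr => v _; rewrite /RC rmorph_prod; apply: eq_bigr => i _.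
  by have [-> _] := hs (coset_of (v 0 i)).
rewrite /RC fmorph_eq0 gt_eqF // (bigD1 0) ?mem0v //=.
have p v : 0 < \prod_i s (coset_of ((v : 'rV['F_3]_n) 0 i)) by apply: prodr_gt0 => i _; have [] := hs (coset_of (v 0 i)).
by rewrite ltr_pwDl // sumr_ge0 // => v _; exact: ltW.
Qed.

(** S^2 = -1 and (ST)^3 = -1 give code_const^2 = code_const^3 = (-1)^n,
evaluated at (i, i, i) where the theta function does not vanish. *)
Lemma code_const1 : code_const = 1.
Proof.
have z0H := @H3_zi R; have z1H := H3_Uz hF Ez z0H; have z2H := H3_Uz hF Ez z1H.
have [U3 N3] := U_cycle hF Ez z0H.
have O1 : OK 1 by exact: OK1.
have hU z : H3 z -> code_theta (Uz z) = code_const * NN (Tz 1 z) ^+ n * code_theta z.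
  by move=> hz; rewrite /inv_shift_z code_theta_S0 ?code_theta_shift //; exact: (OK_H3_Tz hF Ez).
have h3 : code_theta zi = code_const ^+ 3 * (-1) ^+ n * code_theta zi.
  have -> : (-1) ^+ n = NN (Tz 1 zi) ^+ n * NN (Tz 1 (Uz zi)) ^+ n * NN (Tz 1 (Uz (Uz zi))) ^+ n.
    by rewrite -N3 !exprMn.
  by rewrite -{1}U3 hU // hU // hU //; ring.
have h2 : code_theta zi = code_const ^+ 2 * (-1) ^+ n * code_theta zi.
  rewrite -{1}(SzK zi) code_theta_S0; last exact: H3_Sz.
  rewrite code_theta_S0 // NN_Sz; have -> : (-1) ^+ n = (- (NN zi)^-1) ^+ n * NN zi ^+ n.
    by rewrite -exprMn mulNr mulVf // NN_neq0.
  by ring.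
have e2 : code_const ^+ 2 * (-1) ^+ n = 1 by apply: (mulIf code_theta_zi); rewrite mul1r -h2.
have e3 : code_const ^+ 3 * (-1) ^+ n = 1 by apply: (mulIf code_theta_zi); rewrite mul1r -h3.
by rewrite -e3 exprS -mulrA e2 mulr1.
Qed.

Lemma code_theta_S z : H3 z -> code_theta (Sz z) = NN z ^+ n * code_theta z.
Proof. by move=> hz; rewrite code_theta_S0 // code_const1 mul1r. Qed.

Lemma code_theta_mob a b c d : OK a -> OK b -> OK c -> OK d -> a * d - b * c = 1 ->
  forall z, H3 z -> H3 (mob a b c d z) /\ code_theta (mob a b c d z) = nf c d z ^+ n * code_theta z.
Proof.
move: a b c d; apply: (SL2_ind hF Ez Esum ku (P := fun a b c d => forall z, H3 z ->
   H3 (mob a b c d z) /\ code_theta (mob a b c d z) = nf c d z ^+ n * code_theta z)).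
- move=> b bO z hz; rewrite mob_1 nf_1 expr1n mul1r code_theta_shift //; split=> //.
  exact: (OK_H3_Tz hF Ez).
- move=> a b c d _ _ _ _ _ h z hz; rewrite (mob_S E a b c d hz) (nf_S E c d hz).
  have [h1 h2] := h _ (H3_Sz hz); split=> //.
  by rewrite h2 code_theta_S // exprMn mulrA.
- move=> a b c d be _ _ _ _ beO _ h z hz; rewrite mob_T nf_T.
  have [h1 h2] := h _ (OK_H3_Tz hF Ez beO hz); split=> //.
  by rewrite h2 code_theta_shift.
Qed.

End Code.

(** * Holomorphy *)

Section Criterion.
Variable R : realType.
Local Notation C := (Cplx R).
Local Notation V := 'rV[C]_3.

Definition nrm (h : V) : R := complex.Re `|h|.

Lemma nrmE (h : V) : `|h| = RC (nrm h).
Proof. by rewrite /nrm /RC -[LHS]RRe_real // ger0_real. Qed.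

Lemma coord_le (h : V) l : md (h 0 l) <= nrm h.
Proof.
rewrite -RC_le -nrmE -normE [X in _ <= X]mx_normE.
exact: (le_bigmax _ (fun i : 'I_1 * 'I_3 => (`|h i.1 i.2|%:nng : {nonneg C})) (0, l)).
Qed.

(** A first order expansion with quadratic remainder; the linear part is given
by three coefficients. *)
Lemma differentiable_quad (f : V -> C) (z : V) (S : 'I_3 -> C) (dl Q : R) : 0 < dl -> 0 <= Q ->
  (forall h, nrm h < dl -> md (f (h + z) - f z - \sum_l h 0 l * S l) <= Q * nrm h ^+ 2) ->
  differentiable f z.
Proof.
move=> dl0 Q0 hq; pose df (h : V) : C := \sum_l h 0 l * S l.
have dfl : linear df.
  move=> a x y; rewrite /df scaler_sumr -big_split /=; apply: eq_bigr => l _.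
  by rewrite !mxE mulrDl -mulrA.
pose L : {linear V -> C} := HB.pack df (GRing.isLinear.Build _ _ _ _ df dfl).
have Lc : continuous L.
  have -> : (L : V -> C) = (fun h => h 0 0 * S 0 + h 0 1 * S 1 + h 0 2 * S 2).
    by apply/funext => h; rewrite /= /df !big_ord_recl big_ord0 addr0 addrA; do 2?congr (_ + _);
      congr (h _ _ * S _); apply: val_inj.
  have cc l : continuous ((fun h => h 0 l * S l) : V -> C).
    move=> x; apply: (@continuousM C V (fun h => h 0 l) (fun=> S l)); [exact: coord_continuous|exact: cst_continuous].
  move=> x; apply: (@continuousD C C V (fun h => h 0 0 * S 0 + h 0 1 * S 1) (fun h => h 0 2 * S 2)); last exact: cc.
  by apply: (@continuousD C C V (fun h => h 0 0 * S 0) (fun h => h 0 1 * S 1)); exact: cc.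
have Lo (e : C) : 0 < e -> \forall h \near (0 : V), `|f (h + z) - (f z + df h)| <= e * `|h|.
  move=> e0; have [r r0 er] : exists2 r : R, 0 < r & e = RC r.
    move: e0; rewrite ltcE /= => /andP[/eqP h0 h1]; exists (complex.Re e) => //.
    by apply/eqP; rewrite eq_complex /= h0 !eqxx.
  apply/nbhs_norm0P; exists (RC (Num.min dl (r / (Q + 1)))).
    by rewrite /= -[X in X < _](RC0 R) RC_lt lt_min dl0 divr_gt0 //; lra.
  move=> h; rewrite /= nrmE RC_lt lt_min => /andP[h1 h2].
  rewrite er -RCM normE RC_le opprD addrA; apply: le_trans (hq _ h1) _.
  have h0 : 0 <= nrm h by rewrite -RC_le -nrmE RC0 normr_ge0.
  rewrite expr2 mulrA ler_wpM2r //.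
  rewrite ltr_pdivlMr in h2; last by lra.
  by nra.
have de : 'd f z = L :> (V -> C).
  by apply: (@diff_unique C V C f L z Lc); apply/eqaddoP => e e0; exact: Lo.
apply/diff_locallyP; split; first by rewrite de.
by apply/eqaddoP => e e0; rewrite de; exact: Lo.
Qed.

Lemma near_differentiable (f g : V -> C) (z : V) (dl : R) : 0 < dl ->
  (forall h, nrm h < dl -> f (h + z) = g (h + z)) -> differentiable g z -> differentiable f z.
Proof.
move=> dl0 hfg /diff_locallyP[dc /eqaddoP dg].
have e0 : f z = g z.
  have := hfg 0; rewrite add0r; apply; rewrite /nrm normr0 //.
have Lo (e : C) : 0 < e -> \forall h \near (0 : V), `|f (h + z) - (f z + 'd g z h)| <= e * `|h|.
  have hb : \forall h \near (0 : V), nrm h < dl.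
    apply/nbhs_norm0P; exists (RC dl); first by rewrite /= -[X in X < _](RC0 R) RC_lt.
    by move=> h; rewrite /= nrmE RC_lt.
  by move=> /dg; apply: filterS2 hb => h h1 /=; rewrite hfg // e0.
have de : 'd f z = 'd g z :> (V -> C).
  by apply: (@diff_unique C V C f ('d g z) z dc); apply/eqaddoP => e ep; exact: Lo.
apply/diff_locallyP; split; first by rewrite de.
by apply/eqaddoP => e ep; rewrite de; exact: Lo.
Qed.

Lemma differentiable_bigsum (I : Type) (r : seq I) (P : pred I) (g : I -> V -> C) (z : V) :
  (forall i, differentiable (g i) z) -> differentiable (fun y => \sum_(i <- r | P i) g i y) z.
Proof.
move=> hg; elim: r => [|i r IH].
  have -> : (fun y => \sum_(i <- [::] | P i) g i y) = cst (0 : C) by apply/funext => y; rewrite big_nil.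
  exact: differentiable_cst.
have -> : (fun y => \sum_(j <- i :: r | P j) g j y) =
    if P i then (fun y => g i y + \sum_(j <- r | P j) g j y) else (fun y => \sum_(j <- r | P j) g j y).
  by apply/funext => y; rewrite big_cons; case: (P i).
by case: (P i); [exact: (@differentiableD C V C (g i) _ z (hg i) IH)|exact: IH].
Qed.

Lemma differentiable_bigprod (I : Type) (r : seq I) (P : pred I) (g : I -> V -> C) (z : V) :
  (forall i, differentiable (g i) z) -> differentiable (fun y => \prod_(i <- r | P i) g i y) z.
Proof.
move=> hg; elim: r => [|i r IH].
  have -> : (fun y => \prod_(i <- [::] | P i) g i y) = cst (1 : C) by apply/funext => y; rewrite big_nil.
  exact: differentiable_cst.
have -> : (fun y => \prod_(j <- i :: r | P j) g j y) =
    if P i then (fun y => g i y * \prod_(j <- r | P j) g j y) else (fun y => \prod_(j <- r | P j) g j y).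
  by apply/funext => y; rewrite big_cons; case: (P i).
by case: (P i); [exact: (@differentiableM C V (g i) _ z (hg i) IH)|exact: IH].
Qed.

Lemma asum_big (I : choiceType) (J : Type) (r : seq J) (g : J -> I -> C) :
  (forall j, asum (g j)) -> asum (fun i => \sum_(j <- r) g j i).
Proof.
move=> hg; elim: r => [|j r IH].
  by exists 0 => B; rewrite big1 // => i _; rewrite big_nil md0.
have -> : (fun i => \sum_(j0 <- j :: r) g j0 i) = (fun i => g j i + \sum_(j0 <- r) g j0 i).
  by apply/funext => i; rewrite big_cons.
exact: asumD.
Qed.

End Criterion.

Section Holomorphy.
Variables (R : realType) (F : splittingFieldType rat).
Variables (iota : {rmorphism F -> Cplx R}) (zeta : F).
Variable sigma : 'I_3 -> gal_of (realSubfield zeta).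
Hypothesis hF : is_Q_zeta9 iota zeta.
Local Notation C := (Cplx R).
Local Notation u := (iota zeta).
Local Notation K := (realSubfield zeta).
Local Notation lat := {ffun 'I_6 -> int}.
Variables (E : 'I_3 -> {rmorphism F -> C}) (k : 'I_3 -> nat).
Hypothesis Ez : forall l, E l zeta = u ^+ k l.
Hypothesis Es : forall l x, x \in K -> iota (sigma l x) = E l x.
Hypothesis Esum : forall (V : nmodType) (h : nat -> V), {in units9, forall j, h (9 - j)%N = h j} ->
        \sum_l h (k l) = h 1%N + h 2 + h 4.
Hypothesis ku : forall l, k l \in units9.
Hypothesis Etr : forall x, iota (galTrace 1 fullv x) = trF E x.
Local Notation combL := (comb_basis zeta).
Local Notation pL := (emb_basis zeta E).
Local Notation qL := (emb_basisC zeta E).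
Local Notation pD := (emb_dual zeta E).
Local Notation qD := (emb_dualC zeta E).

Local Notation TH := (coset_theta zeta E).
Local Notation H3 := (@upperHalfPlane3 R).
Local Notation V := 'rV[C]_3.

(** Room around a point of the upper half plane on which the bounds of
gauss_dom are uniform. *)
Lemma H3_ball z : H3 z -> exists2 dl : R, 0 < dl & exists2 c1 : R, 0 < c1 & exists W : R,
  forall h : V, nrm h < dl -> (forall l, c1 <= complex.Im ((h + z) 0 l)) /\ (forall l, md ((h + z) 0 l) <= W).
Proof.
move=> hz; have [c1 c10 hc1] := exists_lb hz; have [W W0 hW] := exists_ub (z 0).
exists (Num.min 1 (c1 / 2)); first by rewrite lt_min ltr01 divr_gt0.
exists (c1 / 2); first exact: divr_gt0.
exists (W + 1) => h; rewrite lt_min => /andP[h1 h2]; split=> l; rewrite mxE.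
  have h3 := le_trans (Im_md (h 0 l)) (coord_le h l); have h4 := hc1 l.
  rewrite ImD; have := ler_norm (- complex.Im (h 0 l)); rewrite normrN; lra.
have := mdD (h 0 l) (z 0 l); have := coord_le h l; have := hW l; lra.
Qed.

(** Termwise application of cexp_bnd2. The squares of the linear coefficients
grow like the fourth power of the lattice point, which the factor tau (1 +
|x|)^2 to the third power in gauss_dom absorbs. *)
Lemma coset_theta_quad a z : H3 z -> exists S : 'I_3 -> C, exists dl Q : R, [/\ 0 < dl, 0 <= Q &
  forall h : V, nrm h < dl -> H3 (h + z) /\
    md (TH a (h + z) - TH a z - \sum_l h 0 l * S l) <= Q * nrm h ^+ 2].
Proof.
move=> hz; have [dl dl0 [c1 c10 [Wb hball]]] := H3_ball hz.
have [Hpq Hqp Hpp Hqq] := pair2 hF Ez Esum ku.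
pose x := cosetRep zeta a; pose Pt (c : lat) := gridpt R 1 c.
have [Sx Sx0 hSx] := exists_ub (fun l => E l x).
pose B := coef_bound pL qL pD qD; have B0 : 0 <= B by exact: bb_ge0.
pose pm := md (Complex 0 pi : C); have pm0 : 0 <= pm by exact: md_ge0.
pose M := pm * (2 * (B + Sx) ^+ 2).
have M0 : 0 <= M by exact: (mulr_ge0 pm0 (mulr_ge0 (ler0n _ 2) (sqr_ge0 _))).
pose tau := 1 + M + 9 * M ^+ 2.
have t1 : 1 <= tau by rewrite /tau; have := sqr_ge0 M; lra.
have t0 : 0 <= tau by lra.
have [Kb K0 hK] := @gauss_dom _ _ _ pL qL pD qD (fun i l => erefl) (pair1 hF Ez Esum ku) c1 Wb Sx tau c10 t0.
have hG (w : V) c : (forall l, c1 <= complex.Im (w 0 l)) -> (forall l, md (w 0 l) <= Wb) ->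
   (tau * (1 + norm1 (Pt c)) ^+ 2) ^+ 3 * md (theta_term E w (x + combL c)) <= Kb * wt (Pt c).
  move=> w1 w2; rewrite (tt_EE zeta E w x c); apply: hK => // l; by rewrite md_conj.
have n0 c : 0 <= norm1 (Pt c) by exact: norm1_ge0.
pose A l (c : lat) : C := (Complex 0 pi : C) * (2 * (E l (x + combL c) * (E l (x + combL c))^*)).
have hA l c : md (A l c) <= M * (1 + norm1 (Pt c)) ^+ 2.
  have hl : md (E l (x + combL c)) <= (B + Sx) * (1 + norm1 (Pt c)).
    rewrite rmorphD; apply: le_trans (mdD _ _) _.
    have -> : E l (combL c) = lincomb pL (Pt c) l.
      by rewrite /lincomb E_comb; apply: eq_bigr => i _; rewrite /Pt /gridpt divr1 /RC rmorph_int.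
    have h1 := linp_bnd pL qL pD qD (Pt c) l; have h2 := hSx l; rewrite -/B in h1.
    have := mulr_ge0 Sx0 (n0 c); lra.
  rewrite /A mulconj mdM -/pm (mdM 2) -(RCn R 2) !mdRC ger0_norm // ger0_norm ?sqr_ge0 //.
  have h3 : md (E l (x + combL c)) ^+ 2 <= ((B + Sx) * (1 + norm1 (Pt c))) ^+ 2.
    by rewrite lerXn2r ?nnegrE ?md_ge0 // (le_trans (md_ge0 _) hl).
  rewrite exprMn in h3.
  have -> : M * (1 + norm1 (Pt c)) ^+ 2 = pm * (2 * ((B + Sx) ^+ 2 * (1 + norm1 (Pt c)) ^+ 2)) by rewrite /M; ring.
  by apply: ler_wpM2l => //; apply: ler_wpM2l.
pose N c : R := (1 + norm1 (Pt c)) ^+ 2.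
have N1 c : 1 <= N c by rewrite /N expr_ge1 ?addr_ge0 // lerDl.
have pw c (m : R) : 0 <= m -> m <= tau -> m * N c ^+ 2 <= (tau * N c) ^+ 3.
  move=> m0 mt; have n1 := N1 c.
  have -> : (tau * N c) ^+ 3 = (tau * N c) ^+ 2 * (tau * N c) by ring.
  have a1 : m * N c ^+ 2 <= tau * N c ^+ 2 by rewrite ler_wpM2r ?sqr_ge0.
  apply: (le_trans a1); rewrite [(tau * N c) ^+ 2]exprMn.
  have a2 : tau <= tau ^+ 2 by rewrite expr2 ler_peMr.
  have a3 : tau * N c ^+ 2 <= tau ^+ 2 * N c ^+ 2 by rewrite ler_wpM2r ?sqr_ge0.
  apply: (le_trans a3); rewrite -[X in X <= _]mulr1; apply: ler_wpM2l; first exact: (mulr_ge0 (sqr_ge0 _) (sqr_ge0 _)).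
  by rewrite -[1]mulr1; apply: ler_pM.
have hG1 (w : V) c (m : R) : 0 <= m -> m <= tau -> (forall l, c1 <= complex.Im (w 0 l)) -> (forall l, md (w 0 l) <= Wb) ->
   m * N c ^+ 2 * md (theta_term E w (x + combL c)) <= Kb * wt (Pt c).
  move=> m0 mt w1 w2; apply: le_trans (hG w c w1 w2); apply: ler_wpM2r; [exact: md_ge0|exact: pw].
have bO : bsum (fun c : lat => wt (Pt c)) ((4 * 1%:R) ^+ 6) by exact: bsum_wt.
have [z1 z2] : (forall l, c1 <= complex.Im (z 0 l)) /\ (forall l, md (z 0 l) <= Wb).
  by have := hball 0; rewrite add0r; apply; rewrite /nrm normr0.
have aA l : asum (fun c => A l c * theta_term E z (x + combL c)).
  apply: (asum_le (bsumZ (ltW K0) bO)) => c; rewrite mdM.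
  apply: le_trans (hG1 z c M M0 _ z1 z2); last by rewrite /tau; have := sqr_ge0 M; lra.
  apply: ler_wpM2r; first exact: md_ge0.
  apply: le_trans (hA l c) _; rewrite -/(N c); apply: ler_wpM2l => //.
  by rewrite expr2 ler_peMr //; apply: le_trans (N1 c).
exists (fun l => summability.sum ((fun c : lat => A l c * theta_term E z (x + combL c)) : lat -> C)).
exists dl, (16 * (Kb * (4 * 1%:R) ^+ 6)); split=> //.
  by apply: mulr_ge0 => //; apply: mulr_ge0; [exact: ltW|apply: exprn_ge0; lra].
move=> h hd; have [w1 w2] := hball h hd.
have hw : H3 (h + z) by move=> l; apply: lt_le_trans (w1 l).
split=> //.
have a1 := asum_tt hF Ez Esum ku x hw; have a2 := asum_tt hF Ez Esum ku x hz.
rewrite /coset_theta -/x -(sumB a1 a2).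
have a3 : asum (fun c => \sum_l h 0 l * (A l c * theta_term E z (x + combL c))).
  by apply: asum_big => l; apply: asumZ.
have e3 : \sum_l h 0 l * summability.sum ((fun c : lat => A l c * theta_term E z (x + combL c)) : lat -> C) =
    summability.sum ((fun c : lat => \sum_l h 0 l * (A l c * theta_term E z (x + combL c))) : lat -> C).
  rewrite (@sum_big _ _ _ _ _ (fun l c => h 0 l * (A l c * theta_term E z (x + combL c)))); last by move=> l _; apply: asumZ.
  by apply: eq_bigr => l _; rewrite sumZ.
have aB : asum (fun c => theta_term E (h + z) (x + combL c) - theta_term E z (x + combL c)).
  have := asumD a1 (asumZ (-1) a2); congr asum; by apply/funext => c; rewrite mulN1r.
rewrite e3 -(sumB aB a3); set r := nrm h; have r0 : 0 <= r by apply: le_trans (coord_le h 0); exact: md_ge0.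
have -> : 16 * (Kb * (4 * 1%:R) ^+ 6) * r ^+ 2 = (16 * r ^+ 2) * (Kb * (4 * 1%:R) ^+ 6) by ring.
have r2 : 0 <= 16 * r ^+ 2 by apply: mulr_ge0 => //; exact: sqr_ge0.
apply: md_sum_le; apply: bsum_le (bsumZ r2 (bsumZ (ltW K0) bO)) => c.
pose aa := \sum_l h 0 l * A l c.
have -> : theta_term E (h + z) (x + combL c) = theta_term E z (x + combL c) * cexp aa.
  rewrite /theta_term -cexpD; congr cexp; rewrite /qform /aa /A !mulr_sumr -big_split /=; apply: eq_bigr => l _.
  by rewrite mxE; ring.
set T := theta_term E z (x + combL c).
have -> : T * cexp aa - T - \sum_l h 0 l * (A l c * T) = T * (cexp aa - 1 - aa).
  have -> : \sum_l h 0 l * (A l c * T) = aa * T by rewrite mulr_suml; apply: eq_bigr => l _; rewrite mulrA.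
  by ring.
have haa : md aa <= 3 * (r * (M * N c)).
  by apply: sum_bnd => l; rewrite mdM; apply: ler_pM; rewrite ?md_ge0 ?coord_le ?hA.
have haa2 : md aa ^+ 2 <= 9 * M ^+ 2 * N c ^+ 2 * r ^+ 2.
  apply: (le_trans (y := (3 * (r * (M * N c))) ^+ 2)); last by (have -> : (3 * (r * (M * N c))) ^+ 2 = 9 * M ^+ 2 * N c ^+ 2 * r ^+ 2 by ring).
  by rewrite lerXn2r ?nnegrE ?md_ge0 // (le_trans (md_ge0 _) haa).
have h1 := hG1 z c (9 * M ^+ 2) _ _ z1 z2.
have h2 := hG1 (h + z) c (9 * M ^+ 2) _ _ w1 w2.
have m9 : 0 <= 9 * M ^+ 2 by apply: mulr_ge0 => //; exact: sqr_ge0.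
have m9t : 9 * M ^+ 2 <= tau by rewrite /tau; lra.
have {}h1 := h1 m9 m9t; have {}h2 := h2 m9 m9t.
have e4 : theta_term E (h + z) (x + combL c) = T * cexp aa.
  rewrite /T /theta_term -cexpD; congr cexp; rewrite /qform /aa /A !mulr_sumr -big_split /=; apply: eq_bigr => l _.
  by rewrite mxE; ring.
rewrite e4 mdM -/T in h1 h2; rewrite mdM.
apply: (le_trans (y := md T * (8 * md aa ^+ 2 * (1 + md (cexp aa))))).
  by apply: ler_wpM2l; [exact: md_ge0|exact: cexp_bnd2].
have t0' := md_ge0 T; have c0' := md_ge0 (cexp aa).
have tc : 0 <= md T * (1 + md (cexp aa)) by apply: mulr_ge0 => //; lra.
have := ler_wpM2r tc haa2; have r20 : 0 <= r ^+ 2 := sqr_ge0 _.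
have := ler_wpM2r r20 h1; have := ler_wpM2r r20 h2.
move: (md T) (md (cexp aa)) (md aa ^+ 2) (9 * M ^+ 2 * N c ^+ 2) (r ^+ 2) (Kb * wt (Pt c)) => t' c' a' m' rr O'.
by nra.
Qed.

Lemma coset_theta_differentiable a z : H3 z -> differentiable (TH a) z.
Proof.
move=> hz; have [S [dl [Q [dl0 Q0 h]]]] := coset_theta_quad a hz.
by apply: (differentiable_quad dl0 Q0) => y hy; exact: (h y hy).2.
Qed.

Lemma H3_differentiable (f g : V -> C) z : (forall y, H3 y -> f y = g y) -> H3 z ->
  differentiable g z -> differentiable f z.
Proof.
move=> fg hz; have [dl dl0 [c1 c10 [Wb hb]]] := H3_ball hz.
apply: (near_differentiable dl0) => h hd; apply: fg => l.
by have [h1 _] := hb h hd; apply: lt_le_trans (h1 l).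
Qed.

End Holomorphy.

(** * Modularity *)

Theorem theorem4p8 (R : realType) (F : splittingFieldType rat)
    (iota : {rmorphism F -> Cplx R}) (zeta : F)
    (sigma : 'I_3 -> gal_of (realSubfield zeta))
    (hF : is_Q_zeta9 iota zeta) (hsigma : is_gal_enum sigma)
    (n : nat) (hn : (1 <= n)%N)
    (C : {vspace 'rV['F_3]_n}) (hC : euclideanSelfDual C) :
  (forall a : 'I_3, (a < 2)%N ->
     isHilbertModularForm iota sigma 1 (GammaLevel zeta (levelIdeal zeta))
       (theta iota sigma a)) /\
  isHilbertModularForm iota sigma n (SL2_ZK zeta) (thetaCode iota sigma C).
Proof.
have [E [k [Ez Es Esum ku Etr]]] := embeddings hF hsigma.
have [c0 [hc1 hc2 hST]] := S_transform hF Ez Esum ku Etr.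
have hmob M z : SL2_ZK zeta M ->
    moebius iota sigma M z = moebiusE E (M 0 0) (M 0 1) (M 1 0) (M 1 1) z /\
    normFactor iota sigma M z = factorE E (M 1 0) (M 1 1) z.
  move=> [hM _]; have hK i j : M i j \in realSubfield zeta by have [] := hM i j.
  split; first by apply/rowP => l; rewrite !mxE !(Es _ _ (hK _ _)).
  by rewrite /normFactor; apply: eq_bigr => l _; rewrite !(Es _ _ (hK _ _)).
have hdet (M : 'M[F]_2) : SL2_ZK zeta M -> M 0 0 * M 1 1 - M 0 1 * M 1 0 = 1.
  move=> [_ <-]; rewrite (expand_det_row _ 0) !big_ord_recl big_ord0 addr0 /cofactor !det_mx11 !mxE.
  rewrite /= expr0 expr1 mul1r mulN1r mulrN; congr (M _ _ * M _ _ - M _ _ * M _ _); exact: val_inj.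
have hL x : levelIdeal zeta x -> residue zeta x 0.
  move=> [y [_ yi] <-]; exists ((1 - zeta^-1) * y); last by rewrite add0r mulrA.
  apply: (ZinM hF); last exact: (Zin_of_aint hF Ez Esum ku yi).
  by rewrite (zetaV hF); apply: ZinB; [exact: Zin1|exact: (Zin_zeta hF)].
have hL1 x : levelIdeal zeta (x - 1) -> residue zeta x 1.
  move=> /hL h; have -> : x = (x - 1) + 1 by ring.
  exact: (residueD (a := 0) (b := 1) h (residue_int zeta 1)).
split=> [a a2|]; split.
- move=> z hz; apply: (H3_differentiable (g := coset_theta zeta E a)) => //.
    by move=> y hy; exact: (thetaE hF Ez Es Esum ku).
  exact: (coset_theta_differentiable hF Ez Esum ku).
- move=> M [hM l00 l11 l01 l10] z hz; have [-> ->] := hmob M z hM.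
  have [hO _] := hM.
  have [h1 h2] := level_coset_theta hF Ez Esum ku hc1 hc2 hST (hO _ _) (hO _ _) (hO _ _) (hO _ _) (hdet M hM)
    (hL1 _ l00) (hL _ l01) (hL _ l10) (hL1 _ l11) hz.
  by rewrite expr1 !(thetaE hF Ez Es Esum ku) // h2.
- move=> z hz; apply: (H3_differentiable (g := code_theta zeta E C)) => //.
    by move=> y hy; exact: (thetaCodeE hF Ez Es Esum ku Etr).
  apply: differentiable_bigsum => v; apply: differentiable_bigprod => i.
  exact: (coset_theta_differentiable hF Ez Esum ku).
- move=> M hM z hz; have [-> ->] := hmob M z hM; have [hO _] := hM.
  have [h1 h2] := code_theta_mob hF Ez Esum ku hST hC (hO _ _) (hO _ _) (hO _ _) (hO _ _) (hdet M hM) hz.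
  by rewrite !(thetaCodeE hF Ez Es Esum ku Etr).
Qed.
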